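(* Let $0<a<1$, $b>0$ and $H\in(1,3/2)$. Oscillatory negative sub-fractional Brownian motion $\zeta^H$ with parameter $H$ has a representation $$\zeta^H_t=\int_0^t\varrho^{H-1}_u\,du,\quad t\ge0,$$ where, for $U\in(0,1/2)$, $\varrho^U$ is a continuous centered Gaussian process with covariance $$E\varrho^U_s\varrho^U_t=\frac12\left[(s+t)^{2U}\,\tilde{\tilde h}^U_{s+t}-|s-t|^{2U}\,\tilde{\tilde h}^U_{|s-t|}\right],\quad s,t\ge0,$$ and $$\tilde{\tilde h}^U_t=\sum_{j\in\mathbb Z}(ba^jt)^{-2U}(1-e^{-ba^jt}),\quad t>0$$ (with the convention $0^{2U}\tilde{\tilde h}^U_0=0$).
   Context: Fix constants $0<a<1$ and $b>0$. Oscillatory negative sub-fractional Brownian motion (onsfBm) with parameter $H\in(1,3/2)$ is a centered Gaussian process $(\zeta^H_t)_{t\ge0}$ with covariance $$E\zeta^H_s\zeta^H_t=s^{2H}\widetilde h_s+t^{2H}\widetilde h_t-\tfrac12\left[(s+t)^{2H}\widetilde h_{s+t}+|s-t|^{2H}\widetilde h_{|s-t|}\right],\quad s,t\ge0,$$ where $\widetilde h_t=\sum_{j\in\mathbb Z}(ba^jt)^{-2H}\left(e^{-ba^jt}-1+ba^jt-\frac12(ba^jt)^2\right)$ for $t>0$, with the convention $0^{2H}\widetilde h_0=0$. ''Has a representation'' means that a process $\varrho^{H-1}$ as described exists and that $\int_0^t\varrho^{H-1}_u\,du$, $t\ge 0$, is an onsfBm with parameter $H$. *)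

(* Defs.v *)
From HB Require Import structures.
From mathcomp Require Import all_boot all_order all_algebra.
From mathcomp Require Import all_classical all_reals all_analysis.

Set Implicit Arguments.
Unset Strict Implicit.
Unset Printing Implicit Defensive.

Import Order.TTheory GRing.Theory Num.Theory.
Import numFieldNormedType.Exports.

Local Open Scope classical_set_scope.
Local Open Scope ring_scope.

(* Two-sided series; [Negz n] is the integer [- n.+1]. The two halves converge
   separately, so no cancellation at infinity between them is allowed. *)
Definition sumZ (R : realType) (f : int -> R) : R :=
  limn (series (fun n : nat => f (Posz n))) +
  limn (series (fun n : nat => f (Negz n))).

(* [powR] gives [0 `^ p = 0] for [p != 0], so the products
   [t `^ (2 * H) * onsfbm_h a b H t] and [t `^ (2 * U) * rho_h a b U t] used
   below vanish at [t = 0] as soon as [H != 0], resp. [U != 0]. *)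
Definition onsfbm_h (R : realType) (a b H t : R) : R :=
  sumZ (fun j : int => let x := b * a ^ j * t in
    x `^ (- (2 * H)) * (expR (- x) - 1 + x - 2^-1 * x ^+ 2)).

Definition rho_h (R : realType) (a b U t : R) : R :=
  sumZ (fun j : int => let x := b * a ^ j * t in
    x `^ (- (2 * U)) * (1 - expR (- x))).

Definition onsfbm_cov (R : realType) (a b H s t : R) : R :=
  s `^ (2 * H) * onsfbm_h a b H s + t `^ (2 * H) * onsfbm_h a b H t
  - 2^-1 * ((s + t) `^ (2 * H) * onsfbm_h a b H (s + t)
            + `|s - t| `^ (2 * H) * onsfbm_h a b H `|s - t|).

Definition rho_cov (R : realType) (a b U s t : R) : R :=
  2^-1 * ((s + t) `^ (2 * U) * rho_h a b U (s + t)
          - `|s - t| `^ (2 * U) * rho_h a b U `|s - t|).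

(* A possibly degenerate Gaussian law. The case of zero variance has to be
   separate: [normal_prob m 0] is the uniform law on [0, 1]. *)
Definition gaussian_rv (R : realType) (d : measure_display)
    (T : measurableType d) (P : probability T R) (X : T -> R) : Prop :=
  measurable_fun [set: T] X /\
  exists m : R,
    (exists2 s : R, s != 0 &
       forall B : set R, measurable B -> pushforward P X B = normal_prob m s B)
    \/ (forall B : set R, measurable B -> pushforward P X B = \d_m B).

(* Processes are indexed by [0, +oo[; values at negative times are irrelevant. *)
Definition gaussian_process (R : realType) (d : measure_display)
    (T : measurableType d) (P : probability T R) (X : R -> T -> R) : Prop :=
  forall (n : nat) (t c : 'I_n -> R), (forall i, 0 <= t i) ->
    gaussian_rv P (fun w => \sum_(i < n) c i * X (t i) w).

Definition centered_gaussian_process (R : realType) (d : measure_display)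
    (T : measurableType d) (P : probability T R) (K : R -> R -> R)
    (X : R -> T -> R) : Prop :=
  [/\ gaussian_process P X,
      (forall t : R, 0 <= t -> ('E_P[X t] = 0)%E) &
      (forall s t : R, 0 <= s -> 0 <= t ->
         ('E_P[(fun w => X s w * X t w)%R] = (K s t)%:E)%E)].

Definition continuous_process (R : realType) (d : measure_display)
    (T : measurableType d) (X : R -> T -> R) : Prop :=
  forall w : T, {within `[0, +oo[, continuous (fun t : R => X t w)}.

Definition onsfbm (R : realType) (d : measure_display)
    (T : measurableType d) (P : probability T R) (a b H : R)
    (X : R -> T -> R) : Prop :=
  centered_gaussian_process P (onsfbm_cov a b H) X.

Definition rho_process (R : realType) (d : measure_display)
    (T : measurableType d) (P : probability T R) (a b U : R)
    (X : R -> T -> R) : Prop :=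
  continuous_process X /\ centered_gaussian_process P (rho_cov a b U) X.

(* Main.v *)
(** The covariance of rho is, up to the positive weights c^(-2U), a sum over the
frequencies c = b a^j of 1/2 (e^(-c|s-t|) - e^(-c(s+t))) = e^(-cs) e^(-ct)
min(m(s), m(t)) with m(s) = (e^(2cs) - 1)/2 nondecreasing, hence it is positive
semidefinite. With F(x) = sum_j c^(-2U) (1 - e^(-cx)), its oscillation between
(s, t) and (s', t') is at most F(|s-s'| + |t-t'|), and F(x) = O(x + x^U).

A Gaussian process with such a covariance is obtained on [0, 1]: the binary
digits of a uniform variable yield independent uniform variables, quantiles turn
them into standard normal ones, and the Cholesky factorisation of the covariance
gives a Gaussian family indexed by the rationals. Chaining along the dyadic grids
makes its paths uniformly continuous on bounded intervals almost surely, and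
everywhere after replacing the other paths by 0.

The integrals of a path are limits of Riemann sums, whose joint laws are centered
Gaussian; so it remains to see that the double Riemann sums of rho_cov converge
to onsfbm_cov, that is, that rho_cov is the mixed second derivative of onsfbm_cov.
On a cell of sides h and k the two differ by at most h k F(h + k), as follows
from the mean value theorem applied to each frequency: the even extension of
c^(-2H) (e^(-cx) - 1 + cx - (cx)^2/2) has second derivative - c^(-2U) (1 - e^(-c|x|)). *)

From HB Require Import structures.
Require Import Defs.
From mathcomp Require Import all_boot all_order all_algebra.
From mathcomp Require Import all_classical all_reals all_analysis.
From mathcomp Require Import measurable_realfun ring lra zify.

Import Order.TTheory GRing.Theory Num.Theory.
Import numFieldNormedType.Exports.

Local Open Scope classical_set_scope.
Local Open Scope ring_scope.

Set Implicit Arguments.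
Unset Strict Implicit.
Unset Printing Implicit Defensive.

(** * Normal laws *)

(** Joint laws are never handled as such: [glaw] concerns one real variable, [gaussian_family] asks
    it of every finite linear combination, and covariances come back by polarisation. Since [glaw]
    is stable under pointwise limits, both the process at real times and its integral may be defined
    path by path as limits; what remains to check is the convergence of a quadratic form in the
    kernel. Continuity and limits must hold at every sample point: hence the indexing by rationals,
    for which the nested grids agree everywhere and not just almost surely, and the indicator of the
    regular paths. Chaining uses exponential moments because the power moment that would suffice
    depends on U and grows as U tends to 0; a single integrable variable controls all bounded
    intervals at once, the 4^n cells of length 2^-n at level n covering [0, 2^n]. In the sum over
    frequencies two regimes are kept apart: terms with j >= 0, where the frequencies tend to 0, are
    at most linear in x, the others are bounded by a multiple of x^U. *)

Lemma law_eq_rays (R : realType) d1 d2 (T1 : measurableType d1)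
    (T2 : measurableType d2) (P1 : probability T1 R) (P2 : probability T2 R)
    (X1 : T1 -> R) (X2 : T2 -> R) :
  measurable_fun setT X1 -> measurable_fun setT X2 ->
  (forall x : R, P1 [set w | x < X1 w] = P2 [set w | x < X2 w]) ->
  forall A : set R, measurable A -> P1 (X1 @^-1` A) = P2 (X2 @^-1` A).
Proof.
move=> mX1 mX2 P12 A mA.
have mY1 : @measurable_fun _ _ T1 (measurableTypeR R) setT X1 by exact: mX1.
pose Y1 : {mfun T1 >-> measurableTypeR R} :=
  HB.pack (X1 : T1 -> measurableTypeR R) (isMeasurableFun.Build _ _ _ (measurableTypeR R) X1 mY1).
have mY2 : @measurable_fun _ _ T2 (measurableTypeR R) setT X2 by exact: mX2.
pose Y2 : {mfun T2 >-> measurableTypeR R} :=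
  HB.pack (X2 : T2 -> measurableTypeR R) (isMeasurableFun.Build _ _ _ (measurableTypeR R) X2 mY2).
change (distribution P1 Y1 A = distribution P2 Y2 A).
apply: (@measure_unique _ _ (measurableTypeR R) (@RGenOInfty.G R)
  (fun n : nat => `]- n%:R, +oo[%classic) _ _ _ _ (distribution P1 Y1) (distribution P2 Y2)) => //.
- exact: RGenOInfty.measurableE.
- move=> _ _ [x ->] [y ->]; exists (Num.max x y).
  by apply/seteqP; split => z /=; rewrite !in_itv/= !andbT gt_max => /andP.
- by move=> i; eexists.
- apply/seteqP; split => // x _; exists (Num.bound `|x|) => //=.
  rewrite in_itv/= andbT ltrNl (le_lt_trans (ler_norm _))// normrN.
  exact: archi_boundP.
- move=> B [x ->]; have := P12 x.
  rewrite /distribution /pushforward/=.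
  by congr (_ = _); congr (_ _); apply/seteqP; split => w /=; rewrite ?in_itv/= ?andbT.
- by move=> k; rewrite (le_lt_trans (probability_le1 _ _))// ltry.
Qed.

(** The Radon-Nikodym derivative of [normal_prob m s] is known only up to null sets; it equals
    [normal_pdf] almost everywhere because both have the same integral over every measurable set. *)
Lemma ge0_integral_normal_prob (R : realType) (m s : R) (f : R -> \bar R) :
  measurable_fun setT f -> (forall x, 0 <= f x)%E ->
  (\int[normal_prob m s]_x f x
   = \int[lebesgue_measure]_x (f x * (normal_pdf m s x)%:E))%E.
Proof.
move=> mf f0.
have dom := normal_prob_dominates m s.
rewrite -(Radon_Nikodym_SigmaFinite.change_of_variables dom f0)//.
apply: ge0_ae_eq_integral => //.
- apply: emeasurable_funM => //.
  exact: measurable_int (Radon_Nikodym_SigmaFinite.f_integrable dom).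
- apply: emeasurable_funM => //; apply/measurable_EFinP.
  exact: measurable_normal_pdf.
- by move=> x _; rewrite mule_ge0// Radon_Nikodym_SigmaFinite.f_ge0.
- by move=> x _; rewrite mule_ge0// lee_fin normal_pdf_ge0.
- apply: ae_eqe_mul2l.
  apply: integral_ae_eq => //.
  + exact: Radon_Nikodym_SigmaFinite.f_integrable.
  + by apply/measurable_EFinP; exact: measurable_normal_pdf.
  + by move=> A _ mA; rewrite -Radon_Nikodym_SigmaFinite.f_integral.
Qed.

(** Affine substitution in the density, carried out on rays only, which determine the law. *)
Lemma normal_prob_affine (R : realType) (m s : R) (A : set R) :
  0 < s -> measurable A ->
  normal_prob m s A = normal_prob 0 1 ((fun z : R => m + s * z) @^-1` A).
Proof.
move=> s0 mA.
have mF : measurable_fun setT (fun z : measurableTypeR R => (m + s * z : measurableTypeR R)).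
  by apply: measurable_funD => //; exact: measurable_funM.
apply: (@law_eq_rays _ _ _ (measurableTypeR R) (measurableTypeR R)
  (normal_prob m s) (normal_prob 0 1) id _ (@measurable_id _ _ _) mF) => // x.
pose F (z : R^o) : R^o := m + s * z.
have F'E : F^`()%classic = cst s.
  apply/funext => z; rewrite /F derive1E deriveD// derive_cst add0r deriveM// derive_id.
  by rewrite derive_cst scaler0 addr0 /GRing.scale/= mulr1.
have xE : x = F ((x - m) / s) by rewrite /F; field; rewrite gt_eqF.
have -> : [set w | x < id w] = `]x, +oo[%classic.
  by apply/seteqP; split => z/=; rewrite in_itv/= andbT.
have -> : [set w | x < m + s * w] = `](x - m) / s, +oo[%classic.
  by apply/seteqP; split => z/=; rewrite in_itv/= andbT ltr_pdivrMr// ltrBlDl mulrC.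
rewrite /normal_prob [LHS]integral_itv_obnd_cbnd; last first.
  by apply/measurable_EFinP/measurable_funTS; exact: measurable_normal_pdf.
rewrite [RHS]integral_itv_obnd_cbnd; last first.
  by apply/measurable_EFinP/measurable_funTS; exact: measurable_normal_pdf.
have cF : continuous F.
  by move=> z; apply: cvgD; [exact: cvg_cst|apply: cvgMr; exact: cvg_id].
rewrite {1}xE increasing_ge0_integration_by_substitutiony.
- apply: eq_integral => z _; congr (_%:E).
  rewrite F'E /= !fctE !normal_pdfE ?oner_eq0 ?gt_eqF// /F /normal_fun /normal_peak.
  have -> : (m + s * z - m) ^+ 2 = s ^+ 2 * z ^+ 2 by ring.
  rewrite !expr1n mul1r subr0.
  have -> : - (s ^+ 2 * z ^+ 2) / (s ^+ 2 *+ 2) = - z ^+ 2 / (1 *+ 2).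
    by field; rewrite gt_eqF//= pnatr_eq0.
  rewrite -mulrnAr sqrtrM ?sqr_ge0// sqrtr_sqr gtr0_norm//.
  rewrite mulrAC; congr (_ * _); rewrite invfM mulrAC mulVf ?mul1r// gt_eqF//.
- by move=> y z _ _ yz; rewrite /F ltrD2l ltr_pM2l.
- by rewrite F'E => y _; exact: cvg_cst.
- by rewrite F'E; exact: is_cvg_cst.
- by rewrite F'E; exact: is_cvg_cst.
- split; first by move=> y _; apply: derivableD => //; exact: derivableM.
  by apply: cvg_at_right_filter; exact: cF.
- apply/cvgryPge => A0; near=> y.
  rewrite /F -lerBlDl -ler_pdivrMl//; near: y; exact: nbhs_pinfty_ge.
- by apply: continuous_subspaceT; apply: continuous_normal_pdf; rewrite gt_eqF.
- by move=> y _; exact: normal_pdf_ge0.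
Unshelve. all: by end_near. Qed.

Lemma measurable_normal_pdf_shift (R : realType) (m t : R) : t != 0 ->
  measurable_fun setT (fun p : R * R => normal_pdf (m * p.1) t p.2).
Proof.
move=> t0; under eq_fun do rewrite normal_pdfE//.
apply: measurable_funM => //; apply: measurableT_comp => //.
apply: measurable_funM => //; apply: measurableT_comp => //.
apply: measurable_funX; apply: measurable_funB => //.
exact: measurable_funM.
Qed.

Lemma normal_prob_indic (R : realType) (m t : R) (A : set R) :
  normal_prob m t A = (\int[lebesgue_measure]_z (normal_pdf m t z * \1_A z)%:E)%E.
Proof.
rewrite /normal_prob integral_mkcond/=.
apply: eq_integral => z _; rewrite patchE indicE.
by case: ifPn => zA; rewrite ?mulr1// mulr0.
Qed.

Lemma measurable_normal_prob (R : realType) (a b : R) (A : set R) :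
  b != 0 -> measurable A ->
  measurable_fun setT (fun x : R => normal_prob (a * x) b A).
Proof.
move=> b0 mA; under eq_fun do rewrite normal_prob_indic.
pose h p : \bar R := (normal_pdf (a * p.1) b p.2 * \1_A p.2)%:E.
apply: (@measurable_fun_fubini_tonelli_F _ _ _ _ _ lebesgue_measure h).
  apply/measurable_EFinP; apply: measurable_funM.
    exact: measurable_normal_pdf_shift.
  by apply: measurableT_comp => //; exact: measurable_indic.
by move=> p; rewrite lee_fin mulr_ge0// normal_pdf_ge0.
Qed.

(** Bayes' formula for a normal pair: the density of z given x times that of x equals the density of
    x given z, with mean a z / s^2 and deviation b / s, times that of z. Tonelli then integrates x
    out. *)
Lemma normal_convolution (R : realType) (a b : R) (A : set R) :
  0 < b -> measurable A ->
  (\int[normal_prob 0 1]_x normal_prob (a * x)%R b A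
  = normal_prob 0 (Num.sqrt (a ^+ 2 + b ^+ 2)) A)%E.
Proof.
move=> b0 mA.
have [s sE] : exists s, s = Num.sqrt (a ^+ 2 + b ^+ 2) by eexists.
rewrite -sE.
have s2 : s ^+ 2 = a ^+ 2 + b ^+ 2 by rewrite sE sqr_sqrtr// addr_ge0// sqr_ge0.
have s0 : 0 < s by rewrite sE sqrtr_gt0 ltr_wpDl ?sqr_ge0// exprn_gt0.
have peakM : normal_peak b * normal_peak 1 = normal_peak s * normal_peak (b / s).
  rewrite /normal_peak -!invfM -!sqrtrM; last 2 first.
  - by rewrite mulrn_wge0// mulr_ge0 ?sqr_ge0 ?pi_ge0.
  - by rewrite mulrn_wge0// mulr_ge0 ?sqr_ge0 ?pi_ge0.
  by congr (Num.sqrt _)^-1; field; rewrite gt_eqF.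
have key x z : normal_pdf (a * x) b z * normal_pdf 0 1 x =
   normal_pdf (a * z / s ^+ 2) (b / s) x * normal_pdf 0 s z.
  rewrite !normal_pdfE ?gt_eqF ?divr_gt0//.
  rewrite mulrACA peakM [RHS]mulrACA (mulrC (normal_peak s)); congr (_ * _).
  rewrite /normal_fun -!expRD; congr expR.
  have b2 : b ^+ 2 = s ^+ 2 - a ^+ 2 by rewrite s2 addrAC subrr add0r.
  rewrite !expr_div_n !subr0 b2.
  field; rewrite -b2 !gt_eqF//=.
  by rewrite exprn_gt0.
pose g (p : R * R) : \bar R := (normal_pdf (a * p.1) b p.2 * normal_pdf 0 1 p.1 * \1_A p.2)%:E.
have mg : measurable_fun setT g.
  apply/measurable_EFinP; apply: measurable_funM; first apply: measurable_funM.
  - by apply: measurable_normal_pdf_shift; rewrite gt_eqF.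
  - by apply: measurableT_comp => //; exact: measurable_normal_pdf.
  - by apply: measurableT_comp => //; exact: measurable_indic.
have g0 p : (0 <= g p)%E by rewrite lee_fin !mulr_ge0// normal_pdf_ge0.
have mh x : measurable_fun setT (fun z : R => (normal_pdf (a * x) b z * \1_A z)%:E).
  apply/measurable_EFinP; apply: measurable_funM; first exact: measurable_normal_pdf.
  exact: measurable_indic.
have E1 x : (normal_prob (a * x)%R b A * (normal_pdf 0 1 x)%:E =
   \int[lebesgue_measure]_z g (x, z))%E.
  rewrite normal_prob_indic -ge0_integralZr//; last 3 first.
  - exact: mh.
  - by move=> z _; rewrite lee_fin mulr_ge0// normal_pdf_ge0.
  - by rewrite lee_fin normal_pdf_ge0.
  by apply: eq_integral => z _; rewrite /g /= -EFinM mulrAC.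
rewrite ge0_integral_normal_prob//; last first.
  by apply: measurable_normal_prob; rewrite ?gt_eqF.
under eq_integral do rewrite E1.
rewrite (@fubini_tonelli _ _ _ _ _ lebesgue_measure lebesgue_measure g)//.
transitivity (\int[lebesgue_measure]_z ((normal_pdf 0 s z)%:E * (\1_A z)%:E))%E.
  apply: eq_integral => z _.
  transitivity (\int[lebesgue_measure]_x ((normal_pdf (a * z / s ^+ 2) (b / s) x)%:E * (normal_pdf 0 s z * \1_A z)%:E))%E.
    by apply: eq_integral => x _; rewrite /g/= key -mulrA EFinM.
  rewrite ge0_integralZr//.
  - by rewrite integral_normal_pdf mul1e EFinM.
  - by apply/measurable_EFinP; exact: measurable_normal_pdf.
  - by move=> x _; rewrite lee_fin normal_pdf_ge0.
  - by rewrite lee_fin mulr_ge0// normal_pdf_ge0.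
by rewrite normal_prob_indic; apply: eq_integral => z _; rewrite EFinM.
Qed.

Lemma integral_normal_prob (R : realType) (m s : R) (f : R -> \bar R) :
  measurable_fun setT f ->
  (\int[normal_prob m s]_x f x
   = \int[lebesgue_measure]_x (f x * (normal_pdf m s x)%:E))%E.
Proof.
move=> mf; rewrite [LHS]integralE [RHS]integralE.
rewrite !ge0_integral_normal_prob//; last 2 first.
- exact: measurable_funeneg.
- exact: measurable_funepos.
congr (_ - _)%E; apply: eq_integral => x _.
  by rewrite !funeposE maxeMl ?mul0e// lee_fin normal_pdf_ge0.
by rewrite !funenegE -mulNe maxeMl ?mul0e// lee_fin normal_pdf_ge0.
Qed.

(** Multiplying the standard density by e^(t x) gives e^(t^2 / 2) times the density centred at t. *)
Lemma normal_mgf (R : realType) (t : R) :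
  (\int[normal_prob 0 1]_x (expR (t * x))%:E = (expR (t ^+ 2 / 2))%:E)%E.
Proof.
rewrite ge0_integral_normal_prob//; last first.
  by apply/measurable_EFinP; apply: measurableT_comp => //; exact: measurable_funM.
transitivity (\int[lebesgue_measure]_x ((expR (t ^+ 2 / 2))%:E * (normal_pdf t 1 x)%:E))%E.
  apply: eq_integral => x _; rewrite -!EFinM !normal_pdfE ?oner_eq0//.
  rewrite [in LHS]mulrCA [in RHS]mulrCA; congr ((_ * _)%:E); rewrite /normal_fun -!expRD; congr expR.
  by rewrite expr1n subr0; field.
rewrite ge0_integralZl//.
- by rewrite integral_normal_pdf mule1.
- by apply/measurable_EFinP; exact: measurable_normal_pdf.
- by move=> x _; rewrite lee_fin normal_pdf_ge0.
Qed.

(** Fundamental theorem of calculus on growing symmetric intervals, then dominated convergence; the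
    boundary terms cancel in the limit. *)
Lemma integral_derive_eq0 (R : realType) (f F : R -> R) :
  (forall x, is_derive x (1 : R) F (f x)) -> continuous f ->
  F n%:R - F (- n%:R) @[n --> \oo] --> 0 ->
  lebesgue_measure.-integrable setT (EFin \o f) ->
  (\int[lebesgue_measure]_x (f x)%:E = 0)%E.
Proof.
move=> dF cf F0 intf.
have mf : measurable_fun setT f by exact: continuous_measurable_fun.
(* [n.+1] keeps the interval nondegenerate for every n. *)
pose D (n : nat) : set R := `[(- n.+1%:R), n.+1%:R]%classic.
have [|||||_ _] := @dominated_convergence _ _ _ lebesgue_measure setT measurableT
  (fun n => EFin \o (f \_ (D n))) (EFin \o f) (fun x => `|(f x)%:E|%E).
- move=> n; apply/measurable_EFinP; apply/(measurable_restrictT _ _).1.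
    exact: measurable_itv.
  exact: measurable_funTS.
- exact/measurable_EFinP.
- apply: aeW => x _; apply: cvg_near_cst.
  exists (Num.bound `|x|) => // n /= xn; rewrite /= patchE ifT// inE /D/= in_itv/=.
  rewrite -ler_norml (le_trans (ltW (archi_boundP _)))// ler_nat.
  by rewrite (leq_trans xn).
- exact: integrable_abse.
- apply: aeW => x n _; rewrite /= patchE; case: ifPn => // _.
  by rewrite normr0 lee_fin.
have E n : (\int[lebesgue_measure]_x (EFin \o f \_ (D n)) x)%E = (F n.+1%:R - F (- n.+1%:R))%:E.
  rewrite -restrict_EFin -integral_mkcond (@continuous_FTC2 _ _ F).
  - by rewrite EFinB.
  - by rewrite (@lt_trans _ _ 0)// ltrNl oppr0.
  - exact: continuous_subspaceT.
  - split.
    + by move=> x _; apply: ex_derive.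
    + by apply: cvg_at_right_filter; apply: differentiable_continuous; apply/derivable1_diffP.
    + by apply: cvg_at_left_filter; apply: differentiable_continuous; apply/derivable1_diffP.
  - by move=> x _; rewrite derive1E derive_val.
under eq_fun do rewrite E.
move=> /cvg_lim <- //; apply/cvg_lim => //.
apply: cvg_EFin; first by near=> n.
rewrite -(cvg_shiftS (fun n : nat => F n%:R - F (- n%:R))) in F0.
exact: F0.
Unshelve. all: by end_near. Qed.

(** e^|x| <= e^x + e^(-x), and both terms have expectation e^(1/2). This bound serves the
    integrability of moments and, later, the chaining. *)
Lemma normal_exp_abs (R : realType) :
  (\int[normal_prob 0 1]_x (expR `|x : R|)%:E <= (2 * expR (2^-1))%:E)%E.
Proof.
apply: (@le_trans _ _ (\int[normal_prob 0 1]_x ((expR x)%:E + (expR (- x))%:E))%E).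
  apply: ge0_le_integral => //=.
  - by apply/measurable_EFinP; apply: measurableT_comp.
  - apply: emeasurable_funD; apply/measurable_EFinP => //.
    by apply: measurableT_comp.
  - move=> x _; rewrite -EFinD lee_fin.
    by case: (ger0P x) => _; rewrite ?lerDl ?lerDr expR_ge0.
rewrite ge0_integralD//=; last 2 first.
- by apply/measurable_EFinP.
- by apply/measurable_EFinP; apply: measurableT_comp.
have := normal_mgf (1 : R); under eq_integral do rewrite mul1r.
move=> ->; have := normal_mgf (- 1 : R); under eq_integral do rewrite mulN1r.
by move=> ->; rewrite -EFinD lee_fin sqrrN expr1n mul1r mulr_natl mulr2n.
Qed.

Lemma integrable_normal_poly (R : realType) (f : R -> R) :
  continuous f -> (forall x, `|f x| <= 4 * expR `|x|) ->
  lebesgue_measure.-integrable setT (fun x => (f x * normal_pdf 0 1 x)%:E).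
Proof.
move=> cf fle.
have mf : measurable_fun setT f by exact: continuous_measurable_fun.
apply: (@le_integrable _ _ _ lebesgue_measure setT measurableT _ (fun x : R => (4%:E * ((expR `|x|)%:E * (normal_pdf 0 1 x)%:E))%E)).
- apply/measurable_EFinP; apply: measurable_funM => //.
  exact: measurable_normal_pdf.
- move=> x _; rewrite -!EFinM /= lee_fin normrM [X in _ * X <= _]ger0_norm ?normal_pdf_ge0//.
  rewrite mulrA [leRHS]ger0_norm ?mulr_ge0 ?normal_pdf_ge0 ?expR_ge0//.
  by rewrite ler_wpM2r ?normal_pdf_ge0.
apply: integrableZl => //.
apply/integrableP; split.
  apply/measurable_EFinP; apply: measurable_funM => //.
    exact: measurableT_comp.
  exact: measurable_normal_pdf.
rewrite (le_lt_trans _ (ltry (2 * expR (2^-1)))) //.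
apply: le_trans (normal_exp_abs R).
rewrite ge0_integral_normal_prob//; last first.
  by apply/measurable_EFinP; exact: measurableT_comp.
rewrite le_eqVlt; apply/orP; left; apply/eqP; apply: eq_integral => x _.
by rewrite gee0_abs// mule_ge0// lee_fin// normal_pdf_ge0.
Qed.

(** Stein's identity, by parts: (f - x F) times the density is the derivative of F times the
    density, which vanishes at infinity. F = -1 gives the mean and F(x) = -x the variance. *)
Lemma normal_stein (R : realType) (F f : R -> R) :
  (forall x, is_derive x (1 : R) F (f x)) ->
  continuous f ->
  (forall x, `|F x| <= 2 + `|x|) -> (forall x, `|f x - x * F x| <= 4 * expR `|x|) ->
  (\int[normal_prob 0 1]_x (f x - x * F x)%:E = 0)%E.
Proof.
move=> dF cf Fle fle.
have cF : continuous F.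
  by move=> x; apply: differentiable_continuous; apply/derivable1_diffP; apply: ex_derive.
have cfF : continuous (fun x : R => f x - x * F x).
  by move=> x; apply: cvgB; [exact: cf|apply: cvgM; [exact: cvg_id|exact: cF]].
rewrite integral_normal_prob; last first.
  by apply/measurable_EFinP; exact: continuous_measurable_fun.
under eq_integral do rewrite -EFinM.
pose G x := F x * normal_pdf 0 1 x.
have c0 := @normal_peak_ge0 R 1.
(* e^u >= 1 + u bounds the Gaussian factor by 1 / (1 + x^2 / 2), which beats the linear growth of
   F. *)
have Gle x : `|G x| <= normal_peak 1 * ((2 + `|x|) / (1 + `|x| ^+ 2 / 2)).
  rewrite /G normal_pdfE ?oner_eq0// !normrM [X in _ * (X * _)]ger0_norm// mulrCA ler_wpM2l//.
  rewrite ler_pM// ger0_norm ?expR_ge0// /normal_fun subr0 expr1n mulNr expRN real_normK ?num_real//.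
  by rewrite lef_pV2 ?posrE ?expR_gt0 ?expR_ge1Dx// ltr_wpDr// divr_ge0// sqr_ge0.
apply: (@integral_derive_eq0 _ _ G).
- move=> x; rewrite /G.
  have dP : is_derive x (1 : R) (normal_pdf 0 1) (- x * normal_pdf 0 1 x).
    rewrite normal_pdfE ?oner_eq0//.
    have dE : is_derive x (1 : R) (fun y : R => - (y - 0) ^+ 2 / (1 ^+ 2 *+ 2)) (- x).
      rewrite (_ : (fun y : R => _) = (- 2^-1) *: ((id : R -> R) ^+ 2)); last first.
        apply/funext => y; rewrite -[RHS]/(- 2^-1 * (y * y)) subr0 expr1n.
        by field.
      by apply: is_derive_eq; rewrite /GRing.scale/=; field.
    rewrite (_ : (fun y : R => _) = normal_peak 1 *: (expR \o (fun y : R => - (y - 0) ^+ 2 / (1 ^+ 2 *+ 2))))//.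
    by apply: is_derive_eq; rewrite /GRing.scale/= /normal_fun; ring.
  rewrite (_ : (fun y : R => _) = F * normal_pdf 0 1)//.
  by apply: is_derive_eq; rewrite /GRing.scale/=; ring.
- move=> x; apply: cvgM; first exact: cfF.
  by apply: continuous_normal_pdf; rewrite oner_eq0.
- apply/cvgrPdist_le => e e0; near=> n.
  rewrite sub0r normrN (le_trans (ler_normB _ _))//.
  apply: (le_trans (lerD (Gle _) (Gle _))).
  rewrite normrN ger0_norm// -mulr2n.
  apply: (@le_trans _ _ (normal_peak 1 * (8 / n.+1%:R) *+ 2)).
    rewrite lerMn2r/= ler_wpM2l// ler_pdivrMr ?ltr_wpDr ?divr_ge0 ?sqr_ge0//.
    rewrite mulrAC ler_pdivlMr//.
    have -> : n.+1%:R = n%:R + 1 :> R by rewrite natr1.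
    by have : (0 <= n%:R :> R) by []; set m : R := n%:R; nra.
  near: n.
  have : (normal_peak 1 * (8 / n.+1%:R) *+ 2 : R) @[n --> \oo] --> (normal_peak 1 * (8 * 0) *+ 2 : R).
    apply: cvgMn; apply: cvgMr; apply: cvgMr; exact: cvg_harmonic.
  rewrite !mulr0 mul0rn => /cvgrPdist_le /(_ _ e0); apply: filterS => n.
  rewrite sub0r normrN; apply: le_trans; exact: ler_norm.
- exact: integrable_normal_poly.
Unshelve. all: by end_near. Qed.

Lemma normal_mean (R : realType) : (\int[normal_prob 0 1]_x (x : R)%:E = 0)%E.
Proof.
rewrite -(@normal_stein _ (cst (-1)) (cst 0)).
- by apply: eq_integral => x _; rewrite /= sub0r mulrN1 opprK.
- by move=> x; exact: cvg_cst.
- by move=> x; rewrite /= normrN1 -[leLHS]addr0 lerD// ler1n.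
- move=> x /=; rewrite sub0r mulrN1 opprK.
  have := expR_ge1Dx `|x|; have := normr_ge0 x; set y := `|x|; set z := expR _.
  lra.
Qed.

Lemma normal_var (R : realType) : (\int[normal_prob 0 1]_x ((x : R) ^+ 2)%:E = 1)%E.
Proof.
(* Gives both the growth bound for Stein's identity and the integrability of x^2. *)
have e : forall x : R, x ^+ 2 <= 2 * (expR `|x| - 1).
  move=> x; have := @expR_ge1Dxn R `|x| 1 (normr_ge0 _).
  by rewrite real_normK ?num_real// (_ : 2`!%:R = 2)//; lra.
have := @normal_stein _ (fun x : R => - x) (cst (-1)).
under eq_integral do rewrite mulrN opprK -expr2.
move=> H.
have {H} : (\int[normal_prob 0 1]_x (cst (-1) x + x ^+ 2)%:E = 0 :> \bar R)%E.
  apply: H.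
  - by move=> x; exact: cvg_cst.
  - by move=> x; rewrite normrN lerDr.
  - move=> x; rewrite /= mulrN opprK -expr2 (le_trans (ler_normD _ _))// normrN1 ger0_norm ?sqr_ge0//.
    by have := e x; have := expR_ge1Dx `|x|; have := normr_ge0 x; lra.
under eq_integral do rewrite EFinD.
rewrite integralD//=; last first.
  apply: (@le_integrable _ _ _ (normal_prob 0 1) setT measurableT _ (fun x : R => (2%:E * (expR `|x|)%:E)%E)).
  - by apply/measurable_EFinP; exact: measurable_funX.
  - move=> x _ /=; rewrite lee_fin [leLHS]ger0_norm ?sqr_ge0// [leRHS]ger0_norm ?mulr_ge0 ?expR_ge0//.
    by have := e x; lra.
  - apply: integrableZl => //; apply/integrableP; split.
      by apply/measurable_EFinP; exact: measurableT_comp.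
    under eq_integral do rewrite /= ger0_norm ?expR_ge0//.
    by apply: (le_lt_trans (normal_exp_abs R)); rewrite ltry.
  exact: finite_measure_integrable_cst.
rewrite integral_cst// [X in (_ * X)%E]probability_setT mule1.
case: (\int[_]_x _)%E => // r [].
by move/eqP; rewrite addrC subr_eq0 => /eqP ->.
Qed.

(** * Centered Gaussian variables *)

(** The substitution y -> -y exchanges left and right rays; scaling by a negative factor is thereby
    reduced to scaling by its absolute value. *)
Lemma normal_prob_sym (R : realType) (A : set R) : measurable A ->
  normal_prob 0 1 ((fun z : R => - z) @^-1` A) = normal_prob 0 1 A.
Proof.
move=> mA.
apply: (@law_eq_rays R _ _ (measurableTypeR R) (measurableTypeR R)
  (normal_prob 0 1) (normal_prob 0 1) (fun z => - z) id) => //.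
  exact: measurableT_comp.
move=> x.
have -> : [set w : R | x < - w] = `]-oo, - x[%classic.
  by apply/seteqP; split => z/=; rewrite in_itv/= ltrNr.
have -> : [set w : R | x < id w] = `]x, +oo[%classic.
  by apply/seteqP; split => z/=; rewrite in_itv/= andbT.
have mpdf (D : set R) : measurable_fun D (fun y : R => (normal_pdf 0 1 y)%:E).
  by apply/measurable_EFinP/measurable_funTS; exact: measurable_normal_pdf.
rewrite /normal_prob [LHS]integral_itv_bndo_bndc// [RHS]integral_itv_obnd_cbnd//.
rewrite ge0_integration_by_substitutionNy.
- apply: eq_integral => y _; rewrite /= !normal_pdfE ?oner_eq0//.
  by rewrite /normal_fun !subr0 sqrrN.
- by apply: continuous_subspaceT; apply: continuous_normal_pdf; rewrite oner_eq0.
- by move=> y _; exact: normal_pdf_ge0.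
Qed.

(* The law of [sqrt v * z] for [z] standard normal, so that [v = 0] gives the Dirac
   mass at 0 without a case distinction. *)
Definition glaw (R : realType) d (T : measurableType d) (P : probability T R)
    (X : T -> R) (v : R) : Prop :=
  [/\ 0 <= v, measurable_fun setT X & forall A : set R, measurable A ->
    P (X @^-1` A) = normal_prob 0 1 ((fun z : R => Num.sqrt v * z) @^-1` A)].

Section glaw_theory.
Context (R : realType) d (T : measurableType d) (P : probability T R).
Implicit Types (X : T -> R) (v : R).

Lemma glaw_gaussian_rv X v : glaw P X v -> gaussian_rv P X.
Proof.
move=> [v0 mX lX]; split => //; exists 0.
have [vE|vN0] := eqVneq v 0.
  subst v.
  right => B mB; rewrite /pushforward lX// sqrtr0 diracE.
  have [B0|B0] := boolP (0 \in B).
    rewrite (_ : _ @^-1` _ = setT) ?probability_setT//.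
    by apply/seteqP; split => // z _ /=; rewrite mul0r; rewrite inE in B0.
  rewrite (_ : _ @^-1` _ = set0) ?measure0//.
  by apply/seteqP; split => // z /=; rewrite mul0r => /mem_set; rewrite (negbTE B0).
have v_gt0 : 0 < Num.sqrt v by rewrite sqrtr_gt0 lt_neqAle eq_sym vN0.
left; exists (Num.sqrt v); first by rewrite gt_eqF.
move=> B mB; rewrite /pushforward lX// [RHS]normal_prob_affine//.
by congr (normal_prob _ _ _); apply/seteqP; split => z /=; rewrite add0r.
Qed.

Lemma glaw_ge0_integral X v (f : R -> \bar R) : glaw P X v ->
  measurable_fun setT f -> (forall x, 0 <= f x)%E ->
  (\int[P]_w f (X w) = \int[normal_prob 0 1]_z f (Num.sqrt v * z)%R)%E.
Proof.
move=> [v0 mX lX] mf f0.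
have mg : measurable_fun setT (fun z : measurableTypeR R => (Num.sqrt v * z : R)).
  exact: measurable_funM.
have := @ge0_integral_pushforward _ _ _ _ _ _ mX P setT f measurableT mf.
rewrite preimage_setT => <- //.
have := @ge0_integral_pushforward _ _ _ _ _ _ mg (normal_prob 0 1) setT f measurableT mf.
rewrite preimage_setT => <- //.
by apply: eq_measure_integral => A mA _; exact: lX.
Qed.

Lemma glaw_integral X v (f : R -> \bar R) : glaw P X v -> measurable_fun setT f ->
  (\int[P]_w f (X w) = \int[normal_prob 0 1]_z f (Num.sqrt v * z)%R)%E.
Proof.
move=> gX mf; rewrite [LHS]integralE [RHS]integralE; congr (_ - _)%E.
  transitivity (\int[P]_w (f^\+ (X w)))%E; first by apply: eq_integral => w _; rewrite !funeposE.
  rewrite (glaw_ge0_integral gX); last 2 first.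
  - exact: measurable_funepos.
  - by move=> x; exact: funepos_ge0.
  by apply: eq_integral => w _; rewrite !funeposE.
transitivity (\int[P]_w (f^\- (X w)))%E; first by apply: eq_integral => w _; rewrite !funenegE.
rewrite (glaw_ge0_integral gX); last 2 first.
- exact: measurable_funeneg.
- by move=> x; exact: funeneg_ge0.
by apply: eq_integral => w _; rewrite !funenegE.
Qed.

Lemma glaw_sqr X v : glaw P X v -> (\int[P]_w (X w ^+ 2)%:E = v%:E)%E.
Proof.
move=> gX; have [v0 _ _] := gX.
rewrite (glaw_ge0_integral (f := fun x => (x ^+ 2)%:E) gX); last 2 first.
- by apply/measurable_EFinP; exact: measurable_funX.
- by move=> x; rewrite lee_fin sqr_ge0.
under eq_integral do rewrite exprMn sqr_sqrtr// EFinM.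
rewrite ge0_integralZl//.
- by rewrite normal_var mule1.
- by apply/measurable_EFinP; exact: measurable_funX.
- by move=> x _; rewrite lee_fin sqr_ge0.
Qed.

(** The chaining knows only an upper bound u of the variance, so the normalisation is by sqrt u and
    the constant is independent of the law. *)
Lemma glaw_exp_abs X v u : glaw P X v -> v <= u ->
  (\int[P]_w (expR (`|X w| / Num.sqrt u))%:E <= (2 * expR 2^-1)%:E)%E.
Proof.
move=> gX vu; have [v0 _ _] := gX.
rewrite (glaw_ge0_integral (f := fun x => (expR (`|x| / Num.sqrt u))%:E) gX); last 2 first.
- apply/measurable_EFinP; apply: measurableT_comp => //.
  by apply: measurable_funM => //; exact: measurableT_comp.
- by move=> x; rewrite lee_fin expR_ge0.
apply: le_trans (normal_exp_abs R).
apply: ge0_le_integral => //=.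
- apply/measurable_EFinP; apply: measurableT_comp => //.
  by apply: measurable_funM => //; exact: measurableT_comp.
- by apply/measurable_EFinP; exact: measurableT_comp.
- move=> z _; rewrite lee_fin ler_expR normrM ger0_norm ?sqrtr_ge0// mulrAC.
  rewrite ler_piMl//.
  (* The quotient by a zero deviation is 0 by convention, so the bound persists. *)
  have [->|u0] := eqVneq (Num.sqrt u) 0; first by rewrite invr0 mulr0.
  by rewrite ler_pdivrMr ?lt_neqAle 1?eq_sym ?u0 ?sqrtr_ge0// mul1r ler_sqrt ?(le_trans v0).
Qed.

Lemma glaw_integrable_sqr X v : glaw P X v ->
  P.-integrable setT (fun w => (X w ^+ 2)%:E).
Proof.
move=> gX; have [v0 mX _] := gX; apply/integrableP; split.
  by apply/measurable_EFinP; exact: measurable_funX.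
under eq_integral do rewrite /= ger0_norm ?sqr_ge0//.
by rewrite (glaw_sqr gX) ltry.
Qed.

Lemma glaw_mean X v : glaw P X v -> ('E_P[X] = 0)%E.
Proof.
move=> gX; rewrite unlock (glaw_integral gX) //.
under eq_integral do rewrite EFinM.
rewrite integralZl//; first by rewrite normal_mean mule0.
apply: (@le_integrable _ _ _ (normal_prob 0 1) setT measurableT _ (fun x : R => (1 + (x ^+ 2)%:E)%E)).
- exact/measurable_EFinP.
- move=> x _; rewrite -EFinD /= lee_fin [leRHS]ger0_norm ?addr_ge0 ?sqr_ge0//.
  by rewrite -(real_normK (num_real x)); have := normr_ge0 x; nra.
- apply: integrableD => //; first exact: finite_measure_integrable_cst.
  apply/integrableP; split.
    by apply/measurable_EFinP; exact: measurable_funX.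
  under eq_integral do rewrite /= ger0_norm ?sqr_ge0//.
  by rewrite normal_var ltry.
Qed.

Lemma prob_bounded_cvg (f_ : nat -> T -> R) (f : T -> R) :
  (forall n, measurable_fun setT (f_ n)) -> measurable_fun setT f ->
  (forall n w, `|f_ n w| <= 1) -> (forall w, f_ n w @[n --> \oo] --> f w) ->
  (\int[P]_w (f_ n w)%:E)%E @[n --> \oo] --> (\int[P]_w (f w)%:E)%E.
Proof.
move=> mf_ mf f1 ff.
have [|||||_ _] := @dominated_convergence _ _ _ P setT measurableT
  (fun n => EFin \o f_ n) (EFin \o f) (cst 1%E) => //.
- by move=> n; exact/measurable_EFinP.
- exact/measurable_EFinP.
- by apply: aeW => w _; apply: cvg_EFin; [near=> n|exact: ff].
- exact: finite_measure_integrable_cst.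
- by apply: aeW => w n _ /=; rewrite lee_fin.
Unshelve. all: by end_near. Qed.

End glaw_theory.

(** * Continuous approximation of rays and limits of normal laws *)

Section ray_approx.
Context (R : realType) (x : R).

(* [min 1 (max 0 (n (y - x)))], written with absolute values. *)
Definition ray_approx (n : nat) (y : R) : R :=
  (`|n%:R * (y - x)| - `|n%:R * (y - x) - 1| + 1) / 2.

(** At y = x the approximation is 0 for every n, so the limit is the indicator of the open ray. *)
Lemma ray_approx_cvg y : ray_approx n y @[n --> \oo] --> (\1_[set z : R | x < z] y : R).
Proof.
rewrite indicE; have [xy|yx] := ltP x y; last first.
  rewrite memNset/= ?ltNge ?yx//; apply: cvg_near_cst; near=> n.
  have u0 : n%:R * (y - x) <= 0 by rewrite mulr_ge0_le0// subr_le0.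
  by rewrite /ray_approx ler0_norm// ler0_norm ?subr_le0 ?(le_trans u0)//; field.
rewrite mem_set//; apply: cvg_near_cst.
exists (Num.bound (y - x)^-1) => // n /= ny.
have u1 : 1 <= n%:R * (y - x).
  rewrite -ler_pdivrMr ?subr_gt0// mul1r.
  apply: (@le_trans _ _ (Num.bound (y - x)^-1)%:R); last by rewrite ler_nat.
  by rewrite ltW// archi_boundP// invr_ge0 subr_ge0 ltW.
by rewrite /ray_approx ger0_norm ?(le_trans _ u1)// ger0_norm ?subr_ge0//; field.
Unshelve. all: by end_near. Qed.

Lemma ray_approx_bound n y : `|ray_approx n y| <= 1.
Proof.
rewrite /ray_approx; set u := n%:R * _.
have := ler_normB u (u - 1); have := ler_dist_dist u (u - 1).
rewrite opprB addrCA subrr addr0 normr1 ler_norml => /andP[h1 h2] _.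
by rewrite ger0_norm; lra.
Qed.

Lemma ray_approx_continuous n : continuous (ray_approx n).
Proof.
move=> y; apply: cvgMl; apply: cvgD; last exact: cvg_cst.
have cu : n%:R * (z - x) @[z --> y] --> n%:R * (y - x).
  by apply: cvgMr; apply: cvgB; [exact: cvg_id|exact: cvg_cst].
by apply: cvgB; apply: cvg_norm => //; apply: cvgB => //; exact: cvg_cst.
Qed.

Lemma measurable_ray_approx n : measurable_fun setT (ray_approx n).
Proof. by apply: continuous_measurable_fun; exact: ray_approx_continuous. Qed.

(** Hence a law is determined by the expectations of bounded continuous functions. *)
Lemma integral_ray d (T : measurableType d) (P : probability T R) (X : T -> R) :
  measurable_fun setT X ->
  (\int[P]_w (ray_approx n (X w))%:E)%E @[n --> \oo] --> P [set w | x < X w].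
Proof.
move=> mX.
have mA : measurable [set w | x < X w].
  have -> : [set w | x < X w] = X @^-1` `]x, +oo[%classic.
    by apply/seteqP; split => w/=; rewrite in_itv/= andbT.
  by rewrite -[X in measurable X]setTI; apply: mX.
rewrite -[P _](_ : \int[P]_w (\1_[set w | x < X w] w)%:E = _)%E; last first.
  by rewrite integral_indic// setIT.
apply: prob_bounded_cvg.
- by move=> n; apply: measurableT_comp => //; exact: measurable_ray_approx.
- exact: measurable_indic.
- by move=> n w; exact: ray_approx_bound.
- by move=> w; exact: ray_approx_cvg.
Qed.

End ray_approx.

Section glaw_limit.
Context (R : realType) d (T : measurableType d) (P : probability T R).

(** For h bounded and continuous, E h(X_n) converges to E h(X) by bounded convergence, and so does
    the normal expectation of h(sqrt v_n z), the square root being continuous. Rays are then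
    recovered through [ray_approx]. A limit variance 0 is covered without a case distinction. *)
Lemma glaw_lim (X_ : nat -> T -> R) (X : T -> R) (v_ : nat -> R) (v : R) :
  (forall n, glaw P (X_ n) (v_ n)) -> (forall w, X_ n w @[n --> \oo] --> X w) ->
  v_ n @[n --> \oo] --> v -> glaw P X v.
Proof.
move=> gX XX vv.
have v0 : 0 <= v.
  have /cvg_lim <- // := vv.
  by apply: limr_ge; [apply/cvg_ex; eexists; exact: vv|apply: nearW => n; case: (gX n)].
have mX_ n : measurable_fun setT (X_ n) by case: (gX n).
have mX : measurable_fun setT X.
  by apply: (measurable_fun_cvg (h := X_)) => // w _; exact: XX.
split => //.
have mscale (u : R) : measurable_fun setT (fun z : measurableTypeR R => (u * z : R)).
  exact: measurable_funM.
have test (h : R -> R) : continuous h -> (forall y, `|h y| <= 1) ->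
  (\int[P]_w (h (X w))%:E = \int[normal_prob 0 1]_z (h (Num.sqrt v * z)%R)%:E)%E.
  move=> ch h1.
  have mh : measurable_fun setT h by exact: continuous_measurable_fun.
  have c1 : (\int[P]_w (h (X_ n w))%:E)%E @[n --> \oo] --> (\int[P]_w (h (X w))%:E)%E.
    apply: prob_bounded_cvg => //.
    - by move=> n; exact: measurableT_comp.
    - exact: measurableT_comp.
    - by move=> w; apply: continuous_cvg; [exact: ch|exact: XX].
  have c2 : (\int[normal_prob 0 1]_z (h (Num.sqrt (v_ n) * z)%R)%:E)%E @[n --> \oo] -->
      (\int[normal_prob 0 1]_z (h (Num.sqrt v * z)%R)%:E)%E.
    apply: prob_bounded_cvg => //.
    - by move=> n; apply: measurableT_comp => //; exact: mscale.
    - by apply: measurableT_comp => //; exact: mscale.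
    - move=> z; apply: continuous_cvg; first exact: ch.
      apply: cvgMl; apply: continuous_cvg => //; exact: sqrt_continuous.
  rewrite -(cvg_lim _ c2)// -(cvg_lim _ c1)//; congr (limn _); apply/funext => n.
  rewrite (glaw_integral (f := fun y => (h y)%:E) (gX n))//.
  exact/measurable_EFinP.
apply: (@law_eq_rays R _ _ _ (measurableTypeR R) P (normal_prob 0 1)) => // x.
have := @integral_ray R x _ _ P _ mX; have := @integral_ray R x _ _ (normal_prob 0 1) _ (mscale (Num.sqrt v)).
move=> c2 c1; rewrite -(cvg_lim _ c1)// -(cvg_lim _ c2)//; congr (limn _).
apply/funext => n; apply: test; first exact: ray_approx_continuous.
by move=> y; exact: ray_approx_bound.
Qed.

End glaw_limit.

Section glaw_ops.
Context (R : realType) d (T : measurableType d) (P : probability T R).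

Lemma prob_setI_full (Om B : set T) : measurable Om -> P Om = 1%E ->
  measurable B -> P B = P (B `&` Om).
Proof.
move=> mO PO mB; rewrite (measureDI P mB mO) [X in (X + _)%E](_ : _ = 0%E) ?add0e//.
apply: (@subset_measure0 _ _ _ P _ (~` Om)).
- exact: measurableD.
- exact: measurableC.
- by move=> w [].
- by have := probability_setC P mO; rewrite PO subee// => ->.
Qed.

(** Lets bad paths be replaced by 0 without changing any law. *)
Lemma glaw_mask (X : T -> R) v (Om : set T) : measurable Om -> P Om = 1%E ->
  glaw P X v -> glaw P (fun w => X w * \1_Om w) v.
Proof.
move=> mO PO [v0 mX lX].
have mXO : measurable_fun setT (fun w => X w * \1_Om w).
  by apply: measurable_funM => //; exact: measurable_indic.
split => // A mA; rewrite -lX//.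
have m1 : measurable ((fun w => X w * \1_Om w) @^-1` A).
  by rewrite -[X in measurable X]setTI; exact: mXO.
have m2 : measurable (X @^-1` A).
  by rewrite -[X in measurable X]setTI; exact: mX.
rewrite (prob_setI_full mO PO m1) (prob_setI_full mO PO m2).
congr (P _); apply/seteqP; split => w [/= Aw Ow]; split => //.
  by move: Aw; rewrite indicE mem_set// mulr1.
by rewrite indicE mem_set// mulr1.
Qed.

Lemma glaw_scale (X : T -> R) v (a : R) : glaw P X v ->
  glaw P (fun w => a * X w) (a ^+ 2 * v).
Proof.
move=> [v0 mX lX]; split; first by rewrite mulr_ge0// sqr_ge0.
  exact: measurable_funM.
move=> A mA.
have mB : measurable ((fun y : R => a * y) @^-1` A).
  rewrite -[X in measurable X]setTI.
  by have : measurable_fun setT (fun y : R => a * y) by [exact: measurable_funM]; exact.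
rewrite (lX _ mB) sqrtrM ?sqr_ge0// sqrtr_sqr.
have [a0|a0] := ger0P a.
  by congr (normal_prob _ _ _); apply/seteqP; split => z /=; rewrite mulrA.
rewrite -[LHS]normal_prob_sym.
  by congr (normal_prob _ _ _); apply/seteqP; split => z /=; rewrite !mulrN mulNr mulrA mulNr.
rewrite -[X in measurable X]setTI.
have : measurable_fun setT (fun y : R => Num.sqrt v * y) by exact: measurable_funM.
exact.
Qed.

(** Polarisation: X Y is half of (X + Y)^2 - X^2 - Y^2, so three one-dimensional laws suffice. *)
Lemma glaw_cov (X Y : T -> R) (u v s : R) : glaw P X u -> glaw P Y v ->
  glaw P (fun w => X w + Y w) s ->
  (\int[P]_w (X w * Y w)%:E = (2^-1 * (s - u - v))%:E)%E.
Proof.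
move=> gX gY gS.
have iX := glaw_integrable_sqr gX; have iY := glaw_integrable_sqr gY.
have iS := glaw_integrable_sqr gS.
transitivity (\int[P]_w (2^-1%:E * (((X w + Y w) ^+ 2)%:E - (X w ^+ 2)%:E - (Y w ^+ 2)%:E)))%E.
  by apply: eq_integral => w _; rewrite -!EFinB -EFinM; congr (_%:E); field.
rewrite integralZl//; last by apply: integrableB => //; exact: integrableB.
rewrite integralB//; last exact: integrableB.
by rewrite integralB// (glaw_sqr gX) (glaw_sqr gY) (glaw_sqr gS).
Qed.

End glaw_ops.

(** * Sums of independent normal variables *)

Section independent_copies.
Context (R : realType) d (T : measurableType d) (P : probability T R).
Variables (f g : T -> T).
Hypotheses (mf : measurable_fun setT f) (mg : measurable_fun setT g).
Hypothesis indep : forall A B, measurable A -> measurable B ->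
  P (f @^-1` A `&` g @^-1` B) = (P A * P B)%E.

(** Uniqueness of the product measure on rectangles. With A or B the whole space, [indep] also says
    that f and g preserve P. *)
Lemma indep_product (C : set (T * T)) : measurable C ->
  P ((fun w => (f w, g w)) @^-1` C) = (P \x P)%E C.
Proof.
move=> mC.
have mfg : measurable_fun setT (fun w => (f w, g w)) by exact: measurable_fun_pair.
pose fg : {mfun T >-> (T * T)%type} := HB.pack (fun w => (f w, g w)) (isMeasurableFun.Build _ _ _ _ _ mfg).
apply/esym; apply: (@product_measure_unique _ _ _ _ _ P P (distribution P fg)) => //.
Qed.

(** Conditionally on X o f = x the sum is normal with mean a x and variance v; integrating over x is
    [normal_convolution]. *)
Lemma glaw_indep (X S : T -> R) v : glaw P X 1 -> glaw P S v -> forall a : R,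
  glaw P (fun w => a * X (f w) + S (g w)) (a ^+ 2 + v).
Proof.
move=> [_ mX lX] gS a; have [v0 mS lS] := gS.
have mXf : measurable_fun setT (X \o f) by exact: measurableT_comp.
have mSg : measurable_fun setT (S \o g) by exact: measurableT_comp.
split; first by rewrite addr_ge0// sqr_ge0.
  by apply: measurable_funD => //; exact: measurable_funM.
(* For v = 0 the conditional law is a Dirac mass, which has no density; but then S o g vanishes on a
   set of full measure and only the first term remains. *)
move=> A mA; have [v1|v1] := eqVneq v 0.
  subst v.
  have m0 : measurable (S @^-1` [set 0]) by rewrite -[X in measurable X]setTI; exact: mS.
  have PS0 : P (S @^-1` [set 0]) = 1%E.
    rewrite lS// (_ : _ @^-1` _ = setT) ?probability_setT//.
    by apply/seteqP; split => // z _ /=; rewrite sqrtr0 mul0r.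
  have mD : measurable (g @^-1` (S @^-1` [set 0])).
    by rewrite -[X in measurable X]setTI; exact: mg.
  have PD : P (g @^-1` (S @^-1` [set 0])) = 1%E.
    have := indep (@measurableT _ T) m0.
    by rewrite preimage_setT setTI PS0 probability_setT mul1e.
  have gXf : glaw P (X \o f) 1.
    split => // B mB; rewrite -lX// comp_preimage.
    have mXB : measurable (X @^-1` B) by rewrite -[X in measurable X]setTI; exact: mX.
    have := indep mXB (@measurableT _ T).
    by rewrite preimage_setT setIT probability_setT mule1.
  have [_ maX laX] := glaw_scale a gXf.
  rewrite addr0 -[a ^+ 2]mulr1 -laX//.
  rewrite (prob_setI_full mD PD); last first.
    rewrite -[X in measurable X]setTI.
    have : measurable_fun setT (fun w => a * X (f w) + S (g w)).
      by apply: measurable_funD => //; exact: measurable_funM.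
    exact.
  rewrite [RHS](prob_setI_full mD PD); last by rewrite -[X in measurable X]setTI; exact: maX.
  congr (P _); apply/seteqP; split => w [/= Aw Sw]; split => //.
    by rewrite Sw addr0 in Aw.
  by rewrite Sw addr0.
pose C : set (T * T) := [set p | A (a * X p.1 + S p.2)].
have mC : measurable C.
  rewrite -[C]setTI.
  have : measurable_fun setT (fun p : T * T => a * X p.1 + S p.2).
    apply: measurable_funD; last exact: measurableT_comp.
    by apply: measurable_funM => //; exact: measurableT_comp.
  exact.
have v0' : 0 < Num.sqrt v by rewrite sqrtr_gt0 lt_neqAle eq_sym v1.
rewrite -[LHS]/(P ((fun w => (f w, g w)) @^-1` C)) indep_product//.
rewrite /product_measure1/=.
transitivity (\int[P]_x normal_prob (a * X x)%R (Num.sqrt v) A)%E.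
  apply: eq_integral => x _ /=.
  rewrite (normal_prob_affine _ v0')// (_ : xsection C x = S @^-1` ((fun y => a * X x + y) @^-1` A)).
    rewrite lS//; rewrite -[X in measurable X]setTI.
    have : measurable_fun setT (fun y : R => a * X x + y) by exact: measurable_funD.
    exact.
  by apply/seteqP; split => y; rewrite /xsection /C/= inE.
rewrite (glaw_ge0_integral (f := fun y => normal_prob (a * y) (Num.sqrt v) A) (v := 1)).
- rewrite sqrtr1; under eq_integral do rewrite mul1r.
  have s0 : 0 < Num.sqrt (a ^+ 2 + v).
    by rewrite sqrtr_gt0 ltr_wpDl ?sqr_ge0// lt_neqAle eq_sym v1.
  rewrite (normal_convolution a v0' mA) sqr_sqrtr// (normal_prob_affine 0 s0 mA).
  by congr (normal_prob _ _ _); apply/seteqP; split => z /=; rewrite add0r.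
- by [].
- by apply: measurable_normal_prob => //; rewrite gt_eqF.
- by move=> x; exact: measure_ge0.
Qed.

End independent_copies.

Section gaussian_sequence.
Context (R : realType) d (T : measurableType d) (P : probability T R).
Variables (f g : T -> T) (X : T -> R).
Hypotheses (mf : measurable_fun setT f) (mg : measurable_fun setT g).
Hypothesis indep : forall A B, measurable A -> measurable B ->
  P (f @^-1` A `&` g @^-1` B) = (P A * P B)%E.
Hypothesis gX : glaw P X 1.

(** f extracts one sample from a point and g returns a fresh point independent of that sample; the
    k-th variable reads its sample after k renewals. *)
Definition gauss_seq (k : nat) (w : T) : R := X (f (iter k g w)).

(** All the terms but the first are a combination of the same sequence composed with g, so
    [glaw_indep] applies inductively and mutual independence never has to be stated. *)
Lemma gauss_seq_sum N (a : nat -> R) :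
  glaw P (fun w => \sum_(k < N) a k * gauss_seq k w) (\sum_(k < N) a k ^+ 2).
Proof.
elim: N a => [|N IH] a.
  rewrite big_ord0; under eq_fun do rewrite big_ord0.
  by have := glaw_scale 0 gX; rewrite expr0n mul0r; under eq_fun do rewrite mul0r.
rewrite big_ord_recl; under eq_fun do rewrite big_ord_recl.
have := glaw_indep mf mg indep gX (IH (fun k => a k.+1)) (a 0).
congr glaw; apply/funext => w; congr (_ + _); apply: eq_bigr => k _.
by rewrite /gauss_seq !lift0 iterSr.
Qed.

End gaussian_sequence.

(** Combinations are lists of (coefficient, index) pairs in which an index may recur, so that
    reindexing by a non-injective map and superposing several grids require no merging of terms. *)
Definition gaussian_family (R : realType) d (T : measurableType d)
    (P : probability T R) (I : Type) (D : pred I) (K : I -> I -> R)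
    (X : I -> T -> R) :=
  forall s : seq (R * I), all (fun p => D p.2) s ->
  glaw P (fun w => \sum_(p <- s) p.1 * X p.2 w)
    (\sum_(p <- s) \sum_(q <- s) p.1 * q.1 * K p.2 q.2).

Lemma gaussian_family_map (R : realType) d (T : measurableType d) (P : probability T R)
    (I J : Type) (f : J -> I) (E : pred J) (D : pred I) (K : I -> I -> R) X :
  (forall j, E j -> D (f j)) -> gaussian_family P D K X ->
  gaussian_family P E (fun i j => K (f i) (f j)) (fun j => X (f j)).
Proof.
move=> ED gX s sE; have := gX [seq (u.1, f u.2) | u <- s].
rewrite all_map big_map.
rewrite (_ : (fun w => \sum_(p <- _) _) = fun w => \sum_(u <- s) u.1 * X (f u.2) w); last first.
  by apply/funext => w; rewrite big_map.
under eq_bigr do rewrite big_map.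
by apply; apply: sub_all sE => u; exact: ED.
Qed.

Lemma gaussian_family_process (R : realType) d (T : measurableType d)
    (P : probability T R) (K : R -> R -> R) (X : R -> T -> R) :
  (forall s t, K s t = K t s) ->
  gaussian_family P (fun t => 0 <= t) K X -> centered_gaussian_process P K X.
Proof.
move=> Ksym gX; split.
- move=> n t c t0; apply: glaw_gaussian_rv.
  have -> : (fun w => \sum_(i < n) c i * X (t i) w) =
     (fun w => \sum_(p <- [seq (c i, t i) | i <- enum 'I_n]) p.1 * X p.2 w).
    by apply/funext => w; rewrite big_map big_enum.
  by apply: gX; apply/allP => _ /mapP[i _ ->] /=; exact: t0.
- move=> t t0; have := gX [:: (1, t)]; rewrite /= t0 => /(_ isT) /glaw_mean.
  by under eq_fun do rewrite big_seq1 mul1r.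
- move=> s t s0 t0.
  have := gX [:: (1, s)]; rewrite /= s0 => /(_ isT) gs.
  have := gX [:: (1, t)]; rewrite /= t0 => /(_ isT) gt.
  have := gX [:: (1, s); (1, t)]; rewrite /= s0 t0 => /(_ isT) gst.
  have E (u : R) : (fun w => \sum_(p <- [:: (1, u)]) p.1 * X p.2 w) = X u.
    by apply/funext => w; rewrite big_seq1 mul1r.
  rewrite E in gs; rewrite E in gt.
  have {}gst : glaw P (fun w => X s w + X t w)
     (\sum_(p <- [:: (1, s); (1, t)]) \sum_(q <- [:: (1, s); (1, t)]) p.1 * q.1 * K p.2 q.2).
    by move: gst; under eq_fun do rewrite big_cons big_seq1/= !mul1r.
  have := glaw_cov gs gt gst; rewrite !big_cons !big_nil/= (Ksym t s) unlock => ->.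
  by congr (_%:E); field.
Qed.

(** * Independent normal variables on the unit interval *)

(** Counterpart of [law_eq_rays] for finite measures of any mass, as are the restrictions and
    multiples of the uniform law compared below. *)
Lemma measure_eq_rays (R : realType) (m1 m2 : {measure set (measurableTypeR R) -> \bar R}) :
  (m1 setT < +oo)%E ->
  (forall x : R, m1 `]x, +oo[%classic = m2 `]x, +oo[%classic) ->
  forall A : set R, measurable A -> m1 A = m2 A.
Proof.
move=> m1fin m12 A mA.
apply: (@measure_unique _ _ (measurableTypeR R) (@RGenOInfty.G R) (fun n : nat => `]- n%:R, +oo[%classic)) => //.
- exact: RGenOInfty.measurableE.
- move=> _ _ [x ->] [y ->]; exists (Num.max x y).
  by apply/seteqP; split => z /=; rewrite !in_itv/= !andbT gt_max => /andP.
- by move=> i; eexists.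
- apply/seteqP; split => // x _; exists (Num.bound `|x : R|) => //=.
  rewrite in_itv/= andbT ltrNl (le_lt_trans (ler_norm _))// normrN.
  exact: archi_boundP.
- by move=> _ [x ->].
- by move=> k; apply: le_lt_trans m1fin; apply: le_measure => //; rewrite inE.
Qed.

Section uniform.
Context (R : realType).
Notation U := (measurableTypeR R).
Let P : probability U R := uniform_prob (@ltr01 R).

Lemma uniform_support (A : set U) : P A = P (A `&` `[0, 1]%classic).
Proof.
rewrite /P/= /uniform_prob integral_uniform_pdf.
by rewrite [RHS]integral_uniform_pdf -setIA setIid.
Qed.

Lemma uniform_itv (b1 b2 : bool) (x y : R) : 0 <= x -> x <= y -> y <= 1 ->
  P [set` Interval (BSide b1 x) (BSide b2 y)] = (y - x)%:E.
Proof.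
move=> x0 xy y1.
rewrite /P/= /uniform_prob (eq_integral (cst 1%E)); last first.
  move=> z; rewrite inE/= => zxy; rewrite /uniform_pdf.
  have -> : (0 <= z <= 1) = true.
    by case: b1 b2 zxy => -[]; rewrite in_itv/= => /andP[h1 h2]; apply/andP; split; lra.
  by rewrite subr0 invr1.
rewrite integral_cst/= ?mul1e//.
rewrite lebesgue_measure_itv/= lte_fin.
case: ltP => // yx.
have -> : x = y by apply/eqP; rewrite eq_le xy yx.
by rewrite subrr.
Qed.

Lemma uniform_ray_lt0 (x : R) : x < 0 -> P `]x, +oo[%classic = 1%E.
Proof.
move=> x0; rewrite uniform_support (_ : _ `&` _ = [set` `[0, 1]]).
  by rewrite uniform_itv// subr0.
apply/seteqP; split => z /=; rewrite !in_itv/= andbT; first by case.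
by move=> /andP[z0 ->]; rewrite z0 (lt_le_trans x0 z0).
Qed.

Lemma uniform_ray (x : R) : 0 <= x -> x <= 1 -> P `]x, +oo[%classic = (1 - x)%:E.
Proof.
move=> x0 x1; rewrite uniform_support (_ : _ `&` _ = [set` `]x, 1]]).
  by rewrite uniform_itv.
apply/seteqP; split => z /=; rewrite !in_itv/= andbT; first by move=> [-> /andP[_ ->]].
by move=> /andP[xz ->]; rewrite xz (ltW (le_lt_trans x0 xz)).
Qed.

Lemma uniform_ray_ge1 (x : R) : 1 <= x -> P `]x, +oo[%classic = 0%E.
Proof.
move=> x1; rewrite uniform_support (_ : _ `&` _ = set0) ?measure0//.
apply/seteqP; split => // z /=; rewrite !in_itv/= andbT => -[xz /andP[_ z1]].
by have := lt_le_trans (le_lt_trans x1 xz) z1; rewrite ltxx.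
Qed.

(** * Binary digits of a uniform variable *)

Definition bit (x : U) : bool := 2^-1 <= (x : R).
(** Shift of the binary expansion of a point of [0, 1]; the values elsewhere carry no mass. *)
Definition doubling (x : U) : U := 2 * x - (bit x)%:R.

Lemma measurable_bit : measurable_fun setT bit.
Proof. exact: measurable_fun_ler. Qed.

Lemma measurable_bit_eq e : measurable [set x | bit x = e].
Proof.
case: e; rewrite /bit.
  rewrite (_ : [set _ | _] = `[2^-1, +oo[%classic)//.
  by apply/seteqP; split => x /=; rewrite in_itv/= andbT.
rewrite (_ : [set _ | _] = `]-oo, 2^-1[%classic)//.
by apply/seteqP; split => x /=; rewrite in_itv/= ltNge; [move=> ->|move/negbTE].
Qed.

Lemma measurable_doubling : measurable_fun setT doubling.
Proof.
apply: measurable_funB; first exact: measurable_funM.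
rewrite (_ : (fun x : U => (bit x)%:R) = (fun x : U => if bit x then 1 else 0 : R)).
  by apply: measurable_fun_ifT => //; exact: measurable_bit.
by apply/funext => x; case: bit.
Qed.

(** The shift is affine of slope 2 on each half of [0, 1], so the first digit is fair and
    independent of the shifted point, which is again uniform. Both sides are finite measures in B
    and are compared on rays; rays starting outside [0, 1[ are treated apart. *)
Lemma uniform_doubling (e : bool) (B : set U) : measurable B ->
  P ([set x | bit x = e] `&` doubling @^-1` B) = ((2^-1)%:E * P B)%E.
Proof.
move=> mB.
have mE : measurable [set x : U | bit x = e].
  exact: measurable_bit_eq.
pose D : {mfun U >-> U} := HB.pack doubling (isMeasurableFun.Build _ _ _ _ doubling measurable_doubling).
have h0 : (0 <= 2^-1 :> R) by rewrite invr_ge0.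
pose m1 := pushforward (mrestr P mE) D.
pose m2 := mscale (NngNum h0) P.
rewrite setIC -[RHS]/(m2 B) -[LHS]/(m1 B).
apply: measure_eq_rays => // [|x].
  rewrite /m1 /pushforward/= /mrestr (le_lt_trans (probability_le1 _ _))// ?ltry//.
  by rewrite setTI.
rewrite -[LHS]/(P (doubling @^-1` `]x, +oo[%classic `&` [set x | bit x = e])).
rewrite -[RHS]/((2^-1)%:E * P `]x, +oo[%classic)%E [P (_ `&` _)]uniform_support; have [x0|x0] := ltP x 0.
  rewrite uniform_ray_lt0// mule1; case: e mE {m1 m2} => mE.
    rewrite (_ : _ `&` _ = [set` `[2^-1, 1]]).
      by rewrite uniform_itv; [congr (_%:E); field|lra|lra|lra].
    apply/seteqP; split => z /=; rewrite !in_itv/= /doubling /bit andbT; first by move=> [[_ ->] /andP[_ ->]].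
    by move=> /andP[z2 z1]; rewrite z2 z1/= andbT; split; [split => //; lra|lra].
  rewrite (_ : _ `&` _ = [set` `[0, 2^-1[]).
    by rewrite uniform_itv; [rewrite subr0|lra|lra|lra].
  apply/seteqP; split => z /=; rewrite !in_itv/= /doubling /bit andbT.
    by move=> [[_ /negbT]]; rewrite -ltNge => -> /andP[->].
  by move=> /andP[z0 z2]; rewrite leNgt z2 /= z0/=; split; [split => //; lra|lra].
have [x1|x1] := leP 1 x.
  rewrite uniform_ray_ge1// mule0 (_ : _ `&` _ = set0) ?measure0//.
  apply/seteqP; split => // z /=; rewrite !in_itv/= /doubling andbT => -[[xz ze] /andP[z0 z1]].
  have [z2|z2] := leP 2^-1 (z : R).
    have bz : bit z = true by exact: z2.
    by rewrite bz /= in xz; lra.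
  have bz : bit z = false by apply/negbTE; rewrite /bit -ltNge.
  by rewrite bz /= in xz; lra.
rewrite uniform_ray ?(ltW x1)//; case: e mE {m1 m2} => mE.
  rewrite (_ : _ `&` _ = [set` `](x + 1) / 2, 1]]).
    by rewrite uniform_itv; [congr (_%:E); field|lra|lra|lra].
  apply/seteqP; split => z /=; rewrite !in_itv/= /doubling /bit andbT.
    by move=> [[xz zb] /andP[z0 z1]]; rewrite zb/= in xz; rewrite z1 andbT; lra.
  move=> /andP[z2 z1]; have -> : 2^-1 <= (z : R) by lra.
  by rewrite z1 andbT/=; split; [split => //; lra|lra].
rewrite (_ : _ `&` _ = [set` `]x / 2, 2^-1[]).
  by rewrite uniform_itv; [congr (_%:E); field|lra|lra|lra].
apply/seteqP; split => z /=; rewrite !in_itv/= /doubling /bit andbT.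
  move=> [[xz zb] /andP[z0 z1]]; rewrite zb/= in xz; move/negbT : zb; rewrite -ltNge => z2.
  by rewrite z2 andbT; lra.
by move=> /andP[z0 z2]; rewrite leNgt z2 /=; split; [split => //; lra|lra].
Qed.

Lemma uniform_doubling2 (e e' : bool) (B : set U) : measurable B ->
  P ([set x | bit x = e /\ bit (doubling x) = e'] `&` (doubling \o doubling) @^-1` B) = ((4^-1)%:E * P B)%E.
Proof.
move=> mB; pose C := [set x | bit x = e'] `&` doubling @^-1` B.
have mC : measurable C.
  apply: measurableI.
    exact: measurable_bit_eq.
  by rewrite -[X in measurable X]setTI; exact: measurable_doubling.
transitivity (P ([set x | bit x = e] `&` doubling @^-1` C)).
  by congr (P _); apply/seteqP; split => x /= => [[[? ?] ?]|[? [? ?]]].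
rewrite uniform_doubling// uniform_doubling// muleA -EFinM; congr (_%:E * _)%E.
by rewrite -invfM -natrM.
Qed.

(* [evens n x] and [evens n (doubling x)] read the first [n] binary digits of [x] of
   odd, resp. even, rank. *)
Fixpoint evens (n : nat) (x : U) : nat :=
  if n is n'.+1 then (bit x * 2 ^ n' + evens n' (doubling (doubling x)))%N else 0%N.

Lemma evens_lt n x : (evens n x < 2 ^ n)%N.
Proof.
elim: n x => //= n IH x; have := IH (doubling (doubling x)); rewrite expnS.
by case: bit => /=; lia.
Qed.

(** The definition peels off the leading digit; monotonicity in n needs this recursion, which
    appends the last one. *)
Lemma evensS n x : evens n.+1 x = (2 * evens n x + bit (iter n.*2 doubling x))%N.
Proof.
elim: n x => [|n IH] x; first by rewrite /= muln1 addn0 muln0.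
have -> : evens n.+2 x = (bit x * 2 ^ n.+1 + evens n.+1 (doubling (doubling x)))%N by [].
rewrite IH -!iterSr [evens n.+1 x in RHS]/= doubleS expnS; lia.
Qed.

Lemma measurable_evens n (p : nat) : measurable [set x | p <= evens n x]%N.
Proof.
elim: n p => [|n IH] p.
  case: p => [|p]; first by rewrite (_ : [set _ | _] = setT)//; apply/seteqP.
  by rewrite (_ : [set _ | _] = set0)//; apply/seteqP; split => x /=; rewrite ?ltn0.
have mdd : measurable_fun setT (doubling \o doubling).
  by apply: measurableT_comp; exact: measurable_doubling.
rewrite (_ : [set _ | _] =
  ([set x | bit x = true] `&` (doubling \o doubling) @^-1` [set x | p - 2 ^ n <= evens n x]%N) `|`
  ([set x | bit x = false] `&` (doubling \o doubling) @^-1` [set x | p <= evens n x]%N)).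
  apply: measurableU; apply: measurableI.
  - exact: measurable_bit_eq.
  - by rewrite -[X in measurable X]setTI; apply: mdd.
  - exact: measurable_bit_eq.
  - by rewrite -[X in measurable X]setTI; apply: mdd.
apply/seteqP; split => x /=.
  by case: (bit x); rewrite ?mul1n ?mul0n => h; [left|right]; rewrite ?leq_subLR.
by case => -[-> /=]; rewrite ?leq_subLR ?mul1n ?mul0n ?add0n.
Qed.

Lemma measurable_evens_doubling n (p : nat) : measurable [set x | p <= evens n (doubling x)]%N.
Proof. by have := measurable_doubling measurableT (measurable_evens n p); rewrite setTI. Qed.

(** The two n-digit integers are independent and uniform, so the tail event counts a rectangle among
    4^n pairs. Splitting on the first two digits leaves the same event at level n, with p or q
    lowered by 2^n when the corresponding digit is 1. *)
Lemma uniform_evens n (p q : nat) :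
  P [set x | (p <= evens n x)%N /\ (q <= evens n (doubling x))%N] =
  (((2 ^ n - p) * (2 ^ n - q))%:R / (4 ^ n)%:R)%:E.
Proof.
elim: n p q => [|n IH] p q.
  case: p => [|p]; last first.
    rewrite (_ : [set _ | _] = set0) ?measure0//; first by rewrite expn0 subSS sub0n mul0n mul0r.
    by apply/seteqP; split => // x [].
  case: q => [|q]; last first.
    rewrite (_ : [set _ | _] = set0) ?measure0//; first by rewrite expn0 subSS sub0n muln0 mul0r.
    by apply/seteqP; split => // x [].
  rewrite (_ : [set _ | _] = setT) ?probability_setT; first by rewrite subn0 muln1 divr1.
  by apply/seteqP.
pose E p' q' := [set x | (p' <= evens n x)%N /\ (q' <= evens n (doubling x))%N].
have mE p' q' : measurable (E p' q').
  apply: measurableI; first exact: measurable_evens.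
  exact: measurable_evens_doubling.
have mD e (F : set U) : measurable F -> measurable (F `&` [set x | bit (doubling x) = e]).
  move=> mF; apply: measurableI => //.
  by have := measurable_doubling measurableT (measurable_bit_eq e); rewrite setTI.
have mS : measurable [set x | (p <= evens n.+1 x)%N /\ (q <= evens n.+1 (doubling x))%N].
  apply: measurableI; first exact: measurable_evens.
  exact: measurable_evens_doubling.
have mB e := measurable_bit_eq e.
have splitB (C F : set U) (h : U -> bool) : measurable F ->
    measurable (F `&` [set x | h x = true]) -> measurable (F `&` [set x | h x = false]) ->
   P F = (P (F `&` [set x | h x = false]) + P (F `&` [set x | h x = true]))%E.
  move=> mF m1 m2; rewrite -measureU//.
    congr (P _); apply/seteqP; split => x /=; first by case: (h x); [right|left].
    by case=> -[].
  by apply/seteqP; split => // x /= [[_ ->] []].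
rewrite (splitB setT _ bit) //; last 2 first.
- exact: measurableI.
- exact: measurableI.
rewrite (splitB setT (_ `&` [set x | bit x = false]) (fun x => bit (doubling x))) //; last 3 first.
- exact: measurableI.
- by apply: mD; exact: measurableI.
- by apply: mD; exact: measurableI.
rewrite (splitB setT (_ `&` [set x | bit x = true]) (fun x => bit (doubling x))) //; last 3 first.
- exact: measurableI.
- by apply: mD; exact: measurableI.
- by apply: mD; exact: measurableI.
have key e e' : P ([set x | (p <= evens n.+1 x)%N /\ (q <= evens n.+1 (doubling x))%N]
    `&` [set x | bit x = e] `&` [set x | bit (doubling x) = e']) =
    (4^-1 * (((2 ^ n - (p - e * 2 ^ n)) * (2 ^ n - (q - e' * 2 ^ n)))%:R / (4 ^ n)%:R))%:E.
  rewrite EFinM -IH -(uniform_doubling2 e e' (mE _ _)).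
  congr (P _); apply/seteqP; split => x /=.
    by move=> [[[h1 h2] h3] h4]; split => //; rewrite /E/= !leq_subLR -h3 -h4.
  by move=> [[h3 h4] []]; rewrite /E/= !leq_subLR -h3 -h4.
rewrite !key -!EFinD; congr (_%:E).
rewrite !mul0n !mul1n !subn0 !expnS.
(* With truncated subtraction this holds for p on either side of 2^n. *)
have -> : (2 * 2 ^ n - p = (2 ^ n - p) + (2 ^ n - (p - 2 ^ n)))%N by lia.
have -> : (2 * 2 ^ n - q = (2 ^ n - q) + (2 ^ n - (q - 2 ^ n)))%N by lia.
have : (4 ^ n)%:R != 0 :> R by rewrite pnatr_eq0 expn_eq0.
rewrite [in RHS]natrM !natrM !natrD; move: (4 ^ n)%:R => c c0.
by field.
Qed.

(** The number whose binary digits are those of odd rank in x; after [doubling] it collects those of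
    even rank. *)
Definition deinterleave (x : U) : U := limn (fun n => (evens n x)%:R / (2 ^ n)%:R : R).

Lemma evens_ratio_nd x : nondecreasing_seq (fun n => (evens n x)%:R / (2 ^ n)%:R : R).
Proof.
apply/nondecreasing_seqP => n; rewrite evensS expnS natrM.
rewrite ler_pdivlMr ?mulr_gt0 ?ltr0n ?expn_gt0// natrD natrM.
have -> : (evens n x)%:R / (2 ^ n)%:R * (2 * (2 ^ n)%:R) = 2 * (evens n x)%:R :> R.
  by field; rewrite pnatr_eq0 expn_eq0.
by rewrite lerDl.
Qed.

Lemma evens_ratio_cvg x : cvgn (fun n => (evens n x)%:R / (2 ^ n)%:R : R).
Proof.
apply: nondecreasing_is_cvgn; first exact: evens_ratio_nd.
exists 1 => _ [n _ <-]; rewrite ler_pdivrMr ?ltr0n ?expn_gt0// mul1r ler_nat.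
exact: ltnW (evens_lt _ _).
Qed.

Lemma measurable_evens_ratio n : measurable_fun setT (fun x : U => (evens n x)%:R : R).
Proof.
have mb : measurable_fun setT (fun x : U => (bit x)%:R : R).
  rewrite (_ : (fun x : U => (bit x)%:R) = (fun x : U => if bit x then 1 else 0 : R)).
    by apply: measurable_fun_ifT => //; exact: measurable_bit.
  by apply/funext => x; case: bit.
elim: n => [|n IH] /=; first exact: measurable_cst.
under eq_fun do rewrite natrD natrM.
apply: measurable_funD; first exact: measurable_funM.
apply: (measurableT_comp (f := fun x : U => (evens n x)%:R : R)) => //.
by apply: measurableT_comp; exact: measurable_doubling.
Qed.

Lemma measurable_deinterleave : measurable_fun setT deinterleave.
Proof.
apply: (measurable_fun_cvg (h := fun n (x : U) => (evens n x)%:R / (2 ^ n)%:R : R)).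
  by move=> n; apply: measurable_funM => //; exact: measurable_evens_ratio.
by move=> x _; exact: evens_ratio_cvg.
Qed.

(** The truncations increase to the limit, so a strict lower bound is already visible at a finite
    stage; joint tails thus become increasing unions. *)
Lemma lt_deinterleave (x : U) (y : R) :
  y < deinterleave x <-> exists n, y < (evens n x)%:R / (2 ^ n)%:R.
Proof.
split; last first.
  move=> [n h]; apply: (lt_le_trans h).
  by apply: nondecreasing_cvgn_le; [exact: evens_ratio_nd|exact: evens_ratio_cvg].
move=> h.
have cv : (fun n => (evens n x)%:R / (2 ^ n)%:R : R) @ \oo --> deinterleave x := @evens_ratio_cvg x.
move/cvgrPdist_lt : cv => /(_ (deinterleave x - y)).
rewrite subr_gt0 => /(_ h)[n _ /(_ n (leqnn _))/= hn]; exists n.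
move: hn; set u := _ / _.
by rewrite ltr_norml => /andP[_]; lra.
Qed.

(** The least k with y < k / 2^n; for negative y this is 0, which the truncation alone would
    miss. *)
Definition cut_index (y : R) (n : nat) : nat := if y < 0 then 0 else (Num.truncn ((2 ^ n)%:R * y)).+1.

Lemma cut_indexP (y : R) n (k : nat) : (y < k%:R / (2 ^ n)%:R) = (cut_index y n <= k)%N.
Proof.
rewrite /cut_index; have [y0|y0] := ltP y 0.
  by rewrite (lt_le_trans y0)// divr_ge0.
by rewrite ltr_pdivlMr ?ltr0n ?expn_gt0// mulrC -truncn_lt_nat// mulr_ge0.
Qed.

Lemma cut_index_cvg (y : R) :
  (2 ^ n - cut_index y n)%:R / (2 ^ n)%:R @[n --> \oo] --> fine (P `]y, +oo[%classic).
Proof.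
have n2 n : 0 < (2 ^ n)%:R :> R by rewrite ltr0n expn_gt0.
rewrite /cut_index; have [y0|y0] := ltP y 0.
  rewrite uniform_ray_lt0//=; under eq_fun do rewrite subn0 divff ?gt_eqF//.
  exact: cvg_cst.
have [y1|y1] := leP 1 y.
  rewrite uniform_ray_ge1//=; apply: cvg_near_cst; near=> n.
  have h : (2 ^ n <= Num.truncn ((2 ^ n)%:R * y))%N.
    by rewrite truncn_ge_nat ?mulr_ge0// ler_pMr.
  by have /eqP -> : (2 ^ n - (Num.truncn ((2 ^ n)%:R * y)).+1 == 0)%N; [lia|rewrite mul0r].
rewrite uniform_ray ?(ltW y1)//=.
apply: (@squeeze_cvgr _ _ _ _ (fun n => 1 - y - ((2 ^ n)%:R)^-1) (fun n => 1 - y)); last 2 first.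
- rewrite -[X in _ --> X]subr0; apply: cvgB; first exact: cvg_cst.
  have := @cvg_geometric R 1 2^-1; rewrite ger0_norm ?invr_ge0// invf_lt1// ltr1n => /(_ isT).
  by apply: cvg_trans; apply: near_eq_cvg; near=> n; rewrite /geometric/= mul1r exprVn natrX.
- exact: cvg_cst.
near=> n; set t := Num.truncn _.
have ty0 : 0 <= (2 ^ n)%:R * y by rewrite mulr_ge0.
have /andP[t1 t2] := truncn_itv ty0.
have tn : (t.+1 <= 2 ^ n)%N by rewrite /t truncn_lt_nat// gtr_pMr.
rewrite natrB// ler_pdivlMr// ler_pdivrMr// mulrBl mulVf ?gt_eqF//.
by rewrite -natr1 mulrBl mul1r (mulrC y); apply/andP; split; lra.
Unshelve. all: by end_near. Qed.

Lemma deinterleave_rays (y z : R) :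
  P [set x | y < deinterleave x /\ z < deinterleave (doubling x)] =
  (P `]y, +oo[%classic * P `]z, +oo[%classic)%E.
Proof.
pose S n : set U := [set x | (cut_index y n <= evens n x)%N /\ (cut_index z n <= evens n (doubling x))%N].
have mS n : measurable (S n).
  apply: measurableI; first exact: measurable_evens.
  exact: measurable_evens_doubling.
have SE : [set x | y < deinterleave x /\ z < deinterleave (doubling x)] = \bigcup_n S n.
  apply/seteqP; split => x /=.
    move=> [/lt_deinterleave[n hn] /lt_deinterleave[m hm]].
    exists (maxn n m) => //; rewrite /S/= -!cut_indexP; split.
      by apply: (lt_le_trans hn); apply: evens_ratio_nd; rewrite leq_maxl.
    by apply: (lt_le_trans hm); apply: evens_ratio_nd; rewrite leq_maxr.
  move=> [n _ [h1 h2]]; split; apply/lt_deinterleave; exists n; by rewrite cut_indexP.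
have c1 : P (S n) @[n --> \oo] --> P (\bigcup_n S n).
  apply: nondecreasing_cvg_mu => //; first exact: bigcupT_measurable.
  move=> n m nm; apply/subsetPset => x [/=]; rewrite /S/= -!cut_indexP => h1 h2; split.
    by apply: (lt_le_trans h1); exact: evens_ratio_nd.
  by apply: (lt_le_trans h2); exact: evens_ratio_nd.
rewrite SE -(cvg_lim _ c1)//.
rewrite -[X in (X * _)%E]fineK ?fin_num_measure// -[X in (_ * X)%E]fineK ?fin_num_measure//.
rewrite -EFinM; apply/cvg_lim => //.
under eq_fun do rewrite uniform_evens.
apply: cvg_EFin; first by near=> n.
apply: cvg_trans (cvgM (@cut_index_cvg y) (@cut_index_cvg z)); apply: near_eq_cvg; near=> n.
rewrite -[LHS]/((2 ^ n - cut_index y n)%:R / (2 ^ n)%:R * ((2 ^ n - cut_index z n)%:R / (2 ^ n)%:R)).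
rewrite -[RHS]/(((2 ^ n - cut_index y n) * (2 ^ n - cut_index z n))%:R / (4 ^ n)%:R).
by rewrite mulrACA -invfM -natrM -natrM -expnMn.
Unshelve. all: by end_near. Qed.

(** The factorisation on pairs of rays is extended one variable at a time, the other set being fixed
    so that both sides are finite measures. *)
Lemma deinterleave_indep (A B : set U) : measurable A -> measurable B ->
  P (deinterleave @^-1` A `&` (deinterleave \o doubling) @^-1` B) = (P A * P B)%E.
Proof.
move=> mA mB.
pose f : {mfun U >-> U} :=
  HB.pack deinterleave (isMeasurableFun.Build _ _ _ _ deinterleave measurable_deinterleave).
have mg' : measurable_fun setT (deinterleave \o doubling).
  by apply: measurableT_comp; [exact: measurable_deinterleave|exact: measurable_doubling].
pose g : {mfun U >-> U} :=
  HB.pack (deinterleave \o doubling) (isMeasurableFun.Build _ _ _ _ (deinterleave \o doubling) mg').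
have mpre (h : U -> U) C : measurable_fun setT h -> measurable C -> measurable (h @^-1` C).
  by move=> mh mC; rewrite -[X in measurable X]setTI; exact: mh.
have fin_restr (E : set U) (mE : measurable E) (h : {mfun U >-> U}) :
    (pushforward (mrestr P mE) h setT < +oo)%E.
  change (P (h @^-1` setT `&` E) < +oo)%E.
  by rewrite preimage_setT setTI ltey_eq fin_num_measure.
have step1 (y : R) : P (deinterleave @^-1` A `&` (deinterleave \o doubling) @^-1` `]y, +oo[%classic) =
    (P A * P `]y, +oo[%classic)%E.
  have mE := mpre _ `]y, +oo[%classic mg' (measurable_itv _).
  have p0 : 0 <= fine (P `]y, +oo[%classic) by exact: fine_ge0.
  transitivity (mscale (NngNum p0) P A); last by rewrite /mscale/= fineK ?fin_num_measure// muleC.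
  apply: (@measure_eq_rays R (pushforward (mrestr P mE) f) (mscale (NngNum p0) P)) => //.
    exact: fin_restr.
  move=> x; rewrite -[RHS]/((fine (P `]y, +oo[%classic))%:E * P `]x, +oo[%classic)%E.
  rewrite fineK ?fin_num_measure// muleC -deinterleave_rays; congr (P _).
  by apply/seteqP; split => w /=; rewrite !in_itv/= !andbT.
have mE := mpre _ A measurable_deinterleave mA.
have p0 : 0 <= fine (P A) by exact: fine_ge0.
transitivity (mscale (NngNum p0) P B); last by rewrite /mscale/= fineK ?fin_num_measure.
rewrite setIC.
apply: (@measure_eq_rays R (pushforward (mrestr P mE) g) (mscale (NngNum p0) P)) => //.
  exact: fin_restr.
by move=> x; rewrite -[RHS]/((fine (P A))%:E * P `]x, +oo[%classic)%E fineK ?fin_num_measure// -step1 setIC.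
Qed.

(** * Normal variables by inversion of the distribution function *)

Definition quantile (u : U) : R :=
  if (0 < (u : R) < 1) then inf [set x : R | (u%:E <= normal_prob 0 1 `]-oo, x]%classic)%E] else 0.

(** Right continuity of the distribution function makes the infimum attained, whence an exact
    equivalence. For u <= 0 the set would be unbounded below and for u >= 1 possibly empty, hence
    the restriction to ]0, 1[. *)
Lemma quantile_le (u : U) (x : R) : 0 < (u : R) < 1 ->
  (quantile u <= x) = (u%:E <= normal_prob 0 1 `]-oo, x]%classic)%E.
Proof.
move=> u01; rewrite /quantile u01.
have mid : measurable_fun setT (idfun : U -> R) by exact: measurable_id.
pose Z : {RV (normal_prob 0 1 : probability U R) >-> R} :=
  HB.pack (idfun : U -> R) (isMeasurableFun.Build _ _ _ R (idfun : U -> R) mid).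
pose Phi (y : R) := normal_prob 0 1 `]-oo, y]%classic : \bar R.
have PhiE y : Phi y = cdf Z y by [].
have Phi_nd y z : y <= z -> (Phi y <= Phi z)%E.
  by rewrite !PhiE; exact: cdf_nondecreasing.
pose A := [set x : R | (u%:E <= Phi x)%E].
have /andP[u0 u1] := u01.
have A0 : A !=set0.
  have := @cvg_cdfy1 _ _ _ _ Z.
  move=> /fine_cvgP[_ /cvgrPdist_lt/(_ (1 - u))].
  rewrite subr_gt0 => /(_ u1)[M [_ hM]]; exists (M + 1).
  have := hM (M + 1); rewrite ltrDl ltr01 => /(_ isT)/=.
  rewrite ltr_norml => /andP[_ h]; rewrite /A/= PhiE -[cdf Z _]fineK ?fin_num_measure//.
  by rewrite lee_fin; lra.
have Alb : has_lbound A.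
  have := @cvg_cdfNy0 _ _ _ _ Z.
  move=> /fine_cvgP[_ /cvgrPdist_lt/(_ u u0)[M [_ hM]]]; exists M => y Ay.
  rewrite leNgt; apply/negP => yM; have := hM y yM; rewrite /= sub0r normrN => h.
  have := le_lt_trans (ler_norm _) h; apply/negP; rewrite -leNgt.
  by move: Ay; rewrite /A/= PhiE -[cdf Z y]fineK ?fin_num_measure// lee_fin.
apply/idP/idP => h; last exact: ge_inf.
have rc := @cdf_right_continuous _ _ _ _ Z x.
apply: cvge_ge rc; near=> y.
have xy : x < y by near: y; exact: nbhs_right_gt.
have [a Aa ay] : exists2 a, A a & a < y by apply: inf_lt => //; exact: le_lt_trans xy.
by apply: (le_trans Aa); apply: Phi_nd; exact: ltW.
Unshelve. all: by end_near. Qed.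

Let c01 (x : R) : 0 <= fine (normal_prob 0 1 `]-oo, x]%classic) <= 1.
Proof.
rewrite fine_ge0//=; rewrite -lee_fin fineK ?fin_num_measure//.
exact: probability_le1.
Qed.

Let quantile_gt (x : R) : [set u : U | x < quantile u] `&` `]0, 1[%classic =
  `]fine (normal_prob 0 1 `]-oo, x]%classic), 1[%classic.
Proof.
have /andP[c0 c1] := c01 x.
apply/seteqP; split => u /=; rewrite !in_itv/=.
  move=> [+ u01]; rewrite ltNge (quantile_le _ u01) -ltNge.
  rewrite -[X in (X < _)%E]fineK ?fin_num_measure// lte_fin => ->.
  by case/andP: u01.
move=> /andP[cu u1]; have u01 : 0 < (u : R) < 1 by rewrite u1 (le_lt_trans c0 cu).
split => //; rewrite ltNge (quantile_le _ u01) -ltNge.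
by rewrite -[X in (X < _)%E]fineK ?fin_num_measure// lte_fin.
Qed.

Lemma measurable_quantile : measurable_fun setT quantile.
Proof.
apply: (measurability (@RGenOInfty.G R) (@RGenOInfty.measurableE R)) => _ [_ [x ->] <-].
rewrite setTI (_ : _ @^-1` _ = ([set u : U | x < quantile u] `&` `]0, 1[%classic) `|`
   (~` `]0, 1[%classic `&` (if x < 0 then setT else set0))).
  rewrite quantile_gt; apply: measurableU => //; apply: measurableI; first exact: measurableC.
  by case: ifP.
apply/seteqP; split => u /=; rewrite !in_itv/= andbT.
  move=> xu; have [u01|u01] := boolP (0 < (u : R) < 1); first by left.
  by right; split; [exact/negP|move: xu; rewrite /quantile (negbTE u01) => ->].
move=> [[]//|[/negP u01]]; rewrite /quantile (negbTE u01).
by case: ifP.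
Qed.

Lemma quantile_law (A : set R) : measurable A ->
  P (quantile @^-1` A) = normal_prob 0 1 A.
Proof.
move=> mA; apply: (@law_eq_rays R _ _ U U P (normal_prob 0 1) quantile id) => //.
  exact: measurable_quantile.
move=> x; have /andP[c0 c1] := c01 x.
have P01 : P `]0, 1[%classic = 1%E by rewrite uniform_itv// subr0.
rewrite (prob_setI_full _ P01)//; last first.
  rewrite (_ : [set _ | _] = quantile @^-1` `]x, +oo[%classic).
    by rewrite -[X in measurable X]setTI; exact: measurable_quantile.
  by apply/seteqP; split => u /=; rewrite in_itv/= andbT.
rewrite quantile_gt uniform_itv//.
rewrite (_ : [set w | x < id w] = ~` `]-oo, x]%classic); last first.
  by apply/seteqP; split => u /=; rewrite in_itv/= ltNge; [move/negP|move/negP].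
have := probability_setC (normal_prob 0 1 : probability U R) (measurable_itv `]-oo, x]).
move=> ->; rewrite -[X in (_ - X)%E]fineK ?fin_num_measure//.
Qed.

Lemma quantile_glaw : glaw P quantile 1.
Proof.
split => //; first exact: measurable_quantile.
move=> A mA; rewrite quantile_law//; congr (normal_prob _ _ _).
by apply/seteqP; split => z /=; rewrite sqrtr1 mul1r.
Qed.

End uniform.

(** Digits of odd rank feed the current variable, those of even rank are handed on to the following
    ones. *)
Lemma gauss_space (R : realType) : exists (d : measure_display) (T : measurableType d)
    (P : probability T R) (xi : nat -> T -> R),
  forall N (a : nat -> R),
  glaw P (fun w => \sum_(k < N) a k * xi k w) (\sum_(k < N) a k ^+ 2).
Proof.
exists _, (measurableTypeR R), (uniform_prob (@ltr01 R)).
pose U := measurableTypeR R.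
exists (gauss_seq (@deinterleave R) (@deinterleave R \o @doubling R) (@quantile R)) => N a.
apply: gauss_seq_sum.
- exact: measurable_deinterleave.
- by apply: measurableT_comp; [exact: measurable_deinterleave|exact: measurable_doubling].
- by move=> A B mA mB; exact: deinterleave_indep.
- exact: quantile_glaw.
Qed.

(** * Gaussian families with a given covariance *)

Section cholesky.
Context (R : realType).

Definition qform (I : Type) (K : I -> I -> R) (s : seq (R * I)) : R :=
  \sum_(p <- s) \sum_(q <- s) p.1 * q.1 * K p.2 q.2.

Definition psd (I : Type) (K : I -> I -> R) :=
  (forall i j, K i j = K j i) /\ forall s, 0 <= qform K s.

Lemma qform_cons (I : Type) (K : I -> I -> R) x k s : (forall i j, K i j = K j i) ->
  qform K ((x, k) :: s) = x ^+ 2 * K k k + 2 * x * (\sum_(p <- s) p.1 * K p.2 k) + qform K s.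
Proof.
move=> Ksym; rewrite /qform big_cons big_cons/=.
under [X in _ + X]eq_bigr => p _ do rewrite big_cons/=.
rewrite big_split/=.
have -> : \sum_(q <- s) x * q.1 * K k q.2 = x * \sum_(p <- s) p.1 * K p.2 k.
  by rewrite mulr_sumr; apply: eq_bigr => p _; rewrite (Ksym k); ring.
have -> : \sum_(p <- s) p.1 * x * K p.2 k = x * \sum_(p <- s) p.1 * K p.2 k.
  by rewrite mulr_sumr; apply: eq_bigr => p _; ring.
ring.
Qed.

Lemma psd_diag (I : Type) (K : I -> I -> R) k : psd K -> 0 <= K k k.
Proof. by move=> [_ /(_ [:: (1, k)])]; rewrite /qform !big_seq1/= !mul1r. Qed.

(** Otherwise the form would be affine and nonconstant in the coefficient of k, hence unbounded
    below; the coefficient chosen makes it equal to -1. *)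
Lemma psd_diag0 (I : Type) (K : I -> I -> R) i k : psd K -> K k k = 0 -> K i k = 0.
Proof.
move=> [Ksym Kpsd] Kkk.
have [//|Kik] := eqVneq (K i k) 0.
have := Kpsd [:: (- (K i i + 1) / (2 * K i k), k); (1, i)].
rewrite qform_cons// Kkk /qform !big_seq1/= mulr0 add0r !mul1r.
have -> : 2 * (- (K i i + 1) / (2 * K i k)) * K i k = - (K i i + 1) by field.
by move=> h; exfalso; lra.
Qed.

(* If [K k k = 0] then [K i k = 0] by [psd_diag0], so the junk value of the
   quotient is harmless. *)
Definition schur_step (I : Type) (K : I -> I -> R) k i j := K i j - K i k * K j k / K k k.

(** With B as below, the new form is the minimum of the old one over the coefficient given to k,
    reached at -B / K k k. *)
Lemma psd_schur_step (I : Type) (K : I -> I -> R) k : psd K -> psd (schur_step K k).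
Proof.
move=> KP; have [Ksym Kpsd] := KP; split.
  by move=> i j; rewrite /schur_step (Ksym j i) [K j k * _]mulrC.
move=> s; set B := \sum_(p <- s) p.1 * K p.2 k.
have -> : qform (schur_step K k) s = qform K s - B ^+ 2 / K k k.
  rewrite /qform /schur_step.
  under eq_bigr => p _. under eq_bigr => q _ do rewrite mulrBr. rewrite sumrB; over.
  rewrite sumrB; congr (_ - _).
  rewrite expr2 {1}/B !mulr_suml; apply: eq_bigr => p _.
  by rewrite /B mulr_sumr mulr_suml; apply: eq_bigr => q _; ring.
have K0 := psd_diag k KP.
have [E|Kn] := eqVneq (K k k) 0; first by rewrite E invr0 mulr0 subr0.
have := Kpsd ((- B / K k k, k) :: s); rewrite qform_cons// -/B.
by have -> : (- B / K k k) ^+ 2 * K k k + 2 * (- B / K k k) * B + qform K s = qform K s - B ^+ 2 / K k k by field.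
Qed.

(** Residual covariance once the variables of index less than n have been projected out. *)
Fixpoint schur (K : nat -> nat -> R) n : nat -> nat -> R :=
  if n is m.+1 then schur_step (schur K m) m else K.

Lemma psd_schur K n : psd K -> psd (schur K n).
Proof. by move=> KP; elim: n => //= n IH; exact: psd_schur_step. Qed.

Lemma schur_eq0 K n i j : psd K -> (i < n)%N -> schur K n i j = 0.
Proof.
move=> KP; elim: n i j => // n IH i j; have SP := psd_schur n KP; have [Ssym _] := SP.
rewrite ltnS leq_eqVlt => /orP[/eqP ->|lin] /=; rewrite /schur_step.
  have [E|N] := eqVneq (schur K n n n) 0.
    by rewrite E invr0 mulr0 subr0 Ssym; exact: psd_diag0.
  by rewrite (Ssym j n); field.
by rewrite (IH i j)// (IH i n)// mul0r mul0r subr0.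
Qed.

Definition cholesky K i k : R := schur K k i k / Num.sqrt (schur K k k k).

(** Step k removes exactly the product of the two entries of column k, so the sum telescopes. A zero
    pivot gives a zero column, consistently with [schur_step]. *)
Lemma choleskyE K n i j : psd K ->
  K i j = \sum_(k < n) cholesky K i k * cholesky K j k + schur K n i j.
Proof.
move=> KP; elim: n => [|n IH]; first by rewrite big_ord0 add0r.
rewrite big_ord_recr/= {1}IH -addrA; congr (_ + _).
rewrite /schur_step /cholesky mulrACA -invfM -expr2 sqr_sqrtr; last exact/psd_diag/psd_schur.
by rewrite addrC subrK.
Qed.

Lemma cholesky_sum K n i j : psd K -> (i < n)%N ->
  K i j = \sum_(k < n) cholesky K i k * cholesky K j k.
Proof. by move=> KP lin; rewrite (choleskyE n i j KP) schur_eq0// addr0. Qed.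

Lemma cholesky_eq0 K i k : psd K -> (i < k)%N -> cholesky K i k = 0.
Proof. by move=> KP lik; rewrite /cholesky schur_eq0// mul0r. Qed.

End cholesky.

Lemma gaussian_family_nat (R : realType) (K : nat -> nat -> R) : psd K ->
  exists (d : measure_display) (T : measurableType d) (P : probability T R)
         (Z : nat -> T -> R), gaussian_family P predT K Z.
Proof.
move=> KP; have [d [T [P [xi xiP]]]] := gauss_space R.
exists d, T, P, (fun i w => \sum_(k < i.+1) cholesky K i k * xi k w) => s _.
(* Every row used has index below N, so it can be summed up to N, its entries beyond the diagonal
   being 0; N is then also large enough for the factorisation to be exact. *)
pose N := (\max_(p <- s) p.2).+1.
have sN p : p \in s -> (p.2 < N)%N by move=> ps; rewrite ltnS; exact: leq_bigmax_seq.
have -> : (fun w => \sum_(p <- s) p.1 * \sum_(k < p.2.+1) cholesky K p.2 k * xi k w) =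
   (fun w => \sum_(k < N) (\sum_(p <- s) p.1 * cholesky K p.2 k) * xi k w).
  apply/funext => w; under [RHS]eq_bigr => k _ do rewrite mulr_suml.
  rewrite exchange_big/= big_seq [RHS]big_seq; apply: eq_bigr => p ps.
  rewrite (big_ord_widen N (fun k => cholesky K p.2 k * xi k w)) ?sN// big_mkcond/= mulr_sumr.
  apply: eq_bigr => k _; case: ifPn => [_|]; first by rewrite mulrA.
  by rewrite -leqNgt => pk; rewrite cholesky_eq0// mulr0 mul0r.
have := xiP N (fun k => \sum_(p <- s) p.1 * cholesky K p.2 k).
congr glaw.
under eq_bigr => k _.
  rewrite expr2 mulr_suml; under eq_bigr => p _ do rewrite mulr_sumr; over.
rewrite exchange_big/= big_seq [RHS]big_seq; apply: eq_bigr => p ps.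
rewrite exchange_big/=; apply: eq_bigr => q _.
rewrite (cholesky_sum q.2 KP (sN _ ps)) mulr_sumr; apply: eq_bigr => k _; ring.
Qed.

(** Codes that decode to nothing are sent to i0. The kernel on nat may then have repeated rows,
    which semidefiniteness tolerates. *)
Lemma gaussian_family_exists (R : realType) (I : countType) (i0 : I) (K : I -> I -> R) :
  psd K ->
  exists (d : measure_display) (T : measurableType d) (P : probability T R)
         (Z : I -> T -> R), gaussian_family P predT K Z.
Proof.
move=> [Ksym Kpsd]; pose D (n : nat) : I := odflt i0 (unpickle n).
have KD : psd (fun m n => K (D m) (D n)).
  split; first by move=> m n; exact: Ksym.
  move=> s; have := Kpsd [seq (p.1, D p.2) | p <- s].
  by rewrite /qform big_map; under eq_bigr => p _ do rewrite big_map.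
have [d [T [P [Z ZP]]]] := gaussian_family_nat KD.
exists d, T, P, (fun i => Z (pickle i)) => s _.
have := ZP [seq (p.1, pickle p.2) | p <- s]; rewrite all_predT => /(_ isT).
congr glaw; first by apply/funext => w; rewrite big_map.
rewrite big_map; apply: eq_bigr => p _; rewrite big_map; apply: eq_bigr => q _.
by rewrite /D !pickleK.
Qed.

(** * Continuous versions *)

Lemma geometric_cauchy (R : realType) (u : nat -> R) (C r : R) : 0 <= C -> 0 < r < 1 ->
  (forall n, `|u n.+1 - u n| <= C * r ^+ n) ->
  cvgn u /\ forall n, `|limn u - u n| <= C * r ^+ n / (1 - r).
Proof.
move=> C0 /andP[r0 r1] hu.
have r1' : 0 < 1 - r by rewrite subr_gt0.
have H m n : `|u (n + m)%N - u n| <= C * r ^+ n / (1 - r).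
  (* The induction on m closes only with the exact partial geometric sum. *)
  suff : `|u (n + m)%N - u n| <= C * r ^+ n * (1 - r ^+ m) / (1 - r).
    move=> /le_trans; apply; rewrite ler_pM2r ?invr_gt0//.
    have h0 : 0 <= C * r ^+ n by rewrite mulr_ge0// exprn_ge0// ltW.
    by rewrite -[leRHS]mulr1 ler_wpM2l// gerDl oppr_le0 exprn_ge0// ltW.
  elim: m => [|m IH]; first by rewrite addn0 subrr normr0 expr0 subrr mulr0 mul0r.
  rewrite addnS (_ : u _ - _ = (u (n + m).+1 - u (n + m)%N) + (u (n + m)%N - u n)); last by ring.
  apply: (le_trans (ler_normD _ _)); apply: (le_trans (lerD (hu _) IH)).
  by rewrite le_eqVlt; apply/orP; left; apply/eqP; rewrite exprD exprS; field; rewrite gt_eqF.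
have rn : C * r ^+ n / (1 - r) @[n --> \oo] --> (0 : R).
  rewrite -(mul0r (1 - r)^-1) -[X in X * _](mulr0 C).
  by apply: cvgMl; apply: cvgMr; apply: cvg_expr; rewrite ger0_norm ?ltW.
have cu : cvgn u.
  have -> : u = (fun n => u 0%N + series (telescope u) n).
    by apply/funext => n; exact: eq_sum_telescope.
  apply: is_cvgD; first exact: is_cvg_cst.
  apply: normed_cvg; apply: (@series_le_cvg _ _ (geometric C r)) => [n|n|n|] //=.
  - by rewrite mulr_ge0// exprn_ge0// ltW.
  - exact: hu.
  - by apply: is_cvg_geometric_series; rewrite ger0_norm ?ltW.
split => // n.
have cun : u (n + m)%N - u n @[m --> \oo] --> limn u - u n.
  apply: cvgB; last exact: cvg_cst.
  under eq_fun do rewrite addnC.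
  have h := @cvg_shiftn n _ u (nbhs (limn u)).
  by change (([sequence u (m + n)%N]_m : R^nat) @ \oo --> limn u); rewrite h.
have cn : `|u (n + m)%N - u n| @[m --> \oo] --> `|limn u - u n| by exact: cvg_norm cun.
rewrite -(cvg_lim _ cn)//; apply: limr_le; first by apply/cvg_ex; eexists; exact: cn.
by apply: nearW => m; exact: H.
Qed.

Lemma cvg_sum_seq (R : realType) (I : eqType) (s : seq I) (f : I -> R^nat) (l : I -> R) :
  (forall i, i \in s -> f i n @[n --> \oo] --> l i) ->
  \sum_(i <- s) f i n @[n --> \oo] --> \sum_(i <- s) l i.
Proof.
elim: s => [|i s IH] fl.
  by under eq_fun do rewrite big_nil; rewrite big_nil; exact: cvg_cst.
under eq_fun do rewrite big_cons; rewrite big_cons; apply: cvgD.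
  by apply: fl; rewrite mem_head.
by apply: IH => j js; apply: fl; rewrite inE js orbT.
Qed.

(** * Limits along nested dyadic grids *)

Section dyadic_limit.
Context (R : realType).
Variables (y : nat -> nat -> R) (C r : R).
Hypotheses (C0 : 0 <= C) (r01 : 0 < r < 1).
Hypothesis yE : forall n k, y n.+1 k.*2 = y n k.
Hypothesis ydiff : forall n k, (k < 4 ^ n)%N -> `|y n k.+1 - y n k| <= C * r ^+ n.

(** [y n k] stands for a value at k / 2^n; this picks the last grid point of level n not exceeding
    t. *)
Definition dyadic_step (n : nat) (t : R) : R := y n (Num.truncn ((2 ^ n)%:R * t)).

Lemma truncn_double n (t : R) : 0 <= t -> exists e : bool,
  Num.truncn ((2 ^ n.+1)%:R * t) = ((Num.truncn ((2 ^ n)%:R * t)).*2 + e)%N.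
Proof.
move=> t0; have a0 : 0 <= (2 ^ n)%:R * t by rewrite mulr_ge0.
have /andP[h1 h2] := truncn_itv a0.
set k := Num.truncn _ in h1 h2 *.
have E : (2 ^ n.+1)%:R * t = 2 * ((2 ^ n)%:R * t) by rewrite expnS natrM mulrA.
rewrite E; set x := (2 ^ n)%:R * t in h1 h2 *.
rewrite -natr1 in h2.
have [h|h] := ltP (2 * x) (k.*2.+1)%:R.
  exists false; rewrite addn0; apply: truncn_def; rewrite h andbT.
  by rewrite -muln2 natrM mulrC ler_pM2l.
exists true; rewrite addn1; apply: truncn_def; rewrite h/=.
have -> : k.*2.+2%:R = 2 * (k%:R + 1) :> R by rewrite natr1 -natrM mul2n doubleS.
by rewrite ltr_pM2l.
Qed.

Lemma truncn_bound N n (t : R) : 0 <= t -> t <= N%:R -> (N < 2 ^ n)%N ->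
  (Num.truncn ((2 ^ n)%:R * t) < 4 ^ n)%N.
Proof.
move=> t0 tN Nn; rewrite truncn_lt_nat ?mulr_ge0//.
apply: (@le_lt_trans _ _ ((2 ^ n)%:R * N%:R)); first by rewrite ler_pM2l// ltr0n expn_gt0.
have -> : (4 ^ n = 2 ^ n * 2 ^ n)%N by rewrite -expnMn.
by rewrite -natrM ltr_nat ltn_pmul2l ?expn_gt0.
Qed.

(** Refining the grid either keeps the point chosen or moves it to its right neighbour at level n +
    1. The condition N < 2^n ensures that this neighbour pair is among the 4^n controlled ones. *)
Lemma dyadic_step_diff N n (t : R) : 0 <= t -> t <= N%:R -> (N < 2 ^ n)%N ->
  `|dyadic_step n.+1 t - dyadic_step n t| <= C * r ^+ n.+1.
Proof.
move=> t0 tN Nn; rewrite /dyadic_step.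
have Nn1 : (N < 2 ^ n.+1)%N by rewrite (ltn_trans Nn)// ltn_exp2l.
have b1 := truncn_bound t0 tN Nn1.
have [e Ee] := truncn_double n t0; rewrite Ee -(yE n).
case: e Ee => Ee; last first.
  by rewrite addn0 subrr normr0 mulr_ge0// exprn_ge0// ltW//; case/andP: r01.
rewrite addn1; apply: ydiff; rewrite Ee addn1 in b1.
exact: ltn_trans b1.
Qed.

Lemma dyadic_step_cvg N n (t : R) : 0 <= t -> t <= N%:R -> (N < 2 ^ n)%N ->
  cvgn (dyadic_step ^~ t) /\
  `|limn (dyadic_step ^~ t) - dyadic_step n t| <= C * r ^+ n / (1 - r).
Proof.
move=> t0 tN Nn.
have hu m : `|dyadic_step (m.+1 + n) t - dyadic_step (m + n) t| <= C * r ^+ n * r ^+ m.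
  have Nm : (N < 2 ^ (m + n))%N by rewrite (leq_trans Nn)// leq_exp2l// leq_addl.
  apply: (le_trans (dyadic_step_diff t0 tN Nm)).
  have /andP[r0 r1] := r01.
  rewrite -mulrA ler_wpM2l// -exprD addnC -[leRHS]mulr1 exprSr ler_wpM2l ?exprn_ge0 ?ltW//.
have Cr : 0 <= C * r ^+ n by rewrite mulr_ge0// exprn_ge0// ltW//; case/andP: r01.
have [c l] := geometric_cauchy Cr r01 hu.
have cl : dyadic_step ^~ t @ \oo --> limn (fun m => dyadic_step (m + n) t).
  by rewrite -(cvg_shiftn n).
have c' : cvgn (dyadic_step ^~ t) by apply/cvg_ex; eexists; exact: cl.
split => //; have := l 0%N; rewrite add0n expr0 mulr1.
by rewrite (cvg_lim _ cl).
Qed.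

(** Two points at distance at most 2^-n lie in the same cell or in adjacent ones. *)
Lemma dyadic_step_close N n (s t : R) : 0 <= s -> s <= N%:R -> 0 <= t -> t <= N%:R ->
  (N < 2 ^ n)%N -> `|s - t| <= (2 ^ n)%:R^-1 ->
  `|dyadic_step n s - dyadic_step n t| <= C * r ^+ n.
Proof.
wlog st : s t / s <= t => [H|] s0 sN t0 tN Nn d.
  case: (leP s t) => [st|/ltW ts]; first exact: H.
  by rewrite distrC; apply: H => //; rewrite distrC.
rewrite /dyadic_step.
have n0 : 0 < (2 ^ n)%:R :> R by rewrite ltr0n expn_gt0.
have a0 : 0 <= (2 ^ n)%:R * s by rewrite mulr_ge0.
have b0 : 0 <= (2 ^ n)%:R * t by rewrite mulr_ge0.
have /andP[h1 h2] := truncn_itv a0; have /andP[h3 h4] := truncn_itv b0.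
have bs := truncn_bound s0 sN Nn.
have d' : (2 ^ n)%:R * t <= (2 ^ n)%:R * s + 1.
  rewrite -lerBlDl -mulrBr -ler_pdivlMl// mulr1; apply: le_trans d.
  by rewrite distrC ler_norm.
have ab : (2 ^ n)%:R * s <= (2 ^ n)%:R * t by rewrite ler_pM2l.
move: h1 h2 h3 h4 bs; set k := Num.truncn _; set l := Num.truncn _ => h1 h2 h3 h4 bs.
have kl : (k <= l)%N by rewrite /k /l; exact: le_truncn.
have lk : (l <= k.+1)%N.
  rewrite -ltnS -(ltr_nat R) (le_lt_trans h3)// (le_lt_trans d')//.
  by rewrite -[in ltRHS]natr1 ltrD2r.
have [->|kl'] := eqVneq k l.
  by rewrite subrr normr0 mulr_ge0// exprn_ge0// ltW//; case/andP: r01.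
have -> : l = k.+1 by apply/eqP; rewrite eqn_leq lk ltn_neqAle kl' kl.
by rewrite distrC; exact: ydiff.
Qed.

Lemma dyadic_limit_unif N (e : R) : 0 < e -> exists2 del : R, 0 < del &
  forall s t, 0 <= s -> s <= N%:R -> 0 <= t -> t <= N%:R -> `|s - t| < del ->
  `|limn (dyadic_step ^~ s) - limn (dyadic_step ^~ t)| < e.
Proof.
move=> e0; have /andP[r0 r1] := r01.
have r1' : 0 < 1 - r by rewrite subr_gt0.
(* One C for the passage between adjacent cells, and C / (1 - r) for the chain from each grid point
   to its limit. *)
have rn : (C + 2 * C / (1 - r)) * r ^+ n @[n --> \oo] --> (0 : R).
  by rewrite -(mulr0 (C + 2 * C / (1 - r))); apply: cvgMr; apply: cvg_expr; rewrite ger0_norm ?ltW.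
move/cvgrPdist_lt : rn => /(_ _ e0) [n0 _ hn].
pose n := maxn n0 N.
have Nn : (N < 2 ^ n)%N by apply: (leq_ltn_trans (leq_maxr n0 N)); exact: ltn_expl.
have := hn n (leq_maxl _ _); rewrite /= sub0r normrN => hne.
exists (2 ^ n)%:R^-1; first by rewrite invr_gt0 ltr0n expn_gt0.
move=> s t s0 sN t0 tN st.
have [_ ls] := dyadic_step_cvg s0 sN Nn; have [_ lt] := dyadic_step_cvg t0 tN Nn.
have d := dyadic_step_close s0 sN t0 tN Nn (ltW st).
move: ls lt d; set x := limn _; set z := limn _; set a := dyadic_step n s; set b := dyadic_step n t => ls lt d.
apply: le_lt_trans (le_lt_trans (ler_norm _) hne).
rewrite (_ : x - z = (x - a) + (a - b) - (z - b)); last by ring.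
apply: (le_trans (ler_normB _ _)); apply: (le_trans (lerD (ler_normD _ _) (lexx _))).
apply: (le_trans (lerD (lerD ls d) lt)).
rewrite le_eqVlt; apply/orP; left; apply/eqP; field; by rewrite gt_eqF.
Qed.

End dyadic_limit.

(** * Chaining by exponential moments *)

Section dyadic_process.
Context (R : realType) d (T : measurableType d) (P : probability T R).
Variables (Y : nat * nat -> T -> R) (K : R -> R -> R) (c q : R).

Definition dyadic (i : nat * nat) : R := i.2%:R / (2 ^ i.1)%:R.

Hypothesis gY : gaussian_family P predT (fun i j => K (dyadic i) (dyadic j)) Y.
Hypothesis YE : forall n k w, Y (n.+1, k.*2) w = Y (n, k) w.
Hypotheses (c0 : 0 < c) (q01 : 0 < q < 1).
Hypothesis Kinc : forall n k, let s := dyadic (n, k) in let t := dyadic (n, k.+1) in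
  K t t - K s t - K t s + K s s <= c ^+ 2 * q ^+ (4 * n).

(** A bound for the standard deviation of the increments at level n. The exponent 2 n leaves a
    factor q^n to spare, which absorbs the growth in n found in [regular_paths_bound]. *)
Let sd n := c * q ^+ (2 * n).

Let incr n k w := Y (n, k.+1) w - Y (n, k) w.

Let sd_gt0 n : 0 < sd n.
Proof. by case/andP: q01 => q0 _; rewrite mulr_gt0// exprn_gt0. Qed.

Let incr_glaw n k : exists2 v, v <= sd n ^+ 2 & glaw P (incr n k) v.
Proof.
eexists; last first.
  have := gY (s := [:: (1, (n, k.+1)); (-1, (n, k))]) isT.
  under [X in glaw _ X _ -> _]eq_fun do rewrite big_cons big_seq1/= mul1r mulN1r.
  exact.
apply: le_trans (le_trans (Kinc n k) _); last first.
  by rewrite /sd exprMn -exprM (_ : (2 * n * 2 = 4 * n)%N)// mulnAC.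
rewrite !big_cons !big_nil/= le_eqVlt; apply/orP; left; apply/eqP; ring.
Qed.

Let measurable_incr n k : measurable_fun setT (incr n k).
Proof. by have [v _ []] := incr_glaw n k. Qed.

(* The factor [8 ^- n] compensates the [4 ^ n] cells, whose exponential moments are
   bounded uniformly in [n] and [k]. *)
Let term n w : \bar R := ((8 ^- n) * \sum_(k < 4 ^ n) expR (`|incr n k w| / sd n))%:E.

Let measurable_term n : measurable_fun setT (term n).
Proof.
apply/measurable_EFinP; apply: measurable_funM => //.
apply: measurable_sum => k; apply: measurableT_comp => //.
by apply: measurable_funM => //; apply: measurableT_comp => //; exact: measurable_incr.
Qed.

Let term_ge0 n w : (0 <= term n w)%E.
Proof.
by rewrite lee_fin mulr_ge0 ?invr_ge0 ?exprn_ge0// sumr_ge0// => k _; exact: expR_ge0.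
Qed.

Let total w : \bar R := (\sum_(0 <= n <oo) term n w)%E.

Let measurable_total : measurable_fun setT total.
Proof. exact: ge0_emeasurable_sum. Qed.

Let integral_term n : (\int[P]_w term n w <= (2 * expR 2^-1 / 2 ^+ n)%:E)%E.
Proof.
rewrite /term; under eq_integral do rewrite EFinM -sumEFin.
have me k : measurable_fun setT (fun w => (expR (`|incr n k w| / sd n))%:E).
  apply/measurable_EFinP; apply: measurableT_comp => //.
  by apply: measurable_funM => //; apply: measurableT_comp => //; exact: measurable_incr.
rewrite ge0_integralZl//; last 2 first.
- by apply: emeasurable_sum => k; exact: me.
- by move=> w _; apply: sume_ge0 => k _; rewrite lee_fin expR_ge0.
rewrite ge0_integral_sum//.
apply: (@le_trans _ _ ((8 ^- n)%:E * \sum_(k < 4 ^ n) (2 * expR 2^-1)%:E)%E).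
  apply: lee_wpmul2l; first by rewrite lee_fin invr_ge0 exprn_ge0.
  apply: lee_sum => k _; have [v vs gv] := incr_glaw n k.
  have := glaw_exp_abs gv vs; rewrite sqrtr_sqr ger0_norm//; exact: ltW.
rewrite sumEFin -EFinM lee_fin sumr_const card_ord -mulr_natr.
rewrite -[_ *+ (4 ^ n)]mulr_natr natrX (_ : 8 = 4 * 2 :> R); last by rewrite -natrM.
rewrite mul1r.
rewrite exprMn le_eqVlt; apply/orP; left; apply/eqP.
by field; rewrite !expf_eq0/= !pnatr_eq0 !andbF.
Qed.

Let integral_total : (\int[P]_w total w < +oo)%E.
Proof.
rewrite /total integral_nneseries//.
apply: (@le_lt_trans _ _ (4 * expR 2^-1)%:E); last exact: ltry.
apply: lime_le; first by apply: is_cvg_nneseries => n _ _; exact: integral_ge0.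
apply: nearW => N.
apply: (@le_trans _ _ (\sum_(0 <= n < N) (2 * expR 2^-1 / 2 ^+ n)%:E)%E).
  by apply: lee_sum => n _; exact: integral_term.
rewrite sumEFin lee_fin.
suff -> : \sum_(0 <= n < N) 2 * expR 2^-1 / 2 ^+ n = 4 * expR 2^-1 * (1 - 2 ^- N) :> R.
  by rewrite -[leRHS]mulr1 ler_wpM2l ?mulr_ge0 ?expR_ge0// gerDl oppr_le0 invr_ge0 exprn_ge0.
elim: N => [|N IH]; first by rewrite big_geq// expr0 invr1 subrr mulr0.
rewrite big_nat_recr//= IH exprS; field.
by rewrite !expf_eq0/= !pnatr_eq0 !andbF.
Qed.

Definition regular_paths : set T := [set w | (total w < +oo)%E].

Lemma measurable_regular_paths : measurable regular_paths.
Proof.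
rewrite /regular_paths -[X in measurable X]setTI.
exact: emeasurable_fun_infty_o.
Qed.

Lemma regular_paths_full : P regular_paths = 1%E.
Proof.
have it : P.-integrable setT total.
  apply/integrableP; split => //; apply: le_lt_trans integral_total.
  apply: ge0_le_integral => //=.
  - exact: measurableT_comp.
  - by move=> w _; rewrite gee0_abs// nneseries_ge0.
have mO := measurable_regular_paths.
have N0 : P (~` regular_paths) = 0%E.
  have [N [mN PN sub]] := integrable_ae measurableT it.
  apply: (subset_measure0 _ mN _ PN); first exact: measurableC.
  move=> w wO; apply: sub => /= /(_ I); rewrite fin_numE => /andP[_ h].
  by apply: wO; rewrite /regular_paths/= ltey.
have := probability_setC P mO; rewrite N0 => /esym h.
by have := @probability_le1 _ _ _ P _ mO; move: h; case: (P _) => //= r [] h _; congr (_%:E); lra.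
Qed.

(** Each exponential is at most 8^n times the finite total, so taking logarithms leaves the
    deviation times a linear function of n. *)
Lemma regular_paths_bound w : regular_paths w -> exists2 C : R, 0 <= C &
  forall n k, (k < 4 ^ n)%N -> `|incr n k w| <= C * q ^+ n.
Proof.
rewrite /regular_paths/= => tw.
have t0 : (0 <= total w)%E by exact: nneseries_ge0.
have [M M0 EM] : exists2 M : R, 0 <= M & total w = M%:E.
  by move: t0 tw; case: (total w) => // r; rewrite lee_fin => r0 _; exists r.
have /andP[q0 q1] := q01.
(* The 7 comes from 8 = 1 + 7 <= e^7, and likewise M <= e^M. *)
have key n k : (k < 4 ^ n)%N -> `|incr n k w| <= sd n * (M + 7 * n%:R).
  move=> kn; rewrite mulrC -ler_pdivrMr//.
  suff : expR (`|incr n k w| / sd n) <= expR (M + 7 * n%:R) by rewrite ler_expR.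
  have h1 : (term n w <= M%:E)%E.
    rewrite -EM; apply: (@le_trans _ _ (\sum_(0 <= i < n.+1) term i w)%E); last first.
      exact: nneseries_lim_ge.
    by rewrite big_nat_recr//= leeDr// sume_ge0.
  have h2 : expR (`|incr n k w| / sd n) <= 8 ^+ n * M.
    rewrite /term lee_fin mulrC ler_pdivrMr ?exprn_gt0// in h1.
    rewrite [leRHS]mulrC; apply: le_trans h1; rewrite (bigD1 (Ordinal kn))//= lerDl.
    by rewrite sumr_ge0// => i _; exact: expR_ge0.
  apply: (le_trans h2); rewrite addrC expRD ler_pM ?exprn_ge0//.
    rewrite mulrC expRM_natl lerXn2r ?nnegrE ?expR_ge0//.
    by have := expR_ge1Dx (7 : R); rewrite (_ : 1 + 7 = 8)//; ring.
  by have := expR_ge1Dx M; apply: le_trans; rewrite lerDr.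
exists (c * (M + 7 / (q^-1 - 1))) => [|n k kn].
  rewrite mulr_ge0 ?(ltW c0)// addr_ge0// divr_ge0// subr_ge0.
  by rewrite invf_ge1// ltW.
apply: (le_trans (key _ _ kn)); rewrite /sd -!mulrA ler_pM2l//.
rewrite mul2n -addnn exprD -mulrA mulrC ler_pM2r ?exprn_gt0//.
have qi : 0 < q^-1 - 1 by rewrite subr_gt0 invf_gt1.
(* Bernoulli's inequality for the powers of 1 / q. *)
have nq : q ^+ n * n%:R <= (q^-1 - 1)^-1.
  rewrite -[leRHS]div1r ler_pdivlMr// -mulrA -ler_pdivlMl ?exprn_gt0// mulr1.
  elim: n {kn} => [|n IH]; first by rewrite mul0r invr_ge0.
  rewrite -natr1 mulrDl mul1r exprS invfM.
  have h1 : 1 <= (q ^+ n)^-1 by rewrite invf_ge1 ?exprn_gt0// exprn_ile1// ltW.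
  have : (q^-1 - 1) * 1 <= (q^-1 - 1) * (q ^+ n)^-1 by rewrite ler_pM2l.
  by lra.
rewrite mulrDr lerD//.
  by rewrite -[leRHS]mul1r ler_wpM2r// exprn_ile1// ltW.
by rewrite mulrCA ler_wpM2l.
Qed.

End dyadic_process.

(** * Construction of the continuous version *)

Section continuous_version.
Context (R : realType) (K : R -> R -> R) (M q : R).
Hypothesis KC : forall s t, K s t = K t s.
Hypothesis Kpsd : forall s : seq (R * R), all (fun p => 0 <= p.2) s -> 0 <= qform K s.
Hypotheses (M0 : 0 <= M) (q01 : 0 < q < 1).
Hypothesis Kmod : forall n s t s' t', 0 <= s -> 0 <= t -> 0 <= s' -> 0 <= t' ->
  `|s - s'| + `|t - t'| <= 2 / (2 ^ n)%:R -> `|K s t - K s' t'| <= M * q ^+ n.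

(** Absolute values extend the kernel to all rationals without losing semidefiniteness, so the
    countable type [rat] itself is the index set. *)
Let rat_kernel (i j : rat) := K `|ratr i| `|ratr j|.

Let rat_kernel_psd : psd rat_kernel.
Proof.
split=> [i j|s]; first exact: KC.
have := @Kpsd [seq (p.1, `|ratr p.2|) | p <- s].
rewrite all_map /qform big_map; under eq_bigr do rewrite big_map.
by apply; apply/allP => p _ /=.
Qed.

(** Passing through rationals identifies (n + 1, 2 k) with (n, k), so that the grids are consistent
    at every sample point. *)
Let dyadic_rat (i : nat * nat) : rat := i.2%:R / (2 ^ i.1)%:R.

Let norm_dyadic_rat i : `|ratr (dyadic_rat i)| = dyadic R i.
Proof. by rewrite /dyadic_rat fmorph_div/= !ratr_nat ger0_norm// divr_ge0. Qed.

Let dyadic_rat_double n k : dyadic_rat (n.+1, k.*2) = dyadic_rat (n, k).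
Proof.
rewrite /dyadic_rat/= expnS -muln2 !natrM; field.
by rewrite pnatr_eq0 expn_eq0.
Qed.

(** A fourth root, since the variance bound q^n has to be read as p^(4 n) in the chaining. *)
Let p := Num.sqrt (Num.sqrt q).

Let p01 : 0 < p < 1.
Proof.
case/andP: q01 => q0 q1.
by rewrite !sqrtr_gt0 q0 -sqrtr1 ltr_sqrt// -sqrtr1 ltr_sqrt.
Qed.

Let p4 n : p ^+ (4 * n) = q ^+ n.
Proof.
by rewrite exprM (exprM _ 2 2) !sqr_sqrtr ?sqrtr_ge0// ltW//; case/andP: q01.
Qed.

(** 2 M bounds the two kernel differences in the variance of an increment; the 1 keeps c positive
    when M = 0. *)
Let c := Num.sqrt (2 * M + 1).

Let c2 : c ^+ 2 = 2 * M + 1.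
Proof. by rewrite sqr_sqrtr// addr_ge0// mulr_ge0. Qed.

Let c0 : 0 < c.
Proof. by rewrite sqrtr_gt0 ltr_wpDl// mulr_ge0. Qed.

Let dyadic_ge0 i : 0 <= dyadic R i.
Proof. by rewrite divr_ge0. Qed.

Let Kinc n k : let s := dyadic R (n, k) in let t := dyadic R (n, k.+1) in
  K t t - K s t - K t s + K s s <= c ^+ 2 * p ^+ (4 * n).
Proof.
rewrite /=; set s := dyadic R (n, k); set t := dyadic R (n, k.+1).
have s0 : 0 <= s := dyadic_ge0 _; have t0 : 0 <= t := dyadic_ge0 _.
have ts : t - s = (2 ^ n)%:R^-1.
  by rewrite /t /s /dyadic/= -mulrBl -natr1 addrAC subrr add0r mul1r.
have i0 : 0 <= (2 ^ n)%:R^-1 :> R by rewrite invr_ge0.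
have i2 : (2 ^ n)%:R^-1 <= 2 / (2 ^ n)%:R :> R by rewrite ler_peMl// ler1n.
have h1 : K t t - K s t <= M * q ^+ n.
  apply: (le_trans (ler_norm _)); apply: Kmod => //.
  by rewrite subrr normr0 addr0 ts ger0_norm.
have h2 : K s s - K t s <= M * q ^+ n.
  apply: (le_trans (ler_norm _)); apply: Kmod => //.
  by rewrite subrr normr0 addr0 distrC ts ger0_norm.
rewrite c2 p4; have : 0 <= q ^+ n by rewrite exprn_ge0// ltW//; case/andP: q01.
lra.
Qed.

Let grid n (t : R) : R := dyadic R (n, Num.truncn ((2 ^ n)%:R * t)).

Let grid_close n t : 0 <= t -> `|grid n t - t| <= (2 ^ n)%:R^-1.
Proof.
move=> t0; have n0 : 0 < (2 ^ n)%:R :> R by rewrite ltr0n expn_gt0.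
have a0 : 0 <= (2 ^ n)%:R * t by rewrite mulr_ge0.
have /andP[h1 h2] := truncn_itv a0.
rewrite -(ler_pM2l n0) divff ?gt_eqF// -[X in X * `|_|]gtr0_norm// -normrM mulrBr.
rewrite /grid /dyadic/= mulrCA divff ?gt_eqF// mulr1.
rewrite -natr1 in h2; rewrite ler_norml; apply/andP; split; lra.
Qed.

Theorem continuous_gaussian_family : exists (d : measure_display) (T : measurableType d)
    (P : probability T R) (X : R -> T -> R),
  gaussian_family P (fun t => 0 <= t) K X /\
  forall w N (e : R), 0 < e -> exists2 del : R, 0 < del &
    forall s t, 0 <= s -> s <= N%:R -> 0 <= t -> t <= N%:R -> `|s - t| < del ->
    `|X s w - X t w| < e.
Proof.
have [d [T [P [Z gZ]]]] := gaussian_family_exists (0 : rat) rat_kernel_psd.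
pose Y i := Z (dyadic_rat i).
have gY : gaussian_family P predT (fun i j => K (dyadic R i) (dyadic R j)) Y.
  rewrite (_ : (fun i j => _) = fun i j => rat_kernel (dyadic_rat i) (dyadic_rat j)).
    exact: gaussian_family_map gZ.
  by apply/funext => i; apply/funext => j; rewrite /rat_kernel !norm_dyadic_rat.
have YE n k w : Y (n.+1, k.*2) w = Y (n, k) w by rewrite /Y dyadic_rat_double.
pose reg := regular_paths Y c p.
have mreg : measurable reg by exact: measurable_regular_paths gY Kinc.
have Preg : P reg = 1%E by exact: (regular_paths_full gY c0 p01 Kinc).
pose y w n k := Y (n, k) w.
(* Off the regular set the limit may be meaningless; the indicator makes such paths identically
   0. *)
pose X t w := limn (dyadic_step (y w) ^~ t) * \1_reg w.
exists d, T, P, X; split; last first.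
  move=> w N e e0; rewrite /X indicE.
  have [/set_mem/regular_paths_bound h|_] := boolP (w \in reg); last first.
    by exists 1 => // s t *; rewrite !mulr0 subrr normr0.
  have [C C0 hC] := h c0 p01.
  have [del del0 hd] := dyadic_limit_unif C0 p01 (fun n k => YE n k w) hC N e0.
  by exists del => // s t *; rewrite !mulr1; exact: hd.
move=> s /allP s0.
(* The approximations carry the same indicator, so that they converge at every sample point, as
   [glaw_lim] requires. *)
pose Xn n w := (\sum_(u <- s) u.1 * Y (n, Num.truncn ((2 ^ n)%:R * u.2)) w) * \1_reg w.
apply: (@glaw_lim _ _ _ _ Xn _ (fun n =>
  \sum_(u <- s) \sum_(v <- s) u.1 * v.1 * K (grid n u.2) (grid n v.2))).
- move=> n; apply: glaw_mask => //.
  pose f (t : R) := (n, Num.truncn ((2 ^ n)%:R * t)).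
  exact: (@gaussian_family_map _ _ _ _ _ _ f predT _ _ _ _ gY s (all_predT s)).
- move=> w; rewrite /Xn /X.
  have [wr|wr] := boolP (w \in reg); rewrite indicE ?(negbTE wr) ?wr; last first.
    under eq_fun do rewrite mulr0.
    by rewrite big1; [exact: cvg_cst|move=> *; rewrite !mulr0].
  have [C C0 hC] := regular_paths_bound c0 p01 (set_mem wr).
  under eq_fun do rewrite mulr1.
  apply: cvg_sum_seq => u us; rewrite mulr1; apply: cvgMr.
  have u0 : 0 <= u.2 := s0 u us.
  have uN : u.2 <= (Num.truncn u.2).+1%:R by have /andP[_ /ltW] := truncn_itv u0.
  have := dyadic_step_cvg C0 p01 (fun n k => YE n k w) hC u0 uN (@ltn_expl 2 _ isT).
  by case.
- apply: cvg_sum_seq => u us; apply: cvg_sum_seq => v vs; apply: cvgMr; apply/cvgrPdist_lt => e e0.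
  have qn : M * q ^+ n @[n --> \oo] --> (0 : R).
    case/andP: q01 => q0 q1.
    by rewrite -(mulr0 M); apply: cvgMr; apply: cvg_expr; rewrite ger0_norm ?ltW.
  move/cvgrPdist_lt : qn => /(_ _ e0); apply: filterS => n; rewrite sub0r normrN => hn.
  apply: le_lt_trans (le_lt_trans (ler_norm _) hn).
  apply: Kmod; rewrite ?dyadic_ge0//; [exact: s0|exact: s0|].
  (* The 2 in the modulus hypothesis serves here: each of the two times is off by at most 2^-n. *)
  rewrite mulr_natl mulr2n; apply: lerD; rewrite distrC; apply: grid_close; exact: s0.
Qed.

End continuous_version.

(** * Integrals of Gaussian paths *)

Lemma dist_within_continuous (R : realType) (D : set R) (f : R -> R) :
  (forall x e, D x -> 0 < e -> exists2 del : R, 0 < del &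
    forall y, D y -> `|x - y| < del -> `|f x - f y| < e) ->
  {within D, continuous f}.
Proof.
move=> hf; apply/subspace_continuousP => x Dx; apply/cvgrPdist_lt => e e0.
have [del del0 h] := hf x e Dx e0.
apply/nbhs_ballP; exists del => //= y xy Dy; exact: h.
Qed.

(** * Riemann sums of uniformly continuous functions *)

Section riemann_sum.
Context (R : realType) (f : R -> R) (t : R).
Hypothesis t0 : 0 <= t.
Hypothesis fu : forall e : R, 0 < e -> exists2 del : R, 0 < del &
  forall x y, 0 <= x -> x <= t -> 0 <= y -> y <= t -> `|x - y| < del -> `|f x - f y| < e.

Let mu := @lebesgue_measure R.

Let int_f : mu.-integrable `[0, t] (EFin \o f).
Proof.
apply: continuous_compact_integrable; first exact: segment_compact.
apply: dist_within_continuous => x e; rewrite /= in_itv/= => /andP[x0 xt] e0.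
have [del del0 h] := fu e0; exists del => // y; rewrite /= in_itv/= => /andP[y0 yt].
exact: h.
Qed.

Let int_sub (D : set R) : measurable D -> D `<=` `[0, t] -> mu.-integrable D (EFin \o f).
Proof. by move=> mD Dt; apply: integrableS int_f. Qed.

Let int_cst (D : set R) r : measurable D -> D `<=` `[0, t] -> mu.-integrable D (EFin \o cst r).
Proof.
move=> mD Dt.
have int_r : mu.-integrable `[0, t] (EFin \o cst r).
  apply: continuous_compact_integrable; first exact: segment_compact.
  by apply: continuous_subspaceT => x; exact: cvg_cst.
exact: integrableS int_r.
Qed.

Let cell_bound e x y : 0 <= x -> x <= y -> y <= t ->
  (forall z, x < z -> z <= y -> `|f z - f x| <= e) ->
  `|Rintegral mu `[0, y] f - Rintegral mu `[0, x] f - (y - x) * f x| <= e * (y - x).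
Proof.
move=> x0 xy yt he.
have sub : `]x, y]%classic `<=` `[0, t].
  move=> z; rewrite /= !in_itv/= => /andP[xz zy]; apply/andP; split.
    exact: le_trans (ltW xz).
  exact: le_trans yt.
have sub0 : `[0, y]%classic `<=` `[0, t].
  by move=> z; rewrite /= !in_itv/= => /andP[-> zy]/=; exact: le_trans yt.
rewrite Rintegral_itvB ?bnd_simp//; last exact: int_sub.
have mxy : fine (mu `]x, y]) = y - x.
  rewrite /mu lebesgue_measure_itv/= lte_fin; case: ltP => [_|yx] //=.
  by have -> : y = x by [apply/le_anti; rewrite yx xy]; rewrite subrr.
have <- : Rintegral mu `]x, y] (cst (f x)) = (y - x) * f x.
  by rewrite Rintegral_cst// mxy mulrC.
rewrite -RintegralB//; [|exact: int_sub|exact: int_cst].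
have <- : Rintegral mu `]x, y] (cst e) = e * (y - x) by rewrite Rintegral_cst// mxy.
have ifx : mu.-integrable `]x, y] (EFin \o (fun z => f z - cst (f x) z)).
  rewrite (_ : EFin \o _ = ((EFin \o f) \- (EFin \o cst (f x)))%E)//.
  by apply: integrableB => //; [exact: int_sub|exact: int_cst].
apply: (le_trans (le_normr_Rintegral _ _)) => //.
apply: le_Rintegral => //; [|exact: int_cst|].
  by have := integrable_norm ifx.
move=> z; rewrite /= in_itv/= => /andP[xz zy]; exact: he.
Qed.

Lemma riemann_sum_cvg :
  t / n.+1%:R * \sum_(0 <= k < n.+1) f (k%:R * (t / n.+1%:R)) @[n --> \oo] -->
  Rintegral mu `[0, t] f.
Proof.
apply/cvgrPdist_le => e e0.
(* The 1 makes the quotient meaningful at t = 0. *)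
pose e' := e / (t + 1).
have t1 : 0 < t + 1 by rewrite ltr_wpDl.
have e'0 : 0 < e' by rewrite divr_gt0.
have [del del0 hdel] := fu e'0.
have tn : t * harmonic n @[n --> \oo] --> (0 : R).
  by rewrite -[X in _ --> X](mulr0 t); apply: cvgMr; exact: cvg_harmonic.
move/cvgrPdist_lt : tn => /(_ _ del0); apply: filterS => n.
rewrite sub0r normrN /harmonic/= => hn.
set h := t / n.+1%:R in hn *.
have n0 : 0 < n.+1%:R :> R by [].
have h0 : 0 <= h by rewrite divr_ge0.
have ht : n.+1%:R * h = t by rewrite /h mulrCA divff ?gt_eqF// mulr1.
rewrite ger0_norm// in hn.
have key m : (m <= n.+1)%N ->
    `|Rintegral mu `[0, m%:R * h] f - h * \sum_(0 <= k < m) f (k%:R * h)| <= e' * (m%:R * h).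
  elim: m => [_|m IH mn].
    by rewrite big_geq// mul0r set_itv1 Rintegral_set1 !mulr0 subrr normr0.
  have mt : m.+1%:R * h <= t by rewrite -ht ler_wpM2r// ler_nat.
  have mm : m.+1%:R * h - m%:R * h = h by rewrite -natr1; ring.
  have m0 : 0 <= m%:R * h by rewrite mulr_ge0.
  have mm' : m%:R * h <= m.+1%:R * h by rewrite ler_wpM2r// ler_nat.
  have hz z : m%:R * h < z -> z <= m.+1%:R * h -> `|f z - f (m%:R * h)| <= e'.
    move=> mz zm; apply/ltW; apply: hdel => //.
    - by rewrite (le_trans m0)// ltW.
    - exact: le_trans mt.
    - exact: le_trans mt.
    - by rewrite gtr0_norm ?subr_gt0//; apply: le_lt_trans hn; lra.
  have := cell_bound m0 mm' mt hz; rewrite mm => c; have := IH (ltnW mn); move: c.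
  set A := Rintegral _ _ _; set B := Rintegral _ _ _ => c i.
  rewrite big_nat_recr//=; set S := \sum_(0 <= k < m) _ in i *.
  rewrite (_ : A - _ = (A - B - h * f (m%:R * h)) + (B - h * S)); last by ring.
  apply: (le_trans (ler_normD _ _)); apply: (le_trans (lerD c i)).
  by rewrite -natr1; lra.
have := key n.+1 (leqnn _); rewrite ht => /le_trans; apply.
rewrite /e' -mulrA ler_piMr//; first exact: ltW.
by rewrite mulrC ler_pdivrMr// mul1r lerDl.
Qed.

End riemann_sum.

Section integral_process.
Context (R : realType) d (T : measurableType d) (P : probability T R).
Variables (K I : R -> R -> R) (X : R -> T -> R).
Hypothesis gX : gaussian_family P (fun t => 0 <= t) K X.
Hypothesis Xu : forall w N (e : R), 0 < e -> exists2 del : R, 0 < del &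
  forall s t, 0 <= s -> s <= N%:R -> 0 <= t -> t <= N%:R -> `|s - t| < del ->
  `|X s w - X t w| < e.
Hypothesis KI : forall s t, 0 <= s -> 0 <= t ->
  (s / n.+1%:R) * (t / n.+1%:R) *
  \sum_(0 <= k < n.+1) \sum_(0 <= l < n.+1) K (k%:R * (s / n.+1%:R)) (l%:R * (t / n.+1%:R))
  @[n --> \oo] --> I s t.

(** A combination of Riemann sums is a combination of values of X on a union of grids. Each time has
    its own mesh t / (n + 1), so two different meshes meet in the double sums of [KI]. *)
Theorem gaussian_family_integral : gaussian_family P (fun t => 0 <= t) I
  (fun t w => Rintegral lebesgue_measure `[0, t] (fun u => X u w)).
Proof.
move=> s /allP s0.
pose h n (t : R) := t / n.+1%:R.
pose grid n := [seq (u.1 * h n u.2, k%:R * h n u.2) | u <- s, k <- index_iota 0 n.+1].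
apply: (@glaw_lim _ _ _ _ (fun n w => \sum_(p <- grid n) p.1 * X p.2 w) _
  (fun n => \sum_(p <- grid n) \sum_(q <- grid n) p.1 * q.1 * K p.2 q.2)).
- move=> n; apply: gX; apply/allP => p /allpairsP[[u k] [/= us _ ->]]/=.
  by rewrite mulr_ge0// divr_ge0// s0.
- move=> w.
  rewrite (_ : (fun n => _) = fun n => \sum_(u <- s) u.1 *
      (h n u.2 * \sum_(0 <= k < n.+1) X (k%:R * h n u.2) w)); last first.
    apply/funext => n; rewrite big_allpairs_dep; apply: eq_bigr => u _.
    by rewrite mulrA mulr_sumr.
  apply: cvg_sum_seq => u us; apply: cvgMr.
  apply: (@riemann_sum_cvg _ (fun t => X t w)); first exact: s0.
  move=> e e0; have [del del0 hd] := Xu w (Num.truncn u.2).+1 e0.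
  have uN : u.2 <= (Num.truncn u.2).+1%:R by have /andP[_ /ltW] := truncn_itv (s0 _ us).
  by exists del => // x y x0 xu y0 yu; apply: hd => //; apply: le_trans uN.
- rewrite (_ : (fun n => _) = fun n => \sum_(u <- s) \sum_(v <- s) u.1 * v.1 *
      (h n u.2 * h n v.2 * \sum_(0 <= k < n.+1) \sum_(0 <= l < n.+1)
        K (k%:R * h n u.2) (l%:R * h n v.2))); last first.
    apply/funext => n; rewrite big_allpairs_dep; apply: eq_bigr => u _.
    under eq_bigr do rewrite big_allpairs_dep.
    rewrite exchange_big; apply: eq_bigr => v _ /=.
    rewrite !mulr_sumr; apply: eq_bigr => k _; rewrite !mulr_sumr; apply: eq_bigr => l _.
    ring.
  apply: cvg_sum_seq => u us; apply: cvg_sum_seq => v vs; apply: cvgMr.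
  by apply: KI; exact: s0.
Qed.

End integral_process.

(** * The covariance kernels *)

Section sumZ_theory.
Context (R : realType).
Implicit Types f g : int -> R.

Definition summableZ f :=
  cvgn (series (fun n : nat => f (Posz n))) /\ cvgn (series (fun n : nat => f (Negz n))).

Lemma summableZD f g : summableZ f -> summableZ g -> summableZ (fun j => f j + g j).
Proof. by move=> [f1 f2] [g1 g2]; split; exact: is_cvg_seriesD. Qed.

Lemma summableZ_scale c f : summableZ f -> summableZ (fun j => c * f j).
Proof. by move=> [f1 f2]; split; exact: is_cvg_seriesZ. Qed.

Lemma sumZD f g : summableZ f -> summableZ g ->
  sumZ (fun j => f j + g j) = sumZ f + sumZ g.
Proof.
move=> [f1 f2] [g1 g2]; rewrite /sumZ.
rewrite (lim_seriesD f1 g1) (lim_seriesD f2 g2); ring.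
Qed.

Lemma sumZ_scale c f : summableZ f -> sumZ (fun j => c * f j) = c * sumZ f.
Proof.
by move=> [f1 f2]; rewrite /sumZ mulrDr; congr (_ + _); exact: lim_seriesZ.
Qed.

Lemma sumZ_le f g : summableZ f -> summableZ g -> (forall j, f j <= g j) ->
  sumZ f <= sumZ g.
Proof. by move=> [f1 f2] [g1 g2] fg; rewrite lerD// lim_series_le. Qed.

Lemma sumZ_ge0 f : summableZ f -> (forall j, 0 <= f j) -> 0 <= sumZ f.
Proof.
move=> sf f0; have s0 := summableZ_scale 0 sf.
by have := sumZ_le s0 sf; rewrite sumZ_scale// mul0r; apply => j; rewrite mul0r.
Qed.

Lemma summableZ_sum (I : Type) (r : seq I) (F : I -> int -> R) :
  (forall i, summableZ (F i)) -> summableZ (fun j => \sum_(i <- r) F i j).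
Proof.
move=> sF; elim: r => [|i r IH].
  under eq_fun do rewrite big_nil.
  have E : (fun n => \sum_(0 <= k < n) (0 : R)) = (fun=> 0).
    by apply/funext => n; rewrite big1.
  by split; rewrite /series/= E; exact: is_cvg_cst.
under eq_fun do rewrite big_cons.
exact: summableZD.
Qed.

Lemma sumZ_sum (I : Type) (r : seq I) (F : I -> int -> R) :
  (forall i, summableZ (F i)) ->
  sumZ (fun j => \sum_(i <- r) F i j) = \sum_(i <- r) sumZ (F i).
Proof.
move=> sF; elim: r => [|i r IH].
  rewrite big_nil; under eq_fun do rewrite big_nil.
  rewrite /sumZ /series/=.
  have -> : (fun n => \sum_(0 <= k < n) (0 : R)) = (fun=> 0).
    by apply/funext => n; rewrite big1.
  by rewrite !lim_cst// addr0.
rewrite big_cons -IH -sumZD//; last exact: summableZ_sum.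
by congr sumZ; apply/funext => j; rewrite big_cons.
Qed.

Lemma summableZ_geometric (A B p q : R) f : 0 <= p < 1 -> 0 <= q < 1 ->
  (forall n : nat, `|f (Posz n)| <= A * p ^+ n) ->
  (forall n : nat, `|f (Negz n)| <= B * q ^+ n) -> summableZ f.
Proof.
move=> /andP[p0 p1] /andP[q0 q1] fA fB; split; apply: normed_cvg.
  apply: (@series_le_cvg _ _ (geometric A p)) => [n|n|n|] //=.
  - exact: le_trans (fA _).
  - by apply: is_cvg_geometric_series; rewrite ger0_norm.
apply: (@series_le_cvg _ _ (geometric B q)) => [n|n|n|] //=.
- exact: le_trans (fB _).
- by apply: is_cvg_geometric_series; rewrite ger0_norm.
Qed.

Lemma summableZB f g : summableZ f -> summableZ g -> summableZ (fun j => f j - g j).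
Proof.
move=> sf sg; have := summableZD sf (summableZ_scale (-1) sg).
by under eq_fun do rewrite mulN1r.
Qed.

Lemma sumZB f g : summableZ f -> summableZ g ->
  sumZ (fun j => f j - g j) = sumZ f - sumZ g.
Proof.
move=> sf sg; rewrite -[in RHS]mulN1r -sumZ_scale// -sumZD//; last exact: summableZ_scale.
by congr sumZ; apply/funext => j; rewrite mulN1r.
Qed.

Lemma sumZ_norm_le f g : summableZ f -> summableZ g -> (forall j, `|f j| <= g j) ->
  `|sumZ f| <= sumZ g.
Proof.
move=> sf sg fg; rewrite ler_norml; apply/andP; split.
  rewrite -mulN1r -sumZ_scale//; apply: sumZ_le => //; first exact: summableZ_scale.
  by move=> j; rewrite mulN1r; have := fg j; rewrite ler_norml => /andP[].
by apply: sumZ_le => // j; apply: le_trans (fg j); exact: ler_norm.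
Qed.

Lemma powR_lt1 (x k : R) : 0 <= x -> x < 1 -> 0 < k -> x `^ k < 1.
Proof.
move=> x0 x1 k0; have := @gt0_ltr_powR _ _ k0 x 1.
by rewrite !nnegrE powR1; apply.
Qed.

Lemma powR_exprn (x k : R) n : 0 <= x -> (x ^+ n) `^ k = (x `^ k) ^+ n.
Proof.
move=> x0; elim: n => [|n IH]; first by rewrite !expr0 powR1.
by rewrite !exprS powRM ?exprn_ge0// IH.
Qed.

(** As a < 1, the frequencies b a^j tend to 0 for j -> +oo and to infinity for j -> -oo: a positive
    power is geometric on the first half, a negative one on the second. *)
Lemma summableZ_powR (a b kap kap' A B : R) f : 0 < a -> a < 1 -> 0 < b ->
  0 < kap -> 0 < kap' ->
  (forall n : nat, `|f (Posz n)| <= A * (b * a ^ Posz n) `^ kap) ->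
  (forall n : nat, `|f (Negz n)| <= B * (b * a ^ Negz n) `^ (- kap')) -> summableZ f.
Proof.
move=> a0 a1 b0 k0 k'0 fA fB.
have p01 k : 0 < k -> 0 <= a `^ k < 1.
  by move=> kk; rewrite powR_ge0/= powR_lt1// ltW.
(* The extra factor in the second constant accounts for the shift in Negz n = -(n + 1). *)
apply: (@summableZ_geometric (A * b `^ kap) (B * b `^ (- kap') * a `^ kap') (a `^ kap) (a `^ kap')).
- exact: p01.
- exact: p01.
- move=> n; apply: (le_trans (fA n)).
  rewrite powRM ?(ltW b0)// ?exprz_ge0 ?(ltW a0)// mulrA.
  by rewrite -powR_exprn// ltW.
- move=> n; apply: (le_trans (fB n)).
  rewrite powRM ?(ltW b0)// ?exprz_ge0 ?(ltW a0)// mulrA.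
  rewrite -[leRHS]mulrA -exprS NegzE -exprnN -powR_invn ?(ltW a0)//.
  rewrite -powRrM mulrNN mulrC -(mulrC kap') powRrM powR_mulrn ?powR_ge0// mulrC.
  by [].
Qed.

End sumZ_theory.

(** * Taylor remainders of the exponential and second differences *)

Section exp_taylor.
Context (R : realType).

Lemma derive_ge0_ge0 (f f' : R -> R) : (forall x : R, is_derive x (1 : R) f (f' x)) ->
  (forall x, 0 <= x -> 0 <= f' x) -> f 0 = 0 -> forall x, 0 <= x -> 0 <= f x.
Proof.
move=> df f'0 f0 x x0.
have cf : {within `[0, x], continuous f}.
  by apply: continuous_subspaceT => y; apply: differentiable_continuous; apply/derivable1_diffP; apply: ex_derive.
have [c c0x] := MVT_segment x0 (fun y _ => df y) cf.
rewrite f0 !subr0 => ->; rewrite mulr_ge0// f'0//.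
by move: c0x; rewrite in_itv/= => /andP[].
Qed.

Definition exp_rem1 (y : R) := expR (- y) - 1 + y.
(** Opposite of the second-order Taylor remainder of e^(-y), hence nonnegative for y >= 0. *)
Definition exp_rem2 (y : R) := 2^-1 * y ^+ 2 - exp_rem1 y.

Lemma is_derive_exp_rem1 (y : R) : is_derive y (1 : R) exp_rem1 (1 - expR (- y)).
Proof.
rewrite /exp_rem1; apply: is_derive_eq; rewrite /GRing.scale/=; ring.
Qed.

Lemma is_derive_exp_rem2 (y : R) : is_derive y (1 : R) exp_rem2 (exp_rem1 y).
Proof.
rewrite /exp_rem2 (_ : (fun y => _) = (2^-1 *: ((id : R -> R) ^+ 2)) - exp_rem1)//.
have := is_derive_exp_rem1 y => ?.
by apply: is_derive_eq; rewrite /GRing.scale/= /exp_rem1; field.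
Qed.

Lemma exp_rem1_ge0 y : 0 <= exp_rem1 y.
Proof. by have := expR_ge1Dx (- y); rewrite /exp_rem1; lra. Qed.

Lemma exp_rem2_ge0 y : 0 <= y -> 0 <= exp_rem2 y.
Proof.
apply: (derive_ge0_ge0 (f := exp_rem2) (f' := exp_rem1)); first exact: is_derive_exp_rem2.
  by move=> x _; exact: exp_rem1_ge0.
by rewrite /exp_rem2 /exp_rem1 oppr0 expR0; ring.
Qed.

Lemma exp_rem2_le2 y : exp_rem2 y <= 2^-1 * y ^+ 2.
Proof. by have := exp_rem1_ge0 y; rewrite /exp_rem2; lra. Qed.

(** Integrates exp_rem1 <= y^2 / 2. Weighted by c^(-2H), the cubic bound is summable at low
    frequencies since 3 - 2H > 0, and the quadratic one at high frequencies since 2 - 2H < 0. *)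
Lemma exp_rem2_le3 y : 0 <= y -> exp_rem2 y <= y ^+ 3.
Proof.
move=> y0; rewrite -subr_ge0.
apply: (derive_ge0_ge0 (f := fun y => y ^+ 3 - exp_rem2 y) (f' := fun y => 3 * y ^+ 2 - exp_rem1 y)) => //.
- move=> x; rewrite (_ : (fun y => _) = ((id : R -> R) ^+ 3) - exp_rem2)//.
  have := is_derive_exp_rem2 x => ?.
  by apply: is_derive_eq; rewrite /GRing.scale/=; ring.
- move=> x x0; have := exp_rem2_ge0 x0; have := sqr_ge0 x; rewrite /exp_rem2; lra.
- by rewrite /exp_rem2 /exp_rem1 oppr0 expR0; ring.
Qed.

(** Glues the two halves of the even and odd extensions at the origin. *)
Lemma is_derive0_sqr_bound (f : R -> R) : (forall y, `|f y| <= y ^+ 2) ->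
  is_derive (0 : R) (1 : R) f 0.
Proof.
move=> hf; have f0 : f 0 = 0.
  by apply/normr0_eq0/le_anti; rewrite normr_ge0 andbT; have := hf 0; rewrite expr0n.
have L : h^-1 *: ((f \o shift 0) (h *: 1) - f 0) @[h --> (0 : R)^'] --> (0 : R).
  apply/cvgrPdist_le => e e0; apply/nbhs_ballP; exists e => //= y.
  rewrite /ball/= sub0r normrN => ye y0; rewrite sub0r normrN f0 subr0 addr0 /GRing.scale/= mulr1.
  rewrite normrM normfV mulrC ler_pdivrMr ?normr_gt0//.
  apply: (le_trans (hf y)); rewrite -real_normK ?num_real// expr2 ler_pM2r ?normr_gt0//.
  exact: ltW.
apply: DeriveDef; first by apply/cvg_ex; exists 0.
exact: cvg_lim L.
Qed.

Lemma near_pos (y : R) : 0 < y -> \near y, 0 < y.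
Proof. by move=> y0; exact: lt_nbhsr. Qed.

Lemma near_neg (y : R) : y < 0 -> \near y, y < 0.
Proof. by move=> y0; exact: lt_nbhsl. Qed.

(** The extension to negative arguments is needed because s - t may change sign inside a cell; it
    stays twice differentiable at 0 since [exp_rem2] vanishes there to third order. *)
Definition even_rem2 (y : R) := exp_rem2 `|y|.
Definition odd_rem1 (y : R) := Num.sg y * exp_rem1 `|y|.

Lemma is_derive_even_rem2 (y : R) : is_derive y (1 : R) even_rem2 (odd_rem1 y).
Proof.
rewrite /odd_rem1; have [y0|y0|->] := ltgtP y 0.
- rewrite (ltr0_sg y0) (ltr0_norm y0).
  apply: (@near_eq_is_derive _ _ _ (exp_rem2 \o -%R)).
    near=> z; have z0 : z < 0 by near: z; exact: near_neg.
    by rewrite /even_rem2 (ltr0_norm z0).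
  have := is_derive_exp_rem2 (- y) => ?.
  by apply: is_derive_eq; rewrite /GRing.scale/=; ring.
- rewrite (gtr0_sg y0) (gtr0_norm y0) mul1r.
  apply: (@near_eq_is_derive _ _ _ exp_rem2).
    near=> z; have z0 : 0 < z by near: z; exact: near_pos.
    by rewrite /even_rem2 (gtr0_norm z0).
  exact: is_derive_exp_rem2.
- rewrite sgr0 mul0r; apply: is_derive0_sqr_bound => z.
  rewrite /even_rem2 ger0_norm ?exp_rem2_ge0//.
  by have := exp_rem2_le2 `|z|; rewrite real_normK ?num_real//; have := sqr_ge0 z; lra.
Unshelve. all: by end_near. Qed.

Lemma is_derive_odd_rem1 (y : R) : is_derive y (1 : R) odd_rem1 (1 - expR (- `|y|)).
Proof.
have [y0|y0|->] := ltgtP y 0.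
- rewrite (ltr0_norm y0).
  apply: (@near_eq_is_derive _ _ _ (- (exp_rem1 \o -%R))).
    near=> z; have z0 : z < 0 by near: z; exact: near_neg.
    by rewrite /odd_rem1 (ltr0_norm z0) (ltr0_sg z0) mulN1r.
  have := is_derive_exp_rem1 (- y) => ?.
  by apply: is_derive_eq; rewrite /GRing.scale/=; ring.
- rewrite (gtr0_norm y0).
  apply: (@near_eq_is_derive _ _ _ exp_rem1).
    near=> z; have z0 : 0 < z by near: z; exact: near_pos.
    by rewrite /odd_rem1 (gtr0_norm z0) (gtr0_sg z0) mul1r.
  exact: is_derive_exp_rem1.
- rewrite normr0 oppr0 expR0 subrr; apply: is_derive0_sqr_bound => z.
  rewrite /odd_rem1 normrM normr_sg ger0_norm; last exact: exp_rem1_ge0.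
  have [->|z0] := eqVneq z 0; first by rewrite mul0r sqr_ge0.
  rewrite mul1r; have := exp_rem2_ge0 (normr_ge0 z).
  by rewrite /exp_rem2 real_normK ?num_real//; have := sqr_ge0 z; lra.
Unshelve. all: by end_near. Qed.

(** Mean value theorem twice: for y -> E (y + k) - E y on [x, x + h], then for E1 on an interval of
    length k. *)
Lemma second_difference (E E1 E2 : R -> R) (x h k : R) :
  (forall y : R, is_derive y (1 : R) E (E1 y)) -> (forall y : R, is_derive y (1 : R) E1 (E2 y)) ->
  0 <= h -> 0 <= k ->
  exists2 xi, x <= xi <= x + h + k &
  E (x + h + k) - E (x + k) - E (x + h) + E x = h * k * E2 xi.
Proof.
move=> dE dE1 h0 k0.
pose phi y := E (y + k) - E y.
have dphi (y : R) : is_derive y (1 : R) phi (E1 (y + k) - E1 y).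
  rewrite /phi (_ : (fun y => _) = (E \o (fun y => y + k)) - E)//.
  have := dE (y + k) => ?; have := dE y => ?.
  by apply: is_derive_eq; rewrite /GRing.scale/= addr0 mulr1.
have cont (f f' : R -> R) (A : set R) : (forall y : R, is_derive y (1 : R) f (f' y)) -> {within A, continuous f}.
  move=> df.
  by apply: continuous_subspaceT => y; apply: differentiable_continuous; apply/derivable1_diffP; apply: ex_derive.
have xxh : x <= x + h by rewrite lerDl.
have [e e1 e2] := MVT_segment xxh (fun y _ => dphi y) (cont _ _ _ dphi).
have eek : e <= e + k by rewrite lerDl.
have [xi x1 x2] := MVT_segment eek (fun y _ => dE1 y) (cont _ _ _ dE1).
exists xi.
  by move: e1 x1; rewrite !in_itv/= => /andP[? ?] /andP[? ?]; apply/andP; split; lra.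
have := e2; rewrite /phi x2 => h2.
transitivity (E (x + h + k) - E (x + h) - (E (x + k) - E x)); first ring.
by rewrite h2; ring.
Qed.

End exp_taylor.

Lemma is_derive_scaled_comp (R : realType) (f f' : R -> R) (w c z : R) :
  (forall y : R, is_derive y (1 : R) f (f' y)) ->
  is_derive z (1 : R) (fun z => w * f (c * z)) (w * (c * f' (c * z))).
Proof.
move=> df; have := df (c * z) => ?.
rewrite (_ : (fun z => _) = w *: (f \o (c *: (id : R -> R))))//.
by apply: is_derive_eq; rewrite /GRing.scale/=; ring.
Qed.

(** * Semidefiniteness of the Brownian covariance *)

Section min_kernel.
Context (R : realType).

(** Decomposition along successive increments: the gap from l to the smallest point u is common to
    all points and contributes (u - l) times the square of the sum of all coefficients; what is left
    is the form based at u, in which the first point drops out. *)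
Lemma min_kernel_sorted (s : seq (R * R)) (l : R) :
  sorted (fun p q : R * R => p.2 <= q.2) s -> all (fun p => l <= p.2) s ->
  0 <= qform (fun u v => Num.min u v - l) s.
Proof.
elim: s l => [|[x u] s IH] l; first by rewrite /qform big_nil.
move=> ss /= /andP[lu _].
have tr : transitive (fun p q : R * R => p.2 <= q.2) by move=> p q r; exact: le_trans.
have us := order_path_min tr ss.
have := IH u (path_sorted ss) us.
set X := x + \sum_(p <- s) p.1.
suff -> : qform (fun u v => Num.min u v - l) ((x, u) :: s) =
    qform (fun v w => Num.min v w - u) s + (u - l) * X ^+ 2.
  by move=> h; rewrite addr_ge0// mulr_ge0 ?subr_ge0// sqr_ge0.
rewrite qform_cons; last by move=> v w; rewrite minC.
rewrite minxx.
have -> : \sum_(p <- s) p.1 * (Num.min p.2 u - l) = (u - l) * \sum_(p <- s) p.1.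
  rewrite mulr_sumr big_seq [RHS]big_seq; apply: eq_bigr => p ps.
  by have /allP/(_ p ps)/= up := us; rewrite min_r// mulrC.
have -> : qform (fun v w => Num.min v w - l) s =
    qform (fun v w => Num.min v w - u) s + (u - l) * (\sum_(p <- s) p.1) ^+ 2.
  rewrite expr2 mulr_suml mulr_sumr /qform -big_split; apply: eq_bigr => p _ /=.
  rewrite mulrCA mulr_sumr mulr_sumr -big_split; apply: eq_bigr => q _ /=.
  ring.
rewrite /X; ring.
Qed.

Lemma min_kernel_psd (s : seq (R * R)) : all (fun p => 0 <= p.2) s ->
  0 <= qform (fun u v => Num.min u v) s.
Proof.
move=> s0; pose r := (fun p q : R * R => p.2 <= q.2).
have tot : total r by move=> p q; exact: le_total.
have := @min_kernel_sorted (sort r s) 0 (sort_sorted tot s).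
rewrite all_sort => /(_ s0).
rewrite /qform (perm_big s) ?perm_sort//.
congr (0 <= _); apply: eq_bigr => p _; rewrite (perm_big s) ?perm_sort//.
by apply: eq_bigr => q _; rewrite subr0.
Qed.

End min_kernel.

(** * The kernels as sums over frequencies, with U = H - 1 *)

Section kernel.
Context (R : realType) (a b U : R).
Hypotheses (a0 : 0 < a) (a1 : a < 1) (b0 : 0 < b) (U0 : 0 < U) (U12 : U < 2^-1).

Definition freq (j : int) : R := b * a ^ j.
Definition rho_term (x : R) j := freq j `^ (- (2 * U)) * (1 - expR (- (freq j * x))).
(* The terms of [onsfbm_h] are nonpositive; the sign is changed here. *)
Definition onsfbm_term (x : R) j := freq j `^ (- (2 * (U + 1))) * exp_rem2 (freq j * x).
Definition rho_fun x := sumZ (rho_term x).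
Definition onsfbm_fun x := sumZ (onsfbm_term x).

Lemma freq_gt0 j : 0 < freq j.
Proof. by rewrite mulr_gt0// exprz_gt0. Qed.

Lemma exp_le1 (y : R) : 0 <= y -> expR (- y) <= 1.
Proof. by move=> y0; rewrite -expR0 ler_expR oppr_le0. Qed.

Lemma rho_term_ge0 x j : 0 <= x -> 0 <= rho_term x j.
Proof.
move=> x0; rewrite mulr_ge0 ?powR_ge0// subr_ge0 exp_le1//.
by rewrite mulr_ge0// ltW// freq_gt0.
Qed.

Lemma rho_term_le x y j : x <= y -> rho_term x j <= rho_term y j.
Proof.
move=> xy; rewrite ler_wpM2l ?powR_ge0// lerB// ler_expR lerN2.
by rewrite ler_pM2l// freq_gt0.
Qed.

Lemma rho_term_le_powN x j : rho_term x j <= freq j `^ (- (2 * U)).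
Proof. by rewrite ler_piMr ?powR_ge0// lerBlDr lerDl expR_ge0. Qed.

Lemma rho_term_le_pow x j : rho_term x j <= x * freq j `^ (1 - 2 * U).
Proof.
have c0 := freq_gt0 j.
rewrite addrC powRD; last by rewrite (gt_eqF c0) implybT.
rewrite powRr1 ?(ltW c0)// mulrCA ler_wpM2l ?powR_ge0//.
by have := expR_ge1Dx (- (freq j * x)); lra.
Qed.

Lemma expR_bound_pow (y : R) : 0 <= y -> 1 - expR (- y) <= y `^ U.
Proof.
have U1 : U <= 1 by have := U12; lra.
rewrite le_eqVlt => /predU1P[<-|y0].
  by rewrite oppr0 expR0 subrr powR_ge0.
have [y1|/ltW y1] := leP y 1.
  apply: (@le_trans _ _ y); last by apply: ger1_powR => //; rewrite y0.
  by have := expR_ge1Dx (- y); lra.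
apply: (@le_trans _ _ 1); first by rewrite lerBlDr lerDl expR_ge0.
apply: (@le_trans _ _ (1 `^ U)); first by rewrite powR1.
by rewrite ge0_ler_powR ?nnegrE ?(ltW U0)// ltW.
Qed.

(** [rho_term_le_powN] decays at high frequencies but does not vanish with x; half of its exponent
    is traded here for a factor x^U. *)
Lemma rho_term_le_pow2 x j : 0 <= x -> rho_term x j <= x `^ U * freq j `^ (- U).
Proof.
move=> x0; have c0 := freq_gt0 j.
have -> : freq j `^ (- U) = freq j `^ (- (2 * U)) * freq j `^ U.
  rewrite -powRD; last by rewrite (gt_eqF c0) implybT.
  by congr (_ `^ _); ring.
rewrite mulrCA ler_wpM2l ?powR_ge0// mulrC -powRM ?(ltW c0)//.
by apply: expR_bound_pow; rewrite mulr_ge0 ?(ltW c0).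
Qed.

Lemma summable_rho x : 0 <= x -> summableZ (rho_term x).
Proof.
move=> x0; apply: (@summableZ_powR _ a b (1 - 2 * U) (2 * U) x 1) => //.
- have := U12; lra.
- by rewrite mulr_gt0.
- by move=> n; rewrite ger0_norm ?rho_term_ge0//; exact: rho_term_le_pow.
- by move=> n; rewrite ger0_norm ?rho_term_ge0// mul1r; exact: rho_term_le_powN.
Qed.

Lemma powR_freq2 j : freq j `^ (- (2 * (U + 1))) * freq j ^+ 2 = freq j `^ (- (2 * U)).
Proof.
have c0 := freq_gt0 j.
rewrite -(powR_mulrn _ (ltW c0)) -powRD; last by rewrite (gt_eqF c0) implybT.
by congr (_ `^ _); ring.
Qed.

Lemma summable_onsfbm x : 0 <= x -> summableZ (onsfbm_term x).
Proof.
move=> x0.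
have t0 j : 0 <= onsfbm_term x j.
  by rewrite mulr_ge0 ?powR_ge0// exp_rem2_ge0// mulr_ge0// ltW// freq_gt0.
apply: (@summableZ_powR _ a b (1 - 2 * U) (2 * U) (x ^+ 3) (x ^+ 2)) => //.
- have := U12; lra.
- by rewrite mulr_gt0.
- move=> n; have c0 := freq_gt0 n; rewrite ger0_norm// -/(freq _).
  rewrite addrC powRD; last by rewrite (gt_eqF c0) implybT.
  rewrite powRr1 ?(ltW c0)// -powR_freq2.
  rewrite (_ : x ^+ 3 * _ = freq n `^ (- (2 * (U + 1))) * (freq n * x) ^+ 3); last by ring.
  by rewrite ler_wpM2l ?powR_ge0// exp_rem2_le3// mulr_ge0// ltW.
- move=> n; have c0 := freq_gt0 (Negz n); rewrite ger0_norm// -/(freq _).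
  rewrite -powR_freq2.
  rewrite (_ : x ^+ 2 * _ = freq (Negz n) `^ (- (2 * (U + 1))) * (freq (Negz n) * x) ^+ 2); last by ring.
  rewrite ler_wpM2l ?powR_ge0//; apply: (le_trans (exp_rem2_le2 _)).
  by rewrite ler_piMl ?sqr_ge0//; lra.
Qed.

Lemma rho_term0 : rho_term 0 = fun=> 0.
Proof. by apply/funext => j; rewrite /rho_term mulr0 oppr0 expR0 subrr mulr0. Qed.

Lemma sumZ0 : sumZ (fun=> 0 : R) = 0.
Proof.
rewrite (_ : (fun=> 0) = fun j => 0 * rho_term 0 j); last first.
  by apply/funext => j; rewrite mul0r.
by rewrite sumZ_scale ?mul0r//; exact: summable_rho.
Qed.

Lemma rho_fun0 : rho_fun 0 = 0.
Proof. by rewrite /rho_fun rho_term0 sumZ0. Qed.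

Lemma onsfbm_fun0 : onsfbm_fun 0 = 0.
Proof.
rewrite /onsfbm_fun (_ : onsfbm_term 0 = fun=> 0) ?sumZ0//.
apply/funext => j; rewrite /onsfbm_term mulr0 /exp_rem2 /exp_rem1 oppr0 expR0.
by ring.
Qed.

(** Termwise t^(2U) (c t)^(-2U) = c^(-2U), so the power of t disappears; at t = 0 both sides are
    0. *)
Lemma rho_hE t : 0 <= t -> t `^ (2 * U) * rho_h a b U t = rho_fun t.
Proof.
have U2 : 2 * U != 0 by rewrite mulf_neq0// gt_eqF.
rewrite le_eqVlt => /predU1P[<-|t0]; first by rewrite powR0// mul0r rho_fun0.
have -> : rho_h a b U t = t `^ (- (2 * U)) * rho_fun t.
  rewrite -sumZ_scale; last exact: summable_rho (ltW t0).
  congr sumZ; apply/funext => j; rewrite /rho_term /=.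
  by rewrite powRM ?(ltW t0)// ?(ltW (freq_gt0 j))// -/(freq j); ring.
by rewrite powRN mulrA divff ?mul1r// gt_eqF// powR_gt0.
Qed.

Lemma onsfbm_hE t : 0 <= t -> t `^ (2 * (U + 1)) * onsfbm_h a b (U + 1) t = - onsfbm_fun t.
Proof.
have U2 : 2 * (U + 1) != 0 by rewrite mulf_neq0// gt_eqF// addr_gt0.
rewrite le_eqVlt => /predU1P[<-|t0]; first by rewrite powR0// mul0r onsfbm_fun0 oppr0.
have -> : onsfbm_h a b (U + 1) t = - t `^ (- (2 * (U + 1))) * onsfbm_fun t.
  rewrite -sumZ_scale; last exact: summable_onsfbm (ltW t0).
  congr sumZ; apply/funext => j; rewrite /onsfbm_term /=.
  rewrite powRM ?(ltW t0)// ?(ltW (freq_gt0 j))// -/(freq j).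
  by rewrite /exp_rem2 /exp_rem1; ring.
by rewrite powRN mulNr mulrN mulrA divff ?mul1r// gt_eqF// powR_gt0.
Qed.

Lemma rho_covE s t : 0 <= s -> 0 <= t ->
  rho_cov a b U s t = 2^-1 * (rho_fun (s + t) - rho_fun `|s - t|).
Proof. by move=> s0 t0; rewrite /rho_cov !rho_hE// addr_ge0. Qed.

Lemma onsfbm_covE s t : 0 <= s -> 0 <= t ->
  onsfbm_cov a b (U + 1) s t =
  2^-1 * (onsfbm_fun (s + t) + onsfbm_fun `|s - t|) - onsfbm_fun s - onsfbm_fun t.
Proof. by move=> s0 t0; rewrite /onsfbm_cov !onsfbm_hE// ?addr_ge0//; ring. Qed.

Lemma rho_fun_ge0 x : 0 <= x -> 0 <= rho_fun x.
Proof. by move=> x0; apply: sumZ_ge0 => [|j]; [exact: summable_rho|exact: rho_term_ge0]. Qed.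

(** 1 - e^(-c x) is nondecreasing and subadditive, the latter being (1 - p) (1 - p') >= 0 for two
    exponentials p and p'; such a function is its own modulus of continuity. *)
Lemma rho_term_subadd x y z j : 0 <= x -> 0 <= y -> `|x - y| <= z ->
  `|rho_term x j - rho_term y j| <= rho_term z j.
Proof.
wlog yx : x y / y <= x => [H|] x0 y0 xyz.
  case: (leP y x) => [yx|/ltW xy]; first exact: H.
  by rewrite distrC; apply: H => //; rewrite distrC.
rewrite ger0_norm ?subr_ge0 ?rho_term_le//.
apply: (@le_trans _ _ (rho_term (x - y) j)); last first.
  by apply: rho_term_le; apply: le_trans xyz; exact: ler_norm.
have c0 := freq_gt0 j.
rewrite /rho_term -mulrBr ler_wpM2l ?powR_ge0//.
have -> : expR (- (freq j * x)) = expR (- (freq j * y)) * expR (- (freq j * (x - y))).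
  by rewrite -expRD; congr expR; ring.
have h1 : expR (- (freq j * y)) <= 1 by rewrite exp_le1// mulr_ge0// ltW.
have h2 : expR (- (freq j * (x - y))) <= 1 by rewrite exp_le1// mulr_ge0 ?subr_ge0// ltW.
have h3 : 0 <= (1 - expR (- (freq j * y))) * (1 - expR (- (freq j * (x - y)))).
  by rewrite mulr_ge0// subr_ge0.
lra.
Qed.

Lemma rho_fun_subadd x y z : 0 <= x -> 0 <= y -> `|x - y| <= z ->
  `|rho_fun x - rho_fun y| <= rho_fun z.
Proof.
move=> x0 y0 xyz; have z0 : 0 <= z := le_trans (normr_ge0 _) xyz.
rewrite /rho_fun -sumZB; try exact: summable_rho.
apply: sumZ_norm_le => [||j]; last exact: rho_term_subadd.
  by apply: summableZB; exact: summable_rho.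
exact: summable_rho.
Qed.

(** Both s + t and |s - t| move by at most |s - s'| + |t - t'|, and the factor 1/2 compensates for
    the two terms. *)
Lemma rho_cov_modulus s t s' t' : 0 <= s -> 0 <= t -> 0 <= s' -> 0 <= t' ->
  `|rho_cov a b U s t - rho_cov a b U s' t'| <= rho_fun (`|s - s'| + `|t - t'|).
Proof.
move=> s0 t0 s'0 t'0; rewrite !rho_covE//.
set z := `|s - s'| + `|t - t'|.
have h1 : `|rho_fun (s + t) - rho_fun (s' + t')| <= rho_fun z.
  apply: rho_fun_subadd; rewrite ?addr_ge0//.
  rewrite (_ : s + t - _ = (s - s') + (t - t')); last by ring.
  exact: ler_normD.
have h2 : `|rho_fun `|s - t| - rho_fun `|s' - t'| | <= rho_fun z.
  apply: rho_fun_subadd => //.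
  apply: (le_trans (ler_dist_dist _ _)).
  rewrite (_ : s - t - _ = (s - s') - (t - t')); last by ring.
  exact: ler_normB.
set p := rho_fun (s + t) in h1 *; set p' := rho_fun (s' + t') in h1 *.
set r := rho_fun `|s - t| in h2 *; set r' := rho_fun `|s' - t'| in h2 *.
rewrite (_ : _ - _ = 2^-1 * (p - p') - 2^-1 * (r - r')); last by ring.
apply: (le_trans (ler_normB _ _)); rewrite !normrM gtr0_norm ?invr_gt0//.
lra.
Qed.

(** q is 2^(-U): for x <= 2 / 2^n both x and x^U are at most 2 q^n. *)
Lemma rho_fun_dyadic : exists M q : R, [/\ 0 <= M, 0 < q < 1 &
  forall n x, 0 <= x -> x <= 2 / (2 ^ n)%:R -> rho_fun x <= M * q ^+ n].
Proof.
(* Each majorant is supported on the half where it is summable: c^(1 - 2U) at low frequencies,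
   c^(-U) at high ones. *)
pose p1 (j : int) : R := if j is Posz _ then freq j `^ (1 - 2 * U) else 0.
pose p2 (j : int) : R := if j is Posz _ then 0 else freq j `^ (- U).
have U21 : 0 < 1 - 2 * U by have := U12; lra.
have sp1 : summableZ p1.
  apply: (@summableZ_powR _ a b (1 - 2 * U) U 1 0) => // n.
    by rewrite ger0_norm ?powR_ge0// mul1r.
  by rewrite normr0 mul0r.
have sp2 : summableZ p2.
  apply: (@summableZ_powR _ a b (1 - 2 * U) U 0 1) => // n.
    by rewrite normr0 mul0r.
  by rewrite ger0_norm ?powR_ge0// mul1r.
have s10 : 0 <= sumZ p1 by apply: sumZ_ge0 => // -[n|n] /=; rewrite ?powR_ge0.
have s20 : 0 <= sumZ p2 by apply: sumZ_ge0 => // -[n|n] /=; rewrite ?powR_ge0.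
have bound x : 0 <= x -> rho_fun x <= x * sumZ p1 + x `^ U * sumZ p2.
  move=> x0; rewrite -!sumZ_scale// -sumZD; try exact: summableZ_scale.
  apply: sumZ_le; [exact: summable_rho|by apply: summableZD; exact: summableZ_scale|].
  move=> [n|n] /=; rewrite mulr0 ?addr0 ?add0r; first exact: rho_term_le_pow.
  exact: rho_term_le_pow2.
pose q : R := 2^-1 `^ U.
have U1 : U <= 1 by have := U12; lra.
have q0 : 0 < q by rewrite powR_gt0// invr_gt0.
have q1 : q < 1.
  by apply: powR_lt1 => //; lra.
have q2 : 2^-1 <= q by apply: ger1_powR => //; apply/andP; split; lra.
exists (2 * (sumZ p1 + sumZ p2)), q; split; [by rewrite mulr_ge0// addr_ge0|by rewrite q0|].
move=> n x x0 xn; have n0 : 0 < (2 ^ n)%:R :> R by rewrite ltr0n expn_gt0.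
apply: (le_trans (bound x x0)).
have e1 : x <= 2 * q ^+ n.
  apply: (le_trans xn); rewrite ler_pM2l// natrX -exprVn.
  by rewrite lerXn2r ?nnegrE ?invr_ge0// ltW.
have e2 : x `^ U <= 2 * q ^+ n.
  apply: (@le_trans _ _ ((2 / (2 ^ n)%:R) `^ U)).
    by rewrite ge0_ler_powR ?nnegrE ?(ltW U0)// divr_ge0// ltW.
  rewrite powRM ?invr_ge0// ?(ltW n0)//; apply: ler_pM; rewrite ?powR_ge0//.
    by apply: ler1_powR => //; rewrite ler1n.
  by rewrite natrX -exprVn powR_exprn ?invr_ge0.
have := ler_wpM2r s10 e1; have := ler_wpM2r s20 e2; lra.
Qed.

Lemma rho_fun_cvg0 (u : nat -> R) : (forall n, 0 <= u n) -> u n @[n --> \oo] --> 0 ->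
  rho_fun (u n) @[n --> \oo] --> 0.
Proof.
move=> u0 uc; have [M [q [M0 /andP[q0 q1] h]]] := rho_fun_dyadic.
apply/cvgrPdist_lt => e e0.
have qn : M * q ^+ n @[n --> \oo] --> (0 : R).
  by rewrite -(mulr0 M); apply: cvgMr; apply: cvg_expr; rewrite ger0_norm ?ltW.
move/cvgrPdist_lt : qn => /(_ _ e0) [m _ /(_ m (leqnn _))].
rewrite /= sub0r normrN => hm.
have d0 : 0 < 2 / (2 ^ m)%:R :> R by rewrite divr_gt0// ltr0n expn_gt0.
move/cvgrPdist_le : uc => /(_ _ d0); apply: filterS => n.
rewrite !sub0r !normrN !ger0_norm ?rho_fun_ge0// => un.
by apply: le_lt_trans (h _ _ (u0 n) un) _; apply: le_lt_trans hm; exact: ler_norm.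
Qed.

Lemma rho_cov_sym s t : rho_cov a b U s t = rho_cov a b U t s.
Proof. by rewrite /rho_cov [t + s]addrC [ `|t - s| ]distrC. Qed.

Lemma onsfbm_cov_sym s t : onsfbm_cov a b (U + 1) s t = onsfbm_cov a b (U + 1) t s.
Proof.
rewrite /onsfbm_cov [t + s]addrC [ `|t - s| ]distrC; congr (_ - _).
by rewrite addrC.
Qed.

Lemma rho_cov_psd (s : seq (R * R)) : all (fun p => 0 <= p.2) s ->
  0 <= qform (rho_cov a b U) s.
Proof.
(* The absolute values make the series converge for all real arguments; on the list s they have no
   effect. *)
move=> s0; pose k (j : int) (u v : R) := 2^-1 * (rho_term (`|u| + `|v|) j - rho_term `| `|u| - `|v| | j).
have sk u v : summableZ (fun j => k j u v).
  by apply: summableZ_scale; apply: summableZB; apply: summable_rho; rewrite ?addr_ge0.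
have -> : qform (rho_cov a b U) s = sumZ (fun j => qform (k j) s).
  rewrite /qform sumZ_sum; last first.
    by move=> p; apply: summableZ_sum => q; exact: summableZ_scale.
  rewrite big_seq [RHS]big_seq; apply: eq_bigr => p ps.
  rewrite sumZ_sum; last by move=> q; exact: summableZ_scale.
  rewrite big_seq [RHS]big_seq; apply: eq_bigr => q qs.
  have /allP s0' := s0; have p0 := s0' _ ps; have q0 := s0' _ qs.
  rewrite sumZ_scale// rho_covE// sumZ_scale; last first.
    by apply: summableZB; apply: summable_rho; rewrite ?addr_ge0.
  rewrite sumZB; try by apply: summable_rho; rewrite ?addr_ge0.
  by rewrite !(ger0_norm p0) !(ger0_norm q0).
apply: sumZ_ge0.
  by apply: summableZ_sum => p; apply: summableZ_sum => q; exact: summableZ_scale.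
move=> j; have c0 := freq_gt0 j.
pose m u := 2^-1 * (expR (2 * freq j * u) - 1).
have m_le u v : u <= v -> m u <= m v.
  move=> uv; rewrite /m ler_pM2l ?invr_gt0// lerD2r ler_expR ler_pM2l// mulr_gt0//.
have kE u v : 0 <= u -> 0 <= v -> k j u v =
    freq j `^ (- (2 * U)) * (expR (- (freq j * u)) * expR (- (freq j * v)) * Num.min (m u) (m v)).
  wlog uv : u v / u <= v => [H u0 v0|u0 v0].
    case: (leP u v) => [uv|/ltW vu]; first exact: H.
    by rewrite minC (mulrC (expR (- (freq j * u)))) -H// /k [ `|u| + _]addrC [ `| `|u| - _ |]distrC.
  rewrite min_l ?m_le// /k (ger0_norm u0) (ger0_norm v0) distrC ger0_norm ?subr_ge0//.
  rewrite /rho_term /m.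
  have -> : expR (- (freq j * (u + v))) = expR (- (freq j * u)) * expR (- (freq j * v)).
    by rewrite -expRD; congr expR; ring.
  have -> : expR (- (freq j * (v - u))) =
      expR (- (freq j * u)) * expR (- (freq j * v)) * expR (2 * freq j * u).
    by rewrite -!expRD; congr expR; ring.
  ring.
(* The exponential factors go into the coefficients, and m acts as a change of time in the Brownian
   covariance. *)
have -> : qform (k j) s = freq j `^ (- (2 * U)) *
    qform (fun u v => Num.min u v) [seq (p.1 * expR (- (freq j * p.2)), m p.2) | p <- s].
  rewrite /qform big_map mulr_sumr big_seq [RHS]big_seq; apply: eq_bigr => p ps.
  rewrite big_map mulr_sumr big_seq [RHS]big_seq; apply: eq_bigr => q qs.
  have /allP s0' := s0.
  by rewrite kE ?(s0' _ ps) ?(s0' _ qs)//=; ring.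
rewrite mulr_ge0 ?powR_ge0//; apply: min_kernel_psd; rewrite all_map.
apply: sub_all s0 => p /= p0; rewrite /m mulr_ge0 ?invr_ge0// subr_ge0 -[X in X <= _]expR0 ler_expR.
by rewrite mulr_ge0// mulr_ge0// ltW.
Qed.

(* [E''] below is [rho_term `|.| j], so [rho_fun `|.|] plays the role of the second
   derivative of the even extension of [onsfbm_fun]. *)
Lemma onsfbm_second_difference (x h k y : R) : 0 <= h -> 0 <= k -> x <= y <= x + h + k ->
  `|onsfbm_fun `|x + h + k| - onsfbm_fun `|x + k| - (onsfbm_fun `|x + h| - onsfbm_fun `|x|)
    - h * k * rho_fun `|y| | <= h * k * rho_fun (h + k).
Proof.
move=> h0 k0 /andP[xy yx].
have S (z : R) := summable_onsfbm (normr_ge0 z).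
have hk0 : 0 <= h + k by rewrite addr_ge0.
have S1 := summableZB (S (x + h + k)) (S (x + k)).
have S2 := summableZB (S (x + h)) (S x).
have Sy := summableZ_scale (h * k) (summable_rho (normr_ge0 y)).
have Shk := summableZ_scale (h * k) (summable_rho hk0).
rewrite /onsfbm_fun /rho_fun -(sumZ_scale _ (summable_rho (normr_ge0 y))).
rewrite -(sumZ_scale _ (summable_rho hk0)) -(sumZB (S (x + h + k)) (S (x + k))).
rewrite -(sumZB (S (x + h)) (S x)) -(sumZB S1 S2) -(sumZB (summableZB S1 S2) Sy).
apply: sumZ_norm_le => [||j]; [exact: (summableZB (summableZB S1 S2) Sy)|exact: Shk|].
have c0 := freq_gt0 j.
pose E z := freq j `^ (- (2 * (U + 1))) * even_rem2 (freq j * z).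
pose E1 z := freq j `^ (- (2 * (U + 1))) * (freq j * odd_rem1 (freq j * z)).
have dE (z : R) : is_derive z (1 : R) E (E1 z).
  exact: (is_derive_scaled_comp _ _ _ (@is_derive_even_rem2 R)).
have dE1 (z : R) : is_derive z (1 : R) E1 (rho_term `|z| j).
  rewrite (_ : E1 = fun z => freq j `^ (- (2 * (U + 1))) * freq j * odd_rem1 (freq j * z)).
    apply: is_derive_eq (is_derive_scaled_comp _ _ _ (@is_derive_odd_rem1 R)) _.
    by rewrite /rho_term -powR_freq2 normrM (gtr0_norm c0); ring.
  by apply/funext => u; rewrite /E1 mulrA.
have EE z : onsfbm_term `|z| j = E z by rewrite /onsfbm_term /E /even_rem2 normrM (gtr0_norm c0).
rewrite !EE.
(* The point xi depends on the frequency, so it is compared with the fixed y: both lie in an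
   interval of length h + k, at a cost that can be summed over j. *)
have [xi /andP[x1 x2] e] := second_difference x dE dE1 h0 k0.
rewrite (_ : E (x + h + k) - E (x + k) - (E (x + h) - E x) =
  E (x + h + k) - E (x + k) - E (x + h) + E x); last by ring.
rewrite e -mulrBr normrM ger0_norm ?mulr_ge0// ler_wpM2l ?mulr_ge0//.
apply: rho_term_subadd => //; apply: (le_trans (ler_dist_dist _ _)).
by rewrite ler_norml; apply/andP; split; lra.
Qed.

(** The terms in one variable cancel. The part in s + t is a second difference based at s + t; the
    part in s - t is the opposite of one based at s - t - k, as s - t decreases in t, whence the
    minus sign in [rho_cov]. *)
Lemma onsfbm_cell s t h k : 0 <= s -> 0 <= t -> 0 <= h -> 0 <= k ->
  let C := onsfbm_cov a b (U + 1) in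
  `|(C (s + h) (t + k) - C s (t + k)) - (C (s + h) t - C s t)
     - h * k * rho_cov a b U s t| <= h * k * rho_fun (h + k).
Proof.
move=> s0 t0 h0 k0 /=.
rewrite !onsfbm_covE ?addr_ge0// rho_covE//.
have st0 : 0 <= s + t by rewrite addr_ge0.
have := @onsfbm_second_difference (s + t) h k (s + t) h0 k0.
have -> : s + t <= s + t <= s + t + h + k by apply/andP; split; lra.
move=> /(_ isT).
rewrite (ger0_norm st0) (ger0_norm (addr_ge0 st0 h0)) (ger0_norm (addr_ge0 st0 k0)).
rewrite (ger0_norm (addr_ge0 (addr_ge0 st0 h0) k0)).
have := @onsfbm_second_difference (s - t - k) h k (s - t) h0 k0.
have -> : s - t - k <= s - t <= s - t - k + h + k by apply/andP; split; lra.
move=> /(_ isT).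
rewrite (_ : s - t - k + h + k = s + h - t); last by ring.
rewrite (_ : s - t - k + k = s - t); last by ring.
rewrite (_ : s - t - k + h = s + h - (t + k)); last by ring.
rewrite (_ : s - t - k = s - (t + k)); last by ring.
rewrite (_ : s + t + h + k = s + h + (t + k)); last by ring.
rewrite (_ : s + t + k = s + (t + k)); last by ring.
rewrite (_ : s + t + h = s + h + t); last by ring.
rewrite !ler_norml; move: onsfbm_fun rho_fun => F G /andP[? ?] /andP[? ?].
by apply/andP; split; lra.
Qed.

(** Vanishing on the axes leaves only the corner value (s, t) when the mixed differences are summed
    over a rectangle. *)
Lemma onsfbm_cov0l t : 0 <= t -> onsfbm_cov a b (U + 1) 0 t = 0.
Proof.
by move=> t0; rewrite onsfbm_covE// onsfbm_fun0 sub0r normrN (ger0_norm t0) add0r; field.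
Qed.

Lemma onsfbm_cov0r t : 0 <= t -> onsfbm_cov a b (U + 1) t 0 = 0.
Proof. by move=> t0; rewrite onsfbm_cov_sym onsfbm_cov0l. Qed.

Lemma onsfbm_riemann s t : 0 <= s -> 0 <= t ->
  (s / n.+1%:R) * (t / n.+1%:R) *
  \sum_(0 <= k < n.+1) \sum_(0 <= l < n.+1)
    rho_cov a b U (k%:R * (s / n.+1%:R)) (l%:R * (t / n.+1%:R))
  @[n --> \oo] --> onsfbm_cov a b (U + 1) s t.
Proof.
move=> s0 t0.
(* The (n + 1)^2 cell errors h h' F(h + h') add up to exactly s t F((s + t) / (n + 1)). *)
have key n : let h := s / n.+1%:R in let h' := t / n.+1%:R in
    `|onsfbm_cov a b (U + 1) s t - h * h' * \sum_(0 <= k < n.+1) \sum_(0 <= l < n.+1)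
    rho_cov a b U (k%:R * h) (l%:R * h')| <= s * t * rho_fun ((s + t) * n.+1%:R^-1).
  move=> /=; set h := s / _; set h' := t / _; set N := n.+1.
  have N0 : N%:R != 0 :> R by rewrite pnatr_eq0.
  have h0 : 0 <= h by rewrite divr_ge0.
  have h'0 : 0 <= h' by rewrite divr_ge0.
  pose A k l := onsfbm_cov a b (U + 1) (k%:R * h) (l%:R * h').
  have hs : N%:R * h = s by rewrite /h mulrCA divff ?mulr1.
  have ht : N%:R * h' = t by rewrite /h' mulrCA divff ?mulr1.
  have -> : onsfbm_cov a b (U + 1) s t = \sum_(0 <= k < N) \sum_(0 <= l < N)
      ((A k.+1 l.+1 - A k l.+1) - (A k.+1 l - A k l)).
    under eq_bigr => k _ do rewrite (telescope_sumr (fun l => A k.+1 l - A k l))//.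
    rewrite sumrB !telescope_sumr// /A !mul0r hs ht !onsfbm_cov0l//.
    by rewrite !onsfbm_cov0r// !subr0.
  rewrite mulr_sumr -sumrB; apply: (le_trans (ler_norm_sum _ _ _)).
  apply: (@le_trans _ _ (\sum_(0 <= k < N) \sum_(0 <= l < N) h * h' * rho_fun (h + h'))).
    apply: ler_sum => k _; rewrite mulr_sumr -sumrB; apply: (le_trans (ler_norm_sum _ _ _)).
    apply: ler_sum => l _; rewrite /A -!natr1 !mulrDl !mul1r.
    by apply: onsfbm_cell; rewrite ?mulr_ge0.
  have cancel (x y z f : R) : z != 0 -> z * (z * (x / z * (y / z) * f)) = x * y * f.
    by move=> z0; field.
  have mulrnn (X : R) m : X *+ m *+ m = m%:R * (m%:R * X) by rewrite !mulr_natl.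
  by rewrite !sumr_const_nat subn0 /h /h' -mulrDl mulrnn cancel.
apply/cvgrPdist_le => e e0.
have u0 n : 0 <= (s + t) * n.+1%:R^-1 by rewrite divr_ge0// addr_ge0.
have uc : (s + t) * n.+1%:R^-1 @[n --> \oo] --> (0 : R).
  by rewrite -[X in _ --> X](mulr0 (s + t)); apply: cvgMr; exact: cvg_harmonic.
have := rho_fun_cvg0 u0 uc.
have e'0 : 0 < e / (s * t + 1) by rewrite divr_gt0// ltr_wpDl// mulr_ge0.
move/cvgrPdist_le => /(_ _ e'0); apply: filterS => n.
rewrite sub0r normrN ger0_norm ?rho_fun_ge0// => hn.
apply: (le_trans (key n)).
have st0 : 0 <= s * t by rewrite mulr_ge0.
apply: (le_trans (ler_wpM2l st0 hn)).
rewrite mulrCA ler_piMr ?(ltW e0)// ler_pdivrMr ?ltr_wpDl//.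
by rewrite mul1r lerDl.
Qed.

End kernel.

Theorem proposition2p16 (R : realType) (a b H : R)
    (a_gt0 : 0 < a) (a_lt1 : a < 1) (b_gt0 : 0 < b)
    (H_gt1 : 1 < H) (H_lt32 : H < 3 / 2) :
  exists (d : measure_display) (T : measurableType d) (P : probability T R)
         (rho : R -> T -> R),
    rho_process P a b (H - 1) rho /\
    onsfbm P a b H
      (fun t w => Rintegral lebesgue_measure `[0, t] (fun u => rho u w)).
Proof.
set U := H - 1.
have U0 : 0 < U by rewrite subr_gt0.
have U12 : U < 2^-1 by rewrite /U; lra.
have HU : H = U + 1 by rewrite /U subrK.
have [M [q [M0 q01 dyad]]] := rho_fun_dyadic a_gt0 a_lt1 b_gt0 U0 U12.
have [] := @continuous_gaussian_family R (rho_cov a b U) M q _ _ M0 q01.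
- exact: rho_cov_sym.
- by move=> s; exact: rho_cov_psd.
- move=> n s t s' t' s0 t0 s'0 t'0 st.
  apply: (le_trans (rho_cov_modulus a_gt0 a_lt1 b_gt0 U0 U12 s0 t0 s'0 t'0)).
  by apply: dyad => //; rewrite addr_ge0.
move=> d [T [P [X [gX Xu]]]]; exists d, T, P, X; split; first split.
- move=> w; apply: dist_within_continuous => x e.
  rewrite /= in_itv/= andbT => x0 e0.
  (* The bound exceeds x by at least 1, so that points at distance less than 1 from x stay within
     the range of uniform continuity. *)
  have [del del0 hd] := Xu w (Num.truncn (x + 1)).+1 e e0.
  have xN : x + 1 <= (Num.truncn (x + 1)).+1%:R.
    by have /andP[_ /ltW] := truncn_itv (addr_ge0 x0 ler01).
  exists (Num.min del 1); first by rewrite lt_min del0 ltr01.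
  move=> y; rewrite in_itv/= andbT lt_min => y0 /andP[xy xy1].
  apply: hd => //; apply: le_trans xN; first by rewrite lerDl.
  by have := ler_norm (y - x); rewrite distrC; lra.
- by apply: gaussian_family_process gX; exact: rho_cov_sym.
- rewrite /onsfbm HU; apply: gaussian_family_process; first exact: onsfbm_cov_sym.
  apply: (gaussian_family_integral gX Xu) => s t s0 t0.
  exact: onsfbm_riemann.
Qed.
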